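(* Let $V\in C^2(\mathbb{T}^d)$ and let $u:\mathbb{T}^d\to\mathbb{R}$ be a semiconcave viscosity solution of $$\frac12|Du(x)|^2+V(x)=0\qquad(x\in\mathbb{T}^d).$$ If $x_0\in\mathrm{Sing}(u)$, then $\mathbf{x}_u(t,x_0)\in\mathrm{Sing}(u)$ for all $t\ge0$.
   Context: $\mathbb{T}^d=\mathbb{R}^d/\mathbb{Z}^d$ is the flat torus; functions on $\mathbb{T}^d$ are identified with their $\mathbb{Z}^d$-periodic extensions to $\mathbb{R}^d$. A continuous $u:\mathbb{T}^d\to\mathbb{R}$ is semiconcave if there is $C>0$ with $\lambda u(x)+(1-\lambda)u(y)-u(\lambda x+(1-\lambda)y)\le \frac C2\lambda(1-\lambda)|x-y|^2$ for all $x,y$ and $\lambda\in[0,1]$. The superdifferential is $D^+u(x)=\{p\in\mathbb{R}^d:\limsup_{y\to x}\frac{u(y)-u(x)-\langle p,y-x\rangle}{|y-x|}\le0\}$ and the subdifferential is $D^-u(x)=\{p\in\mathbb{R}^d:\liminf_{y\to x}\frac{u(y)-u(x)-\langle p,y-x\rangle}{|y-x|}\ge0\}$. $u$ is a viscosity solution of $\frac12|Du|^2+V=0$ if $\frac12|p|^2+V(x)\le0$ for all $x$ and $p\in D^+u(x)$, and $\frac12|p|^2+V(x)\ge0$ for all $x$ and $p\in D^-u(x)$. (The critical constant $\max V$ has been absorbed into the potential, so that $\max_{\mathbb{T}^d}V=0$.) $\mathrm{Sing}(u)$ is the set of points of $\mathbb{T}^d$ where $u$ is not differentiable. The generalized gradient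 flow $\mathbf{x}_u(\cdot,x):[0,\infty)\to\mathbb{T}^d$ is the unique locally Lipschitz solution of $\dot{\mathbf{x}}(t)\in D^+u(\mathbf{x}(t))$ for a.e. $t\ge0$, $\mathbf{x}(0)=x$. *)

(* Defs.v *)
From HB Require Import structures.
From mathcomp Require Import all_boot all_order all_algebra.
Set Warnings "-notation-overridden,-notation-incompatible-prefix".
From mathcomp Require Import all_classical all_reals all_analysis.

Set Implicit Arguments.
Unset Strict Implicit.
Unset Printing Implicit Defensive.

Import Order.TTheory GRing.Theory Num.Theory.
Import numFieldNormedType.Exports.

Local Open Scope classical_set_scope.
Local Open Scope ring_scope.

Section Defs.
Variables (R : realType) (d : nat).
Implicit Types (u V : 'rV[R]_d -> R) (x y p : 'rV[R]_d).

(* The library norm `|x| on 'rV[R]_d is the sup norm: it provides the topology,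
   differentiability and Lipschitz continuity, which agree for all norms.
   Metric quantities use the Euclidean norm below. *)
Definition dotv x y : R := \sum_(i < d) x 0 i * y 0 i.

Definition enorm x : R := Num.sqrt (dotv x x).

(* Objects on the torus R^d / Z^d are represented by their lifts: functions by
   their periodic extensions, points and curves by lifts to R^d. *)
Definition Zperiodic u : Prop :=
  forall (k : 'rV[int]_d) x, u (x + map_mx intr k) = u x.

Fixpoint Ck (k : nat) u : Prop :=
  continuous u /\
  if k is k'.+1 then
    forall i : 'I_d, (forall x, derivable u x (delta_mx 0 i)) /\
                     Ck k' (fun x => 'D_(delta_mx 0 i) u x)
  else True.

Definition semiconcave u : Prop :=
  continuous u /\
  exists2 C : R, 0 < C &
    forall x y (l : R), 0 <= l <= 1 ->
      l * u x + (1 - l) * u y - u (l *: x + (1 - l) *: y)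
        <= C / 2 * l * (1 - l) * enorm (x - y) ^+ 2.

Definition diff_quotient u x p : 'rV[R]_d -> \bar R :=
  fun y => ((u y - u x - dotv p (y - x)) / enorm (y - x))%:E.

Definition superdifferential u x : set 'rV[R]_d :=
  [set p | (limf_esup (diff_quotient u x p) x^' <= 0)%E].

Definition subdifferential u x : set 'rV[R]_d :=
  [set p | (0 <= limf_einf (diff_quotient u x p) x^')%E].

Definition viscosity_solution V u : Prop :=
  [/\ continuous u,
      forall x p, superdifferential u x p -> 2^-1 * enorm p ^+ 2 + V x <= 0
    & forall x p, subdifferential u x p -> 0 <= 2^-1 * enorm p ^+ 2 + V x].

Definition Sing u : set 'rV[R]_d := [set x | ~ differentiable u x].

Definition locally_lipschitz (A : set R) (xi : R -> 'rV[R]_d) : Prop :=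
  forall t, A t -> exists2 U : set R, nbhs t U & [lipschitz xi s | s in A `&` U].

(* xi is the curve t |-> x_u(t, x); its values at negative times are
   irrelevant. *)
Definition generalized_gradient_flow u x (xi : R -> 'rV[R]_d) : Prop :=
  [/\ xi 0 = x,
      locally_lipschitz [set t | 0 <= t] xi
    & {ae (@lebesgue_measure R), forall t, 0 <= t ->
        derivable xi t 1 /\ superdifferential u (xi t) (derive1 xi t)}].

End Defs.

(* Main.v *)
Require Import Defs.
From HB Require Import structures.
From mathcomp Require Import all_boot all_order all_algebra.
From mathcomp Require Import ring lra.
From mathcomp Require Import all_classical all_reals all_analysis.
Import Order.TTheory GRing.Theory Num.Theory.
Import numFieldNormedType.Exports.
Local Open Scope classical_set_scope.
Local Open Scope ring_scope.

Set Implicit Arguments.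
Unset Strict Implicit.
Unset Printing Implicit Defensive.

(* For p in D^+u(x), the defect -(|p|^2/2 + V(x)) is nonnegative, and x is singular
   iff it is positive for some p. One shows that the largest defect decays at most
   exponentially along the generalized gradient flow. Let u_e be the
   sup-convolution of u and psi = -(|Du_e|^2/2 + V).

   If p is in D^+u(y), then for small s
     u(y - s v) <= u(y) - s <p,v> + s^2 (<DV,p>/2 - <DV,v>
                    + (C/2)(-2V - 2<p,v> + |v|^2) + o(1)).
   This follows from the Lax-Oleinik formula with the action of straight segments
   in place of the true action, which determines u up to a term s^3 |DV|^2 / 24
   and an error O(s^4). For v = p the factor of C/2 is twice the defect.
   Since u_e is C^{1,1}, the bound passes to the derivative of u_e along its own
   gradient and yields psi(x + h Du_e(x)) >= psi(x) - h (2C psi(x) + O(e)).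

   To compare the flow of Du_e with the generalized flow xi, one follows the
   maximum over x of a(t) psi(x) - N b(t) |x - xi(t)|^2: the one-sided
   Lipschitz bound on D^+u lets it decrease at a rate O(e) only, at almost every t.
   At the initial time, the point xi(t0) - e p0 with p0 of positive defect bounds this
   maximum from below; if u were differentiable at xi(T), then D^+u near xi(T)
   would be close to a momentum with zero defect, contradicting the lower bound
   at time T for large N and small e. *)

(** * Euclidean geometry and real analysis *)

(** The obstacle is that D^+u is multivalued at singular points, so the defect has no derivative
    along the flow that could be estimated directly. The sup-convolution gives a gradient that is
    Lipschitz at fixed e, belongs to D^+u at a point within O(e), and takes a prescribed value p of
    D^+u(y) exactly at y - e p. Its constants of order 1/e are harmless, since they only multiply
    steps h that tend to 0 before e does. Straight segments reduce the Lax-Oleinik formula to an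
    optimization in R^d, where compactness provides minimizers. Their action fails to solve the
    Hamilton-Jacobi equation by s^2 |DV|^2 / 8, whose time integral is the s^3 term. That term has
    to be identified: values at y and y + b with b of order k s^2 are compared and the difference is
    divided by k s, so an unknown error s^3 would leave s^2 / k instead of o(s^2). Trajectories of
    Du_e are never constructed. A maximizer x at time t is moved to x + h Du_e(x), which competes at
    time t + h; such single steps combine with a bound at all times to tolerate the null set where
    the flow equation fails. *)

Section Euclid.
Variables (R : realType) (d : nat).
Implicit Types (x y z : 'rV[R]_d) (a : R).

Lemma dotvC x y : dotv x y = dotv y x.
Proof. by apply: eq_bigr => i _; rewrite mulrC. Qed.

Lemma dotvDl x y z : dotv (x + y) z = dotv x z + dotv y z.
Proof. by rewrite -big_split /=; apply: eq_bigr => i _; rewrite mxE mulrDl. Qed.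

Lemma dotvZl a x y : dotv (a *: x) y = a * dotv x y.
Proof. by rewrite mulr_sumr; apply: eq_bigr => i _; rewrite mxE mulrA. Qed.

Lemma dotvDr x y z : dotv z (x + y) = dotv z x + dotv z y.
Proof. by rewrite dotvC dotvDl !(dotvC z). Qed.

Lemma dotvZr a x y : dotv x (a *: y) = a * dotv x y.
Proof. by rewrite dotvC dotvZl dotvC. Qed.

Lemma dotvNl x y : dotv (- x) y = - dotv x y.
Proof. by rewrite -scaleN1r dotvZl mulN1r. Qed.

Lemma dotvNr x y : dotv x (- y) = - dotv x y.
Proof. by rewrite dotvC dotvNl dotvC. Qed.

Lemma dotv0l x : dotv 0 x = 0.
Proof. by rewrite -(scale0r 0) dotvZl mul0r. Qed.

Lemma dotv0r x : dotv x 0 = 0.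
Proof. by rewrite dotvC dotv0l. Qed.

Definition dotvE := (dotvDl, dotvDr, dotvNl, dotvNr, dotvZl, dotvZr,
  dotv0l, dotv0r).

Lemma dotv_ge0 x : 0 <= dotv x x.
Proof. by apply: sumr_ge0 => i _; rewrite -expr2 sqr_ge0. Qed.

Lemma enorm_ge0 x : 0 <= enorm x.
Proof. exact: sqrtr_ge0. Qed.

Lemma enorm_sqr x : enorm x ^+ 2 = dotv x x.
Proof. by rewrite sqr_sqrtr // dotv_ge0. Qed.

Lemma dotv_eq0 x : dotv x x = 0 -> x = 0.
Proof.
move=> /eqP; rewrite psumr_eq0 => [/allP h|i _]; last by rewrite -expr2 sqr_ge0.
apply/rowP => i; rewrite mxE.
by have := h i (mem_index_enum i); rewrite /= mulf_eq0 orbb => /eqP.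
Qed.

Lemma enorm0 : enorm (0 : 'rV[R]_d) = 0.
Proof. by rewrite /enorm dotv0l sqrtr0. Qed.

Lemma enorm_eq0 x : enorm x = 0 -> x = 0.
Proof. by move=> h; apply: dotv_eq0; rewrite -enorm_sqr h expr0n. Qed.

Lemma enormZ a x : enorm (a *: x) = `|a| * enorm x.
Proof.
by rewrite /enorm dotvZl dotvZr mulrA -expr2 sqrtrM ?sqr_ge0 // sqrtr_sqr.
Qed.

Lemma enormN x : enorm (- x) = enorm x.
Proof. by rewrite -scaleN1r enormZ normrN1 mul1r. Qed.

Lemma enormB x y : enorm (x - y) = enorm (y - x).
Proof. by rewrite -enormN opprB. Qed.

Lemma dotv_le x y : dotv x y <= enorm x * enorm y.
Proof.
have [x0|x0] := eqVneq (enorm x) 0.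
  by rewrite (enorm_eq0 x0) dotv0l enorm0 mul0r.
have [y0|y0] := eqVneq (enorm y) 0.
  by rewrite (enorm_eq0 y0) dotv0r enorm0 mulr0.
have := dotv_ge0 (enorm y *: x - enorm x *: y).
rewrite !dotvE (dotvC y x) -!enorm_sqr => h.
have xy : 0 < enorm x * enorm y.
  by rewrite mulr_gt0 // lt_neqAle eq_sym ?x0 ?y0 enorm_ge0.
rewrite -(ler_pM2l xy).
move: h; set a := enorm x; set b := enorm y; set c := dotv x y; nra.
Qed.

Lemma dotv_norm_le x y : `|dotv x y| <= enorm x * enorm y.
Proof.
by rewrite ler_norml dotv_le andbT lerNl -dotvNl -(enormN x) dotv_le.
Qed.

Lemma enormD x y : enorm (x + y) <= enorm x + enorm y.
Proof.
rewrite -(@ler_pXn2r _ 2) ?nnegrE ?addr_ge0 ?enorm_ge0 //.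
rewrite sqrrD !enorm_sqr !dotvE (dotvC y x).
by have := dotv_le x y; lra.
Qed.

Lemma enorm_triangle z x y : enorm (x - y) <= enorm (x - z) + enorm (z - y).
Proof. by rewrite -{1}(subrK z x) -addrA enormD. Qed.

Lemma enorm_le_sqr x (K : R) : 0 <= K -> dotv x x <= K ^+ 2 -> enorm x <= K.
Proof.
by move=> K0; rewrite -enorm_sqr ler_pXn2r ?nnegrE ?enorm_ge0.
Qed.

Lemma coord_le_enorm x i : `|x 0 i| <= enorm x.
Proof.
rewrite -sqrtr_sqr ler_wsqrtr // /dotv (bigD1 i) //= -expr2 lerDl.
by apply: sumr_ge0 => j _; rewrite -expr2 sqr_ge0.
Qed.

Lemma norm_le_enorm x : `|x| <= enorm x.
Proof.
have h i : `|x i.1 i.2| <= enorm x.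
  by case: i => i j /=; rewrite (ord1 i) coord_le_enorm.
rewrite [`|x|]mx_normrE; apply/bigmax_leP; split; first exact: enorm_ge0.
by move=> i _; exact: h.
Qed.

Lemma enorm_le_norm x : enorm x <= d%:R * `|x|.
Proof.
have nx i : `|x 0 i| <= `|x|.
  rewrite [`|x|]mx_normrE.
  exact: (@le_bigmax _ _ _ _ (fun i => `|x i.1 i.2|) (0, i)).
apply: enorm_le_sqr; first by rewrite mulr_ge0.
apply: (@le_trans _ _ (\sum_(i < d) `|x| ^+ 2)).
  apply: ler_sum => i _; rewrite -expr2 -[in leLHS]real_normK ?num_real //.
  by rewrite ler_pXn2r ?nnegrE.
rewrite sumr_const card_ord -[leLHS]mulr_natl exprMn ler_wpM2r ?exprn_ge0 //.
by rewrite -natrX ler_nat; case: (d) => // n; rewrite leq_pmulr.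
Qed.

End Euclid.

Ltac gen_atoms := repeat match goal with
  | |- context [@dotv ?R ?d ?x ?y] => generalize (@dotv R d x y); intro
  | |- context [@enorm ?R ?d ?x] => generalize (@enorm R d x); intro
  end.

(* [lra] is slow in large contexts, so the inequalities it needs are first moved
   to the goal and the others cleared. The argument [k] is a section hypothesis
   on the section variables, which [lra] loses if it is cleared. *)
Ltac clear_le_but k := repeat match goal with
  | h : is_true _ |- _ => tryif constr_eq h k then fail else clear h
  end.
Ltac lra_but k := clear_le_but k; gen_atoms; intros; lra.

Section RealLemmas.
Variable R : realType.

(** Bisection halves the quadratic error, and the limit removes it whatever the size of [c]. This
    replaces differentiation for a function known only through two-point comparisons. *)
Lemma increment_halving (f : R -> R) (al be k c : R) : al <= be ->
  (forall a b, al <= a -> a <= b -> b <= be ->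
     f b - f a <= k * (b - a) + c * (b - a) ^+ 2) ->
  f be - f al <= k * (be - al).
Proof.
move=> ab h.
have hn n : forall a b, al <= a -> a <= b -> b <= be ->
     f b - f a <= k * (b - a) + c / 2 ^+ n * (b - a) ^+ 2.
  elim: n => [|n IH] a b ala alb bbe; first by rewrite expr0 divr1; exact: h.
  pose m := (a + b) / 2.
  have := IH a m ala; have := IH m b => /(_ _ _ bbe) h1 h2.
  have {}h1 : f b - f m <= k * (b - m) + c / 2 ^+ n * (b - m) ^+ 2.
    by apply: h1; rewrite /m; lra.
  have {}h2 : f m - f a <= k * (m - a) + c / 2 ^+ n * (m - a) ^+ 2.
    by apply: h2; rewrite /m; lra.
  have -> : c / 2 ^+ n.+1 = (c / 2 ^+ n) / 2.
    by rewrite exprS; field; rewrite expf_neq0.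
  move: h1 h2; set e := c / 2 ^+ n; rewrite /m => h1 h2.
  have -> : f b - f a = (f b - f ((a + b) / 2)) + (f ((a + b) / 2) - f a) by ring.
  apply: le_trans (lerD h1 h2) _; rewrite le_eqVlt; apply/orP; left; apply/eqP.
  by field.
apply/ler_addgt0Pr => e e0.
have [n hen] : exists n : nat, `|c| * (be - al) ^+ 2 / e < n%:R.
  by exists (Num.bound (`|c| * (be - al) ^+ 2 / e));
    rewrite archi_boundP // mulr_ge0 ?invr_ge0 ?(ltW e0) // mulr_ge0 ?sqr_ge0.
apply: le_trans (hn n _ _ (lexx _) ab (lexx _)) _.
rewrite lerD2l; apply: le_trans (ler_norm _) _.
rewrite normrM (ger0_norm (sqr_ge0 _)) normrM normfV (ger0_norm (_ : 0 <= 2 ^+ n)); last exact: exprn_ge0.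
rewrite mulrAC ler_pdivrMr ?exprn_gt0 // mulrC.
move: hen; rewrite ltr_pdivrMr // => /ltW/le_trans; rewrite mulrC; apply.
rewrite [leRHS]mulrC.
by rewrite ler_wpM2r ?(ltW e0) // -natrX ler_nat ltnW // ltn_expl.
Qed.

(** The supremum of the times up to which [Q] holds throughout satisfies [Q] by the last hypothesis,
    and it must be [b] by the one before. *)
Lemma real_induction (a b : R) (Q : R -> Prop) : a <= b ->
  Q a ->
  (forall t, a <= t -> t < b -> (forall s, a <= s -> s <= t -> Q s) ->
     exists2 e : R, 0 < e & forall s, t < s -> s <= t + e -> s <= b -> Q s) ->
  (forall t, a < t -> t <= b -> (forall s, a <= s -> s < t -> Q s) -> Q t) ->
  Q b.
Proof.
move=> ab Qa hstep hlim.
pose A := [set t | a <= t <= b /\ forall s, a <= s -> s <= t -> Q s].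
have Aa : A a.
  split; first by rewrite lexx ab.
  by move=> s as_ sa; have -> : s = a by apply/eqP; rewrite eq_le sa as_.
have supA : has_sup A.
  by split; [exists a | exists b => t [/andP[]]].
pose T := sup A.
have aT : a <= T by exact: (sup_upper_bound supA Aa).
have Tb : T <= b by apply: ge_sup; [exists a | move=> t [/andP[]]].
have below s : a <= s -> s < T -> Q s.
  move=> as_ sT.
  have Ts : 0 < T - s by rewrite subr_gt0.
  have [t At st] := sup_adherent Ts supA.
  have {}st : s < t by move: st; rewrite -/T subKr.
  by apply: At.2 => //; exact: ltW.
have QT : Q T.
  have [aT'|Ta] := ltP a T; first exact: hlim.
  by have -> : T = a by apply/eqP; rewrite eq_le Ta aT.
have upto s : a <= s -> s <= T -> Q s.
  by move=> as_; rewrite le_eqVlt => /orP[/eqP ->|] //; exact: below.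
have [Tb'|bT] := ltP T b; last by apply: upto.
have [e e0 he] := hstep _ aT Tb' upto.
pose t := Num.min (T + e) b.
have : A t.
  have Tt : T < t by rewrite lt_min Tb' andbT ltrDl.
  split; first by rewrite (ltW (le_lt_trans aT Tt)) ge_min lexx orbT.
  move=> s as_ st; have [sT|Ts] := leP s T; first exact: upto.
  by move: st; rewrite le_min => /andP[]; exact: he.
move=> /(sup_upper_bound supA); rewrite -/T leNgt.
by rewrite lt_min Tb' andbT ltrDl e0.
Qed.

End RealLemmas.

Section Argmax.
Variables (R : realType) (d : nat).
Implicit Types (x y : 'rV[R]_d).

Lemma continuous_dotvr x : continuous (dotv x).
Proof.
apply: continuous_big => [|i _ y]; first exact: add_continuous.
by apply: continuousM; [exact: cst_continuous | exact: coord_continuous].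
Qed.

Lemma continuous_sqnorm : continuous (fun y : 'rV[R]_d => dotv y y).
Proof.
apply: continuous_big => [|i _ y]; first exact: add_continuous.
by apply: continuousM; exact: coord_continuous.
Qed.

Lemma enorm_nbhs x (e : R) : 0 < e -> nbhs x [set y | enorm (y - x) < e].
Proof.
move=> e0; apply/nbhs_ballP; exists (e / d.+1%:R) => /=; first by rewrite divr_gt0.
move=> y; rewrite -ball_normE /= => xy.
apply: le_lt_trans (enorm_le_norm _) _; rewrite distrC.
apply: (@le_lt_trans _ _ (d.+1%:R * `|x - y|)).
  by rewrite ler_wpM2r // ler_nat.
by rewrite mulrC -ltr_pdivlMr.
Qed.

Lemma nbhs_enorm x (A : set 'rV[R]_d) : nbhs x A ->
  exists2 e : R, 0 < e & forall y, enorm (y - x) < e -> A y.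
Proof.
move=> /nbhs_ballP[e /= e0 h]; exists e => // y xy; apply: h.
rewrite -ball_normE /=; apply: le_lt_trans xy.
by rewrite distrC norm_le_enorm.
Qed.

Lemma closed_ball_compact (c : 'rV[R]_d) (r : R) :
  compact [set x | enorm (x - c) <= r].
Proof.
apply: bounded_closed_compact.
- exists (r + enorm c); split; first exact: num_real.
  move=> M hM x /= hx; apply: le_trans (norm_le_enorm _) _.
  have := enormD (x - c) c; rewrite subrK; lra.
- have -> : [set x | enorm (x - c) <= r] =
    (fun x => enorm (x - c)) @^-1` [set t | t <= r] by [].
  apply: preimage_closed; last exact: closed_le.
  move=> x _; apply: (@continuous_comp _ _ _ (fun x => dotv (x - c) (x - c))
    (@Num.sqrt R)); last exact: sqrt_continuous.
  apply: (@continuous_comp _ _ _ (fun x => x - c) (fun y => dotv y y)).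
    by apply: continuousB; [exact: cvg_id | exact: cst_continuous].
  exact: continuous_sqnorm.
Qed.

Lemma argmax_coercive (f : 'rV[R]_d -> R) (c : 'rV[R]_d) (r : R) : continuous f ->
  (forall x, r < enorm (x - c) -> f x <= f c) ->
  exists z, forall x, f x <= f z.
Proof.
(* The maximum with 0 keeps [c] in the ball when [r] is negative. *)
move=> cf h; pose A := [set x | enorm (x - c) <= Num.max r 0].
have Ac : A c by rewrite /A /= subrr enorm0 le_max lexx orbT.
have [z zA hz] : exists2 z, z \in A & forall t, t \in A -> f t <= f z.
  apply: EVT_max_rV; first by exists c.
    exact: closed_ball_compact.
  by apply: continuous_subspaceT.
exists z => x; have [xr|rx] := leP (enorm (x - c)) (Num.max r 0).
  by apply: hz; rewrite inE.
apply: (@le_trans _ _ (f c)); last by apply: hz; rewrite inE.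
by apply: h; apply: le_lt_trans rx; rewrite le_max lexx.
Qed.

End Argmax.

(** * Averages along segments *)

Section Average.
Variable R : realType.
Implicit Types f g : R -> R.

Definition avg01 f : R := (\int[@lebesgue_measure R]_(t in `[0%R, 1%R]) f t)%R.

Lemma avg01_integrable f : continuous f ->
  (@lebesgue_measure R).-integrable `[0%R, 1%R] (EFin \o f).
Proof.
move=> cf; apply: continuous_compact_integrable; first exact: segment_compact.
exact: continuous_subspaceT.
Qed.

Lemma avg01D f g : continuous f -> continuous g ->
  avg01 (fun t => f t + g t) = avg01 f + avg01 g.
Proof.
by move=> cf cg; apply: RintegralD => //; exact: avg01_integrable.
Qed.

Lemma avg01Z (a : R) f : continuous f -> avg01 (fun t => a * f t) = a * avg01 f.
Proof.
by move=> cf; apply: RintegralZl => //; exact: avg01_integrable.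
Qed.

Lemma avg01_le f g : continuous f -> continuous g ->
  (forall t, 0 <= t <= 1 -> f t <= g t) -> avg01 f <= avg01 g.
Proof.
move=> cf cg h; apply: le_Rintegral => //; exact: avg01_integrable.
Qed.

Lemma is_derive_quadratic (f : R -> R) (s k c : R) :
  (forall t, `|t| <= 1 -> `|f (s + t) - f s - t * k| <= c * t ^+ 2) ->
  is_derive s 1 f k.
Proof.
move=> h.
have : h^-1 *: ((f \o shift s) (h *: 1) - f s) @[h --> 0^'] --> k.
  apply/cvgrPdist_le => e e0.
  pose r := Num.min 1 (e / (`|c| + 1)).
  have c0 : 0 < `|c| + 1 by apply: ltr_wpDl.
  have r0 : 0 < r by rewrite lt_min ltr01 divr_gt0.
  near=> t.
  have t0 : t != 0 by near: t; exact: nbhs_dnbhs_neq.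
  have tr : `|t| < r.
    by near: t; apply: dnbhs0_lt.
  have [t1 t2] : `|t| <= 1 /\ `|t| * (`|c| + 1) <= e.
    move: tr; rewrite lt_min => /andP[/ltW -> /ltW].
    by rewrite ler_pdivlMr.
  have /= := h t t1.
  rewrite /= [t%:A]mulr1 /shift /= [t + s]addrC => ht.
  have -> : k - t^-1 *: (f (s + t) - f s) = - (t^-1 * (f (s + t) - f s - t * k)).
    by rewrite -[t^-1 *: _]/(t^-1 * _); field.
  rewrite normrN normrM normfV ler_pdivrMl ?normr_gt0 //.
  apply: le_trans ht _; rewrite -(real_normK (num_real t)) expr2.
  rewrite mulrCA ler_wpM2l // mulrC; apply: le_trans t2.
  by rewrite ler_wpM2l // (le_trans (ler_norm _)) // lerDl.
move=> hk; have dk : derivable f s 1 by apply/cvg_ex; exists k.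
by apply: (DeriveDef dk); exact: cvg_lim.
Unshelve. all: by end_near. Qed.

Lemma avg01_FTC (F f : R -> R) : continuous f -> (forall t : R, is_derive t 1 F (f t)) ->
  avg01 f = F 1 - F 0.
Proof.
move=> cf dF.
have cF : continuous F.
  by move=> t; apply: differentiable_continuous; apply/derivable1_diffP; case: (dF t).
rewrite /avg01 /Rintegral (@continuous_FTC2 _ f F) //.
- exact: continuous_subspaceT.
- split; [by move=> t _; case: (dF t)| |].
  + exact/cvg_at_right_filter/cF.
  + exact/cvg_at_left_filter/cF.
- by move=> t _; rewrite derive1E; apply: derive_val.
Qed.

Lemma avg01_cst (c : R) : avg01 (fun=> c) = c.
Proof.
transitivity ((fun t => c * t) 1 - (fun t => c * t) 0); last by rewrite mulr1 mulr0 subr0.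
apply: avg01_FTC.
- exact: cst_continuous.
- move=> t; apply: (@is_derive_quadratic _ _ _ 0) => s _.
  by rewrite mul0r (_ : _ - _ - _ = 0) ?normr0 //; ring.
Qed.

Lemma avg01_onem : avg01 (fun t : R => 1 - t) = 2^-1.
Proof.
pose F (t : R) := t - t ^+ 2 / 2.
transitivity (F 1 - F 0); last by rewrite /F; field.
apply: avg01_FTC; rewrite /F.
- by move=> t; apply: continuousB; [exact: cst_continuous | exact: cvg_id].
- move=> t; apply: (@is_derive_quadratic _ _ _ (2^-1)) => s _.
  rewrite (_ : _ - _ - _ = - (2^-1 * s ^+ 2)); last by field.
  by rewrite normrN ger0_norm // mulr_ge0 ?sqr_ge0.
Qed.

Lemma avg01_norm_le f (K : R) : continuous f ->
  (forall t, 0 <= t <= 1 -> `|f t| <= K) -> `|avg01 f| <= K.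
Proof.
move=> cf h; rewrite ler_norml; apply/andP; split.
  rewrite -[leLHS]avg01_cst; apply: avg01_le => //; first exact: cst_continuous.
  by move=> t /h; rewrite ler_norml => /andP[].
rewrite -[leRHS](avg01_cst K); apply: avg01_le => //; first exact: cst_continuous.
by move=> t /h; rewrite ler_norml => /andP[].
Qed.

Lemma avg01_by_parts (f f' : R -> R) : continuous f' -> (forall t : R, is_derive t 1 f (f' t)) ->
  avg01 (fun t : R => (1 - t) * f' t) = avg01 f - f 0.
Proof.
move=> cf' df.
have cf : continuous f.
  by move=> t; apply: differentiable_continuous; apply/derivable1_diffP; case: (df t).
have c1 : continuous (fun t : R => 1 - t).
  by move=> t; apply: continuousB; [exact: cst_continuous | exact: cvg_id].
have c2 : continuous (fun t : R => (1 - t) * f' t).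
  by move=> t; apply: (@continuousM _ _ (fun t : R => 1 - t) f'); [exact: c1|exact: cf'].
have c3 : continuous (fun t : R => -1 * f t).
  by move=> t; apply: (@continuousM _ _ (cst (-1)) f); [exact: cst_continuous|exact: cf].
have : avg01 (fun t => (1 - t) * f' t + -1 * f t) =
    (fun t : R => (1 - t) * f t) 1 - (fun t : R => (1 - t) * f t) 0.
  apply: (@avg01_FTC (fun t : R => (1 - t) * f t)).
    by move=> t; apply: (@continuousD _ _ _ (fun t : R => (1 - t) * f' t) (fun t : R => -1 * f t)); [exact: c2|exact: c3].
  move=> t; have dft := df t.
  have : is_derive t 1 ((fun t : R => 1 - t) * f) ((1 - t) *: f' t + f t *: (0 - 1)).
    by apply: is_deriveM; apply: is_deriveB.
  move=> h; apply: is_derive_eq h _.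
  by rewrite -[_ *: _]/(_ * _) -[f t *: _]/(_ * _); ring.
rewrite avg01D // avg01Z //; lra.
Qed.

End Average.

(** * Uniform bounds for periodic potentials *)

Section Partials.
Variables (R : realType) (d : nat).
Implicit Types (f V : 'rV[R]_d -> R) (x a : 'rV[R]_d).

Lemma periodic_bounded f : Zperiodic f -> continuous f ->
  exists2 B : R, 0 <= B & forall x, `|f x| <= B.
Proof.
move=> fp cf.
pose D := [set x : 'rV[R]_d | enorm (x - 0) <= d%:R].
have [z _ hz] : exists2 z, z \in D & forall t, t \in D -> `|f t| <= `|f z|.
  apply: (@EVT_max_rV _ _ (fun x => `|f x|)).
  - by exists 0; rewrite /D /= subrr enorm0.
  - exact: closed_ball_compact.
  - apply: continuous_subspaceT => x; apply: continuous_comp; first exact: cf.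
    exact: norm_continuous.
exists `|f z| => // x.
(* Subtracting integer parts moves [x] into the unit cube, which lies in the ball of radius [d]. *)
pose k : 'rV[int]_d := \row_i - Num.floor (x 0 i).
rewrite -(fp k x); apply: hz; rewrite inE /D /= subr0.
apply: le_trans (enorm_le_norm _) _.
rewrite -[leRHS]mulr1 ler_wpM2l // [`|_|]mx_normrE; apply/bigmax_leP; split => //.
case=> i j _ /=; rewrite (ord1 i) !mxE rmorphN /= ger0_norm.
  by rewrite lerBlDr addrC ltW // -[1]/((1%:Z)%:~R) -intrD floorD1_gt.
by rewrite subr_ge0 floor_le_tmp.
Qed.

Lemma is_derive_line f x (e : 'rV[R]_d) (s : R) :
  derivable f (x + s *: e) e ->
  is_derive s 1 (fun r : R => f (x + r *: e)) ('D_e f (x + s *: e)).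
Proof.
move=> df.
have E : (fun h : R => h^-1 *: (((fun r : R => f (x + r *: e)) \o shift s) (h *: 1)
      - f (x + s *: e))) =
    (fun h : R => h^-1 *: ((f \o shift (x + s *: e)) (h *: e) - f (x + s *: e))).
  apply/funext => h /=; congr (_ *: (f _ - _)).
  by rewrite /shift /= [h%:A]mulr1 scalerDl addrCA.
have d1 : derivable (fun r : R => f (x + r *: e)) s 1.
  by rewrite /derivable E.
by apply: (DeriveDef d1); rewrite /derive E.
Qed.

(** The increment is split into moves of one coordinate at a time, so that the one-variable mean
    value theorem applies to each partial derivative. Hence one intermediate point per coordinate,
    all in the box spanned by [a]. *)
Lemma partials_mean_value f x a :
  (forall i y, derivable f y (delta_mx 0 i)) ->
  exists2 xi : 'I_d -> 'rV[R]_d,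
    forall k i, `|(xi k - x) 0 i| <= `|a 0 i| &
    f (x + a) - f x = \sum_k a 0 k * 'D_(delta_mx 0 k) f (xi k).
Proof.
move=> df.
pose y (n : nat) : 'rV[R]_d := x + \row_i (if (i < n)%N then a 0 i else 0).
have step (k : 'I_d) : exists z : 'rV[R]_d,
    (forall i, `|(z - x) 0 i| <= `|a 0 i|) /\
    f (y k.+1) - f (y k) = a 0 k * 'D_(delta_mx 0 k) f z.
  pose h (r : R) := f (y k + r *: delta_mx 0 k).
  have dh (r : R) := is_derive_line (df k (y k + r *: delta_mx 0 k)).
  have ch : continuous h.
    move=> t; apply: differentiable_continuous; apply/derivable1_diffP.
    by case: (dh t).
  have yk : y k.+1 = y k + a 0 k *: delta_mx 0 k.
    rewrite /y -addrA; congr (_ + _); apply/rowP => i; rewrite !mxE eqxx /=.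
    have [->|ik] := eqVneq i k; first by rewrite leqnn ltnn add0r mulr1.
    by rewrite mulr0 addr0 ltnS leq_eqVlt val_eqE (negbTE ik).
  have hz (z : R) : `|z| <= `|a 0 k| -> forall i,
      `|(y k + z *: delta_mx 0 k - x) 0 i| <= `|a 0 i|.
    move=> zk i; rewrite /y addrAC [x + _]addrC addrK !mxE eqxx /=.
    have [->|ik] := eqVneq i k; first by rewrite ltnn add0r mulr1.
    by rewrite mulr0 addr0; case: ifP => // _; rewrite normr0.
  have [k0|k0] := leP 0 (a 0 k).
  - have [r] := @MVT_segment _ h (fun r => 'D_(delta_mx 0 k) f (y k + r *: delta_mx 0 k))
        _ _ k0 (fun r _ => dh r) (continuous_subspaceT ch).
    rewrite in_itv /= => /andP[r0 rk] e; exists (y k + r *: delta_mx 0 k); split.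
      by apply: hz; rewrite !ger0_norm.
    by rewrite yk; move: e; rewrite /h scale0r addr0 subr0 mulrC.
  - have [r] := @MVT_segment _ h (fun r => 'D_(delta_mx 0 k) f (y k + r *: delta_mx 0 k))
        _ _ (ltW k0) (fun r _ => dh r) (continuous_subspaceT ch).
    rewrite in_itv /= => /andP[r0 rk] e; exists (y k + r *: delta_mx 0 k); split.
      by apply: hz; rewrite !ler0_norm ?lerN2 // ltW.
    rewrite yk; move: e; rewrite /h scale0r addr0 sub0r => e.
    by rewrite -opprB e mulrN opprK mulrC.
have /choice[xi hxi] := step.
exists xi => [k|]; first by case: (hxi k).
have -> : \sum_k a 0 k * 'D_(delta_mx 0 k) f (xi k) =
    \sum_(k < d) (f (y k.+1) - f (y k)).
  by apply: eq_bigr => k _; case: (hxi k).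
rewrite -(big_mkord xpredT (fun k => f (y k.+1) - f (y k))) telescope_sumr //.
by congr (f _ - f _); rewrite /y; [congr (_ + _)|rewrite -[LHS]addr0; congr (_ + _)];
  apply/rowP => i; rewrite !mxE ?ltn_ord.
Qed.

Lemma sum_coord_le (b : 'rV[R]_d) : \sum_i `|b 0 i| <= d%:R * enorm b.
Proof.
apply: (@le_trans _ _ (\sum_(i < d) enorm b)).
  by apply: ler_sum => i _; exact: coord_le_enorm.
by rewrite sumr_const card_ord mulr_natl.
Qed.

Lemma partials_lipschitz f (B : R) x a : 0 <= B ->
  (forall i y, derivable f y (delta_mx 0 i)) ->
  (forall i y, `|'D_(delta_mx 0 i) f y| <= B) ->
  `|f (x + a) - f x| <= B * \sum_i `|a 0 i|.
Proof.
move=> B0 df hB; have [xi _ ->] := partials_mean_value x a df.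
apply: le_trans (ler_norm_sum _ _ _) _.
rewrite mulr_sumr; apply: ler_sum => i _.
by rewrite normrM mulrC ler_wpM2r.
Qed.

Definition grad V x : 'rV[R]_d := \row_i 'D_(delta_mx 0 i) V x.

(** The second partial derivatives are continuous and periodic, hence bounded, which makes the
    gradient Lipschitz. These three bounds are the form in which the smoothness of [V] enters the
    estimates. *)
Lemma C2_gradient_bounds V : Zperiodic V -> Ck 2 V ->
  exists2 L : R, 0 <= L &
   [/\ forall x a, `|V (x + a) - V x - dotv (grad V x) a| <= L * dotv a a,
       forall x a, enorm (grad V (x + a) - grad V x) <= L * enorm a
     & forall x, enorm (grad V x) <= L].
Proof.
move=> Vp [cV C1].
have perD f : Zperiodic f -> forall v : 'rV[R]_d, Zperiodic ('D_v f).
  move=> fp v k x; rewrite /derive.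
  rewrite (_ : (fun h => _) = (fun h : R => h^-1 *: ((f \o shift x) (h *: v) - f x))) //.
  by apply/funext => h /=; rewrite /shift /= addrA !fp.
have /choice[B1 hB1] (i : 'I_d) : exists B, 0 <= B /\
    forall x, `|'D_(delta_mx 0 i) V x| <= B.
  have [B B0 hB] := periodic_bounded (perD _ Vp (delta_mx 0 i)) (C1 i).2.1.
  by exists B.
have /choice[B2 hB2] (ij : 'I_d * 'I_d) : exists B, 0 <= B /\
    forall x, `|'D_(delta_mx 0 ij.2) ('D_(delta_mx 0 ij.1) V) x| <= B.
  have c : continuous (fun x => 'D_(delta_mx 0 ij.2) ('D_(delta_mx 0 ij.1) V) x).
    exact: ((C1 ij.1).2.2 ij.2).2.1.
  have [B B0 hB] := periodic_bounded (perD _ (perD _ Vp (delta_mx 0 ij.1)) (delta_mx 0 ij.2)) c.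
  by exists B.
pose B := \sum_i B1 i + \sum_ij B2 ij.
have B1s : 0 <= \sum_i B1 i by apply: sumr_ge0 => i _; case: (hB1 i).
have B2s : 0 <= \sum_ij B2 ij by apply: sumr_ge0 => i _; case: (hB2 i).
have B0 : 0 <= B by rewrite addr_ge0.
have hB1' i x : `|'D_(delta_mx 0 i) V x| <= B.
  apply: le_trans ((hB1 i).2 x) _; rewrite /B (bigD1 i) //= -addrA lerDl.
  by rewrite addr_ge0 // sumr_ge0 // => j _; case: (hB1 j).
have hB2' i j x : `|'D_(delta_mx 0 j) ('D_(delta_mx 0 i) V) x| <= B.
  apply: le_trans ((hB2 (i, j)).2 x) _; rewrite /B (bigD1 (i, j)) //= addrCA lerDl.
  by rewrite addr_ge0 // sumr_ge0 // => k _; case: (hB2 k).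
have lipD i x a : `|'D_(delta_mx 0 i) V (x + a) - 'D_(delta_mx 0 i) V x| <=
    B * \sum_i `|a 0 i|.
  have di j y : derivable ('D_(delta_mx 0 i) V) y (delta_mx 0 j).
    exact: ((C1 i).2.2 j).1.
  exact: (@partials_lipschitz _ B x a B0 di (hB2' i)).
have vec_le (c : 'rV[R]_d) (M : R) : 0 <= M -> (forall i, `|c 0 i| <= M) ->
    enorm c <= d%:R * M.
  move=> M0 h; apply: le_trans (enorm_le_norm _) _; rewrite ler_wpM2l //.
  rewrite [`|_|]mx_normrE; apply/bigmax_leP; split => //.
  by case=> i j _ /=; rewrite (ord1 i).
have sum0 (a : 'rV[R]_d) : 0 <= \sum_i `|a 0 i| by apply: sumr_ge0.
exists (d%:R * (B * d%:R) + d%:R * B).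
  by rewrite addr_ge0 // mulr_ge0 // mulr_ge0.
have L1 : d%:R * (B * d%:R) <= d%:R * (B * d%:R) + d%:R * B.
  by rewrite lerDl mulr_ge0.
split.
- move=> x a.
  have [xi hxi ->] := partials_mean_value x a (fun i y => (C1 i).1 y).
  have -> : dotv (grad V x) a = \sum_k a 0 k * 'D_(delta_mx 0 k) V x.
    by apply: eq_bigr => k _; rewrite mxE mulrC.
  rewrite -sumrB; apply: le_trans (ler_norm_sum _ _ _) _.
  apply: (@le_trans _ _ (\sum_k `|a 0 k| * (B * (d%:R * enorm a)))).
    apply: ler_sum => k _; rewrite -mulrBr normrM ler_wpM2l //.
    have -> : xi k = x + (xi k - x) by rewrite addrC subrK.
    apply: le_trans (lipD _ _ _) _; rewrite ler_wpM2l //.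
    apply: le_trans (sum_coord_le a); apply: ler_sum => i _; exact: hxi.
  rewrite -mulr_suml -enorm_sqr.
  apply: (@le_trans _ _ (d%:R * enorm a * (B * (d%:R * enorm a)))).
    by rewrite ler_wpM2r ?sum_coord_le // mulr_ge0 // mulr_ge0 // enorm_ge0.
  have -> : d%:R * enorm a * (B * (d%:R * enorm a)) = d%:R * (B * d%:R) * enorm a ^+ 2.
    by ring.
  by rewrite ler_wpM2r ?sqr_ge0.
- move=> x a; apply: (@le_trans _ _ (d%:R * (B * (d%:R * enorm a)))).
    apply: vec_le => [|i]; first by rewrite mulr_ge0 // mulr_ge0 // enorm_ge0.
    rewrite !mxE; apply: le_trans (lipD _ _ _) _.
    by rewrite ler_wpM2l // sum_coord_le.
  have -> : d%:R * (B * (d%:R * enorm a)) = d%:R * (B * d%:R) * enorm a by ring.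
  by rewrite ler_wpM2r ?enorm_ge0.
- move=> x; apply: (@le_trans _ _ (d%:R * B)); last first.
    by rewrite lerDr mulr_ge0 // mulr_ge0.
  by apply: vec_le => // i; rewrite mxE.
Qed.

End Partials.

(** * The potential averaged along a segment *)

Section LineAverage.
Variables (R : realType) (d : nat).
Implicit Types (x y z a b : 'rV[R]_d).
Variables (V : 'rV[R]_d -> R) (g : 'rV[R]_d -> 'rV[R]_d) (L : R).
Hypothesis L0 : 0 <= L.
Hypothesis V_taylor : forall x a, `|V (x + a) - V x - dotv (g x) a| <= L * dotv a a.
Hypothesis g_lip : forall x a, enorm (g (x + a) - g x) <= L * enorm a.
Hypothesis g_bounded : forall x, enorm (g x) <= L.

Lemma lipschitz_continuous1 (f : R -> R) (c : R) :
  (forall s t, `|f t - f s| <= c * `|t - s|) -> continuous f.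
Proof.
move=> h s; apply/cvgrPdist_le => e e0.
have c0 : 0 < `|c| + 1 by apply: ltr_wpDl.
near=> t.
have : `|s - t| < e / (`|c| + 1).
  by near: t; apply: cvgr_dist_lt; [exact: cvg_id | rewrite divr_gt0].
rewrite ltr_pdivlMr // => ht; rewrite distrC; apply: le_trans (h s t) _.
rewrite distrC; apply: le_trans (ltW ht); rewrite mulrC ler_wpM2l //.
by rewrite (le_trans (ler_norm _)) // lerDl.
Unshelve. all: by end_near. Qed.

Lemma continuous_g_line z v a : continuous (fun t : R => dotv (g (z + t *: v)) a).
Proof.
apply: (@lipschitz_continuous1 _ (L * enorm v * enorm a)) => s t.
rewrite -dotvNl -dotvDl; apply: le_trans (dotv_norm_le _ _) _.
rewrite [leRHS]mulrAC ler_wpM2r ?enorm_ge0 //.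
have -> : z + t *: v = (z + s *: v) + (t - s) *: v.
  by rewrite scalerBl addrAC -addrA addrNK.
by apply: le_trans (g_lip _ _) _; rewrite enormZ mulrA mulrAC -mulrA mulrA.
Qed.

Lemma is_derive_V_line z v (t : R) :
  is_derive t 1 (fun t : R => V (z + t *: v)) (dotv (g (z + t *: v)) v).
Proof.
apply: (@is_derive_quadratic _ _ _ _ (L * dotv v v)) => s _.
have := V_taylor (z + t *: v) (s *: v).
rewrite !dotvE scalerDl addrA => /le_trans; apply.
by rewrite le_eqVlt; apply/orP; left; apply/eqP; ring.
Qed.

Lemma continuous_V_line z v : continuous (fun t : R => V (z + t *: v)).
Proof.
move=> t; apply: differentiable_continuous; apply/derivable1_diffP.
by case: (is_derive_V_line z v t).
Qed.

Definition avg_line z y : R := avg01 (fun t => V (z + t *: (y - z))).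

(** The gradient of [avg_line] in its first argument, by differentiation under the integral: the
    point with parameter [t] moves with [z] at rate [1 - t]. *)
Definition avg_grad z y : 'rV[R]_d :=
  \row_i avg01 (fun t : R => (1 - t) * dotv (g (z + t *: (y - z))) (delta_mx 0 i)).

Lemma avg01_sum n (f : 'I_n -> R -> R) : (forall i, continuous (f i)) ->
  avg01 (fun t => \sum_i f i t) = \sum_i avg01 (f i).
Proof.
elim: n f => [|n IH] f cf.
  rewrite big_ord0 -[RHS]avg01_cst; congr avg01.
  by apply/funext => t; rewrite big_ord0.
rewrite big_ord_recl -IH // -avg01D //.
  by congr avg01; apply/funext => t; rewrite big_ord_recl.
by apply: continuous_big => [|i _ y]; [exact: add_continuous | exact: cf].
Qed.

Lemma continuous_onemM (f : R -> R) : continuous f -> continuous (fun t : R => (1 - t) * f t).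
Proof.
move=> cf t; apply: (@continuousM _ _ (fun t : R => 1 - t) f); last exact: cf.
by apply: continuousB; [exact: cst_continuous | exact: cvg_id].
Qed.

Lemma continuous_scale (c : R) (f : R -> R) : continuous f -> continuous (fun t : R => c * f t).
Proof.
move=> cf t; apply: (@continuousM _ _ (cst c) f); last exact: cf.
exact: cst_continuous.
Qed.

Lemma continuous_add (f1 f2 : R -> R) : continuous f1 -> continuous f2 ->
  continuous (fun t : R => f1 t + f2 t).
Proof. by move=> c1 c2 t; apply: (@continuousD _ _ _ f1 f2); [exact: c1|exact: c2]. Qed.

Lemma dotv_avg_grad z y a :
  dotv (avg_grad z y) a = avg01 (fun t : R => (1 - t) * dotv (g (z + t *: (y - z))) a).
Proof.
rewrite /dotv; have c i := continuous_onemM (@continuous_g_line z (y - z) (delta_mx 0 i)).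
transitivity (\sum_i avg01 (fun t => a 0 i * ((1 - t) *
    dotv (g (z + t *: (y - z))) (delta_mx 0 i)))).
  by apply: eq_bigr => i _; rewrite avg01Z // mxE mulrC.
rewrite -avg01_sum => [|i]; last exact: continuous_scale.
congr avg01; apply/funext => t; rewrite mulr_sumr; apply: eq_bigr => i _.
rewrite mulrCA; congr (_ * _); rewrite mulrC; congr (_ * _).
rewrite /dotv (bigD1 i) //= big1 => [|j ji]; first by rewrite mxE !eqxx mulr1 addr0.
by rewrite mxE eqxx (negbTE ji) mulr0.
Qed.

Lemma avg_line_expand_left z y a :
  `|avg_line (z + a) y - avg_line z y - dotv (avg_grad z y) a| <= L * dotv a a.
Proof.
pose f1 (t : R) := V (z + a + t *: (y - (z + a))).
pose f2 (t : R) := V (z + t *: (y - z)).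
pose f3 (t : R) := (1 - t) * dotv (g (z + t *: (y - z))) a.
have c1 : continuous f1 by exact: continuous_V_line.
have c2 : continuous f2 by exact: continuous_V_line.
have c3 : continuous f3 by exact: continuous_onemM (@continuous_g_line _ _ _).
have -> : avg_line (z + a) y - avg_line z y - dotv (avg_grad z y) a =
    avg01 (fun t => f1 t + (-1 * f2 t + -1 * f3 t)).
  rewrite dotv_avg_grad avg01D //; last by apply: continuous_add; exact: continuous_scale.
  rewrite avg01D //; [|exact: continuous_scale|exact: continuous_scale].
  by rewrite !avg01Z // /avg_line -/f1 -/f2 -/f3; ring.
apply: avg01_norm_le => [|t /andP[t0 t1]].
  by apply: continuous_add => //; apply: continuous_add; exact: continuous_scale.
rewrite /f1 /f2 /f3.
have -> : z + a + t *: (y - (z + a)) = z + t *: (y - z) + (1 - t) *: a.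
  by apply/rowP => i; rewrite !mxE; ring.
have := V_taylor (z + t *: (y - z)) ((1 - t) *: a).
rewrite !dotvE => h.
rewrite (_ : _ + _ = V (z + t *: (y - z) + (1 - t) *: a) -
  V (z + t *: (y - z)) - (1 - t) * dotv (g (z + t *: (y - z))) a); last by ring.
apply: le_trans h _; rewrite ler_wpM2l // mulrA -[leRHS]mul1r.
rewrite ler_wpM2r ?dotv_ge0 //.
by rewrite -expr2 expr_le1 // ?subr_ge0 // lerBlDr lerDl.
Qed.

(** The gradient in [y] carries the weight [t], of total mass 1/2. Freezing [g] at [y] turns it into
    half of [g y] and costs the term with [enorm (y - z)]. *)
Lemma avg_line_expand_right z y b :
  `|avg_line z (y + b) - avg_line z y - 2^-1 * dotv (g y) b| <=
    L * dotv b b + L * (enorm (y - z) * enorm b).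
Proof.
pose f1 (t : R) := V (z + t *: (y + b - z)).
pose f2 (t : R) := V (z + t *: (y - z)).
pose f3 (t : R) := (1 - t) * dotv (g y) b.
have c1 : continuous f1 by exact: continuous_V_line.
have c2 : continuous f2 by exact: continuous_V_line.
(* The weight [t] is split as [1 - (1 - t)], so that the known mean of [1 - t] applies. *)
have c3 : continuous f3 by apply: continuous_onemM; exact: cst_continuous.
have i3 : avg01 f3 = 2^-1 * dotv (g y) b.
  rewrite -avg01_onem mulrC -avg01Z.
    by congr avg01; apply/funext => t; rewrite /f3 mulrC.
  by move=> t; apply: continuousB; [exact: cst_continuous | exact: cvg_id].
have -> : avg_line z (y + b) - avg_line z y - 2^-1 * dotv (g y) b =
    avg01 (fun t => f1 t + (-1 * f2 t + ((fun=> - dotv (g y) b) t + f3 t))).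
  rewrite avg01D //; last first.
    apply: continuous_add; first exact: continuous_scale.
    by apply: continuous_add => //; exact: cst_continuous.
  rewrite avg01D //; [|exact: continuous_scale|]; last first.
    by apply: continuous_add => //; exact: cst_continuous.
  rewrite avg01D //; last exact: cst_continuous.
  by rewrite avg01Z // avg01_cst i3 /avg_line -/f1 -/f2; field.
apply: avg01_norm_le => [|t /andP[t0 t1]].
  apply: continuous_add => //; apply: continuous_add; first exact: continuous_scale.
  by apply: continuous_add => //; exact: cst_continuous.
rewrite /f1 /f2 /f3.
have -> : z + t *: (y + b - z) = z + t *: (y - z) + t *: b.
  by apply/rowP => i; rewrite !mxE; ring.
have h1 := V_taylor (z + t *: (y - z)) (t *: b).
have h2 : `|dotv (g (z + t *: (y - z)) - g y) b| <= L * (enorm (y - z) * enorm b).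
  apply: le_trans (dotv_norm_le _ _) _; rewrite mulrA ler_wpM2r ?enorm_ge0 //.
  have -> : z + t *: (y - z) = y + (1 - t) *: (z - y).
    by apply/rowP => i; rewrite !mxE; ring.
  apply: le_trans (g_lip _ _) _; rewrite ler_wpM2l // enormZ enormB.
  rewrite -[leRHS]mul1r ler_wpM2r ?enorm_ge0 // ger0_norm ?subr_ge0 //.
  by rewrite lerBlDr lerDl.
have h3 : t * t * dotv b b <= dotv b b.
  by rewrite -[leRHS]mul1r ler_wpM2r ?dotv_ge0 // -expr2 expr_le1.
have h4 : L * (t * t * dotv b b) <= L * dotv b b by rewrite ler_wpM2l.
move: h1 h2; rewrite !dotvE !ler_norml.
set c := dotv (g (z + _)) b; set c' := dotv (g y) b => /andP[h1 h1'] /andP[h2 h2'].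
have X0 : 0 <= L * (enorm (y - z) * enorm b) by rewrite !mulr_ge0 ?enorm_ge0.
have k1 : t * (c - c') <= L * (enorm (y - z) * enorm b).
  apply: le_trans (ler_norm _) _; rewrite normrM (ger0_norm t0).
  rewrite -[leRHS]mul1r ler_pM // ler_norml; lra.
have k2 : - (L * (enorm (y - z) * enorm b)) <= t * (c - c').
  rewrite lerNl -mulrN; apply: le_trans (ler_norm _) _; rewrite normrM (ger0_norm t0).
  rewrite -[leRHS]mul1r ler_pM // ler_norml; lra.
lra.
Qed.

(** Integration by parts of [1 - t] against the derivative of [V] along the segment. The identity
    serves to eliminate [V z] from the Hamilton-Jacobi equation at the foot of a segment. *)
Lemma dotv_avg_grad_segment z y :
  dotv (avg_grad z y) (y - z) = avg_line z y - V z.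
Proof.
rewrite dotv_avg_grad.
have := @avg01_by_parts _ (fun t : R => V (z + t *: (y - z))) _
  (@continuous_g_line z (y - z) (y - z)) (is_derive_V_line z (y - z)).
by rewrite scale0r addr0.
Qed.

Lemma avg_grad_near z y : enorm (avg_grad z y - 2^-1 *: g y) <= L * enorm (y - z).
Proof.
set c := avg_grad z y - _.
have h a : dotv c a <= L * enorm (y - z) * enorm a.
  rewrite !dotvE dotv_avg_grad -avg01_onem -mulrN mulrC -avg01Z; last first.
    by move=> t; apply: continuousB; [exact: cst_continuous | exact: cvg_id].
  rewrite -avg01D.
  - apply: le_trans (ler_norm _) _; apply: avg01_norm_le => [|t /andP[t0 t1]].
      apply: continuous_add; first exact: continuous_onemM (@continuous_g_line _ _ _).
      apply: continuous_scale.
      by move=> t; apply: continuousB; [exact: cst_continuous | exact: cvg_id].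
    have -> : (1 - t) * dotv (g (z + t *: (y - z))) a + - dotv (g y) a * (1 - t) =
       (1 - t) * dotv (g (z + t *: (y - z)) - g y) a by rewrite !dotvE; ring.
    rewrite normrM ger0_norm ?subr_ge0 // -[leRHS]mul1r ler_pM // ?subr_ge0 //.
      by rewrite lerBlDr lerDl.
    apply: le_trans (dotv_norm_le _ _) _; rewrite ler_wpM2r ?enorm_ge0 //.
    have -> : z + t *: (y - z) = y + (1 - t) *: (z - y).
      by apply/rowP => i; rewrite !mxE; ring.
    apply: le_trans (g_lip _ _) _; rewrite ler_wpM2l // enormZ enormB.
    rewrite -[leRHS]mul1r ler_wpM2r ?enorm_ge0 // ger0_norm ?subr_ge0 //.
    by rewrite lerBlDr lerDl.
  - exact: continuous_onemM (@continuous_g_line _ _ _).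
  - apply: continuous_scale.
    by move=> t; apply: continuousB; [exact: cst_continuous | exact: cvg_id].
have := h c; rewrite -enorm_sqr expr2.
have [->|c0] := eqVneq (enorm c) 0; first by rewrite mulr_ge0 // enorm_ge0.
by rewrite ler_pM2r // lt_neqAle eq_sym c0 enorm_ge0.
Qed.

Lemma avg_line_bounds z y (K : R) : (forall x, - K <= V x <= 0) ->
  - K <= avg_line z y <= 0.
Proof.
move=> hV; apply/andP; split.
  rewrite -[leLHS]avg01_cst; apply: avg01_le; [exact: cst_continuous | | ].
    exact: continuous_V_line.
  by move=> t _; case/andP: (hV (z + t *: (y - z))).
rewrite -[leRHS](avg01_cst 0); apply: avg01_le.
- exact: continuous_V_line.
- exact: cst_continuous.
- by move=> t _; case/andP: (hV (z + t *: (y - z))).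
Qed.

Lemma avg_grad_bounded z y : enorm (avg_grad z y) <= L.
Proof.
have h a : dotv (avg_grad z y) a <= L * enorm a.
  rewrite dotv_avg_grad; apply: le_trans (ler_norm _) _.
  apply: avg01_norm_le => [|t /andP[t0 t1]].
    exact: continuous_onemM (@continuous_g_line _ _ _).
  rewrite normrM ger0_norm ?subr_ge0 // -[leRHS]mul1r ler_pM // ?subr_ge0 //.
    by rewrite lerBlDr lerDl.
  by apply: le_trans (dotv_norm_le _ _) _; rewrite ler_wpM2r ?enorm_ge0.
have := h (avg_grad z y); rewrite -enorm_sqr expr2.
have [->//|c0] := eqVneq (enorm (avg_grad z y)) 0.
by rewrite ler_pM2r // lt_neqAle eq_sym c0 enorm_ge0.
Qed.

Lemma taylor_continuous (f : 'rV[R]_d -> R) (c : R) :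
  (forall x, exists p, forall a, `|f (x + a) - f x - dotv p a| <= c * dotv a a) ->
  continuous f.
Proof.
move=> h x; have [p hp] := h x.
have E : f = (fun y => (f y - f x - dotv p (y - x)) + (f x + dotv p (y - x))).
  by apply/funext => y; ring.
have bx : continuous (fun y : 'rV[R]_d => y - x).
  by move=> y; apply: continuousB; [exact: cvg_id | exact: cst_continuous].
have c1 : continuous (fun y => dotv p (y - x)).
  by move=> y; apply: (@continuous_comp _ _ _ (fun y => y - x) (dotv p)); [exact: bx|exact: continuous_dotvr].
have c2 : continuous (fun y => c * dotv (y - x) (y - x)).
  move=> y; apply: (@continuousM _ _ (cst c) (fun y => dotv (y - x) (y - x))).
    exact: cst_continuous.
  by apply: (@continuous_comp _ _ _ (fun y => y - x) (fun z => dotv z z)); [exact: bx|exact: continuous_sqnorm].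
have z1 : dotv p (x - x) = 0 by rewrite subrr dotv0r.
have z2 : c * dotv (x - x) (x - x) = 0 by rewrite subrr dotv0r mulr0.
apply/(@cvgrPdist_lt _ _ _ (nbhs x)) => e e0; near=> y.
have h1 : `|dotv p (y - x)| < e / 2.
  near: y; have := c1 x => /cvgrPdist_lt /(_ (e / 2)); rewrite divr_gt0 // => /(_ isT).
  by apply: filterS => y; rewrite z1 sub0r normrN.
have h2 : c * dotv (y - x) (y - x) < e / 2.
  near: y; have := c2 x => /cvgrPdist_lt /(_ (e / 2)); rewrite divr_gt0 // => /(_ isT).
  apply: filterS => y; rewrite z2 sub0r normrN; exact: le_lt_trans (ler_norm _).
have h3 := hp (y - x); rewrite [x + _]addrC subrK in h3; rewrite distrC.
rewrite (_ : f y - f x = (f y - f x - dotv p (y - x)) + dotv p (y - x)); last by ring.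
apply: le_lt_trans (ler_normD _ _) _; lra.
Unshelve. all: by end_near. Qed.

End LineAverage.

(** * Semiconcave solutions *)

Section Prox.
Variables (R : realType) (d : nat).
Implicit Types (x y z p r v : 'rV[R]_d) (s e : R).

(* If [u] is semiconcave with constant [C], then [upgrad u C x] is [D^+u(x)]. *)
Definition upgrad (u : 'rV[R]_d -> R) (C : R) x p := forall z,
  u z <= u x + dotv p (z - x) + C / 2 * dotv (z - x) (z - x).

(** [C] is kept apart because it fixes the decay rate of the defect; [K] dominates all constants, so
    that errors become polynomials in [K]. Periodicity and semiconcavity have been used to make
    every bound global, and the viscosity inequalities are tested with global paraboloids. *)
Record semiconcave_solution (V u : 'rV[R]_d -> R) (g : 'rV[R]_d -> 'rV[R]_d)
    (C K : R) : Prop := SemiconcaveSolution {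
  sol_C_gt0 : 0 < C;
  sol_K_ge1 : 1 <= K;
  sol_C_le : C <= K;
  sol_V_taylor : forall x a, `|V (x + a) - V x - dotv (g x) a| <= K * dotv a a;
  sol_g_lip : forall x a, enorm (g (x + a) - g x) <= K * enorm a;
  sol_g_le : forall x, enorm (g x) <= K;
  sol_V_bounds : forall x, - K <= V x <= 0;
  sol_u_cont : continuous u;
  sol_u_bounds : forall x, `|u x| <= K;
  sol_u_lip : forall x y, `|u x - u y| <= K * enorm (x - y);
  sol_midpoint : forall x a, u (x + a) + u (x - a) - 2 * u x <= C * dotv a a;
  sol_upgrad : forall x p c,
    (forall z, u z <= u x + dotv p (z - x) + c * dotv (z - x) (z - x)) ->
    upgrad u C x p;
  sol_sub : forall x p, upgrad u C x p -> 2^-1 * dotv p p + V x <= 0;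
  sol_super : forall x p c,
    (forall z, u x + dotv p (z - x) - c * dotv (z - x) (z - x) <= u z) ->
    0 <= 2^-1 * dotv p p + V x }.

Variables (V u : 'rV[R]_d -> R) (g : 'rV[R]_d -> 'rV[R]_d) (C K : R).
Hypothesis H : semiconcave_solution V u g C K.

Lemma upgrad_le p x : upgrad u C x p -> enorm p <= 2 * K.
Proof.
move=> /(sol_sub H) h; have /andP[hV _] := sol_V_bounds H x.
have K1 := sol_K_ge1 H; apply: enorm_le_sqr; first lra.
have : 0 <= K * (K - 1) by rewrite mulr_ge0 //; lra.
rewrite expr2; lra.
Qed.

(** The two defining inequalities added. This is the one-sided Lipschitz bound: forward flows
    separate at rate at most [C]. *)
Lemma upgrad_monotone x p y q : upgrad u C x p -> upgrad u C y q ->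
  dotv (p - q) (x - y) <= C * dotv (x - y) (x - y).
Proof.
move=> /(_ y) h1 /(_ x) h2; move: h1 h2.
rewrite !dotvE (dotvC y x); lra.
Qed.

(** The midpoint inequality reflects the lower paraboloid into an upper one, so [r] belongs to both
    differentials and both viscosity inequalities apply to it. *)
Lemma subgrad_eq x r c :
  (forall z, u x + dotv r (z - x) - c * dotv (z - x) (z - x) <= u z) ->
  upgrad u C x r /\ 2^-1 * dotv r r + V x = 0.
Proof.
move=> h; have hr : upgrad u C x r.
  apply: (sol_upgrad H (c := c + C)) => z.
  have := sol_midpoint H x (z - x); rewrite [x + _]addrC subrK => h1.
  have E : x - (z - x) - x = - (z - x) by rewrite addrAC subrr sub0r.
  have := h (x - (z - x)); rewrite E; move: (z - x) h1 => a.
  rewrite !dotvE; lra.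
split=> //; apply/eqP; rewrite eq_le (sol_sub H hr) /=; exact: sol_super H _ _ _ h.
Qed.

Lemma prox_exists e x : 0 < e ->
  exists y, forall z, u z - (2 * e)^-1 * dotv (z - x) (z - x) <=
                      u y - (2 * e)^-1 * dotv (y - x) (y - x).
Proof.
move=> e0.
(* At a distance [n > 1 + 4 e K] one has [n^2 >= n >= 4 e K], so the penalty reaches the oscillation
   [2 K] of [u]. *)
apply: (@argmax_coercive _ _ (fun z => u z - (2 * e)^-1 * dotv (z - x) (z - x)) x
  (1 + 4 * e * K)).
  have c1 : continuous (fun y : 'rV[R]_d => y - x).
    by move=> y; apply: continuousB; [exact: cvg_id | exact: cst_continuous].
  move=> z; apply: (@continuousB _ _ _ u); first exact: (sol_u_cont H).
  apply: (@continuousM _ _ (cst (2 * e)^-1) (fun z => dotv (z - x) (z - x))).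
    exact: cst_continuous.
  by apply: (@continuous_comp _ _ _ (fun y => y - x) (fun z => dotv z z));
    [exact: c1 | exact: continuous_sqnorm].
move=> z hz; rewrite subrr dotv0r mulr0 subr0 -enorm_sqr.
have := sol_u_bounds H z; have := sol_u_bounds H x.
rewrite !ler_norml => /andP[b1 _] /andP[_ b2].
suff : 2 * K <= (2 * e)^-1 * enorm (z - x) ^+ 2 by lra.
have K1 := sol_K_ge1 H; rewrite ler_pdivlMl ?mulr_gt0 // expr2.
set n := enorm _ in hz *; have eK : 0 <= e * K by rewrite mulr_ge0 //; lra.
have : 0 <= n * (n - 1) by rewrite mulr_ge0 //; lra.
lra.
Qed.

Lemma prox_choice : exists P : R -> 'rV[R]_d -> 'rV[R]_d, forall e x, 0 < e ->
  forall z, u z - (2 * e)^-1 * dotv (z - x) (z - x) <=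
    u (P e x) - (2 * e)^-1 * dotv (P e x - x) (P e x - x).
Proof.
have /choice[P hP] (ex : R * 'rV[R]_d) : exists y, 0 < ex.1 ->
    forall z, u z - (2 * ex.1)^-1 * dotv (z - ex.2) (z - ex.2) <=
    u y - (2 * ex.1)^-1 * dotv (y - ex.2) (y - ex.2).
  have [e0|_] := ltP 0 ex.1; last by exists 0.
  by have [y hy] := prox_exists ex.2 e0; exists y.
by exists (fun e x => P (e, x)) => e x e0; exact: (hP (e, x)).
Qed.

Lemma prox_upgrad e x y : 0 < e ->
  (forall z, u z - (2 * e)^-1 * dotv (z - x) (z - x) <=
             u y - (2 * e)^-1 * dotv (y - x) (y - x)) ->
  upgrad u C y (e^-1 *: (y - x)).
Proof.
move=> e0 h; apply: (sol_upgrad H (c := (2 * e)^-1)) => z.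
have := h z; rewrite invfM; set f := e^-1 => h1.
apply: le_trans (_ : u y + 2^-1 * f * (dotv (z - x) (z - x) - dotv (y - x) (y - x)) <= _).
  by move: h1; lra.
rewrite !dotvE (dotvC x y) (dotvC z y) (dotvC z x); lra.
Qed.

(** Converse of [prox_upgrad], by completing the square. When [e C < 1] the last term makes [y] the
    strict proximal point of [y - e p], so any momentum of [D^+u] can be prescribed. *)
Lemma upgrad_prox e y p : 0 < e ->
  upgrad u C y p -> let x := y - e *: p in forall z,
  u z - (2 * e)^-1 * dotv (z - x) (z - x) <=
  u y - (2 * e)^-1 * dotv (y - x) (y - x) -
    (e^-1 - C) / 2 * dotv (z - y) (z - y).
Proof.
move=> e0 hp x z; have := hp z; rewrite /x.
have -> : y - (y - e *: p) = e *: p by rewrite subKr.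
have -> : z - (y - e *: p) = (z - y) + e *: p by apply/rowP => i; rewrite !mxE; ring.
move: (z - y) => a; rewrite !dotvE (dotvC a p) => h.
have -> : (2 * e)^-1 * (dotv a a + e * dotv p a + (e * dotv p a + e * (e * dotv p p)))
  = (e^-1 / 2) * dotv a a + dotv p a + e / 2 * dotv p p by field; rewrite gt_eqF.
have -> : (2 * e)^-1 * (e * (e * dotv p p)) = e / 2 * dotv p p by field; rewrite gt_eqF.
lra.
Qed.

End Prox.

(** * One Lax-Oleinik step along straight segments *)

Section OneStep.
Variables (R : realType) (d : nat).
Implicit Types (x y z w p r v : 'rV[R]_d) (s e : R).
Variables (V u : 'rV[R]_d -> R) (g : 'rV[R]_d -> 'rV[R]_d) (C K : R).
Hypothesis H : semiconcave_solution V u g C K.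

Let K_ge0 : 0 <= K.
Proof. by have := sol_K_ge1 H; lra. Qed.

Let J := avg_line V.
Let G := avg_grad g.

Let J_left := avg_line_expand_left K_ge0 (sol_V_taylor H) (sol_g_lip H).
Let J_segment := dotv_avg_grad_segment (sol_V_taylor H) (sol_g_lip H).
Let J_bounds z y := avg_line_bounds (sol_V_taylor H) z y (sol_V_bounds H).
Let G_near := avg_grad_near K_ge0 (sol_g_lip H).
Let G_le := avg_grad_bounded K_ge0 (sol_g_lip H) (sol_g_le H).

Ltac real_lra := clear_le_but K_ge0;
  repeat match goal with |- context [J ?a ?b] => generalize (J a b); intro end;
  gen_atoms; intros; lra.
Ltac real_lra2 := clear_le_but K_ge0; gen_atoms; intros; split; lra.

(* The cost of the straight segment run in time [s] from [z] to [y]. *)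
Definition action s z y := (2 * s)^-1 * dotv (y - z) (y - z) - s * J z y.

Definition action_min s y w := forall z, u w + action s w y <= u z + action s z y.

Lemma action_min_exists s y : 0 < s -> exists w, action_min s y w.
Proof.
move=> s0.
have c1 : continuous (fun z => y - z).
  by move=> z; apply: continuousB; [exact: cst_continuous | exact: cvg_id].
have c2 : continuous (fun z => (2 * s)^-1 * dotv (y - z) (y - z)).
  move=> z; apply: (@continuousM _ _ (cst (2 * s)^-1) (fun z => dotv (y - z) (y - z))).
    exact: cst_continuous.
  by apply: (@continuous_comp _ _ _ (fun z => y - z) (fun z => dotv z z));
    [exact: c1 | exact: continuous_sqnorm].
have cJ : continuous (fun z => J z y).
  by apply: (@taylor_continuous _ _ _ K) => x; exists (G x y) => a; exact: J_left.
have c3 : continuous (fun z => s * J z y).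
  move=> z; apply: (@continuousM _ _ (cst s) (fun z => J z y)).
    exact: cst_continuous.
  exact: cJ.
have [w hw] : exists w, forall z, - (u z + action s z y) <= - (u w + action s w y).
  apply: (@argmax_coercive _ _ (fun z => - (u z + action s z y)) y (1 + 2 * s * (2 * K + s * K))).
    move=> z; apply: (@continuousN _ _ _ (fun z => u z + action s z y)).
    apply: (@continuousD _ _ _ u (fun z => action s z y)); first exact: (sol_u_cont H).
    apply: (@continuousB _ _ _ (fun z => (2 * s)^-1 * dotv (y - z) (y - z))
      (fun z => s * J z y)); [exact: c2 | exact: c3].
  move=> z; rewrite enormB => hz; rewrite lerN2 /action subrr dotv0r mulr0 -enorm_sqr.
  have := sol_u_bounds H z; have := sol_u_bounds H y.
  rewrite !ler_norml => /andP[b1 b1'] /andP[b2 b2'].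
  have /andP[j1 _] := J_bounds y y; have /andP[_ j2] := J_bounds z y.
  have j3 : s * - K <= s * J y y by rewrite ler_wpM2l // ltW.
  have j4 : s * J z y <= 0 by rewrite mulr_ge0_le0 // ltW.
  suff : 2 * K + s * K <= (2 * s)^-1 * enorm (y - z) ^+ 2.
    by move: b1' b2 j3 j4; real_lra.
  rewrite ler_pdivlMl ?mulr_gt0 // expr2.
  set n := enorm _ in hz *; have sK : 0 <= s * (2 * K + s * K).
    by rewrite mulr_ge0 ?addr_ge0 ?mulr_ge0 // ltW.
  have : 0 <= n * (n - 1) by rewrite mulr_ge0 //; move: hz sK; real_lra.
  by move: hz sK; real_lra.
by exists w => z; move: (hw z); rewrite lerN2.
Qed.

Section Minimizer.
Variables (s : R) (y w rho : 'rV[R]_d).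
Hypotheses (s0 : 0 < s) (s1 : s <= 1) (hw : action_min s y w).
Hypothesis ywE : y - w = s *: rho.

(** By minimality, minus the action touches [u] from below at [w] up to a constant and a quadratic
    error. Its gradient in the foot is [rho + s G], to which [subgrad_eq] applies. *)
Lemma action_min_upgrad :
  upgrad u C w (rho + s *: G w y) /\
  2^-1 * dotv (rho + s *: G w y) (rho + s *: G w y) + V w = 0.
Proof.
apply: (@subgrad_eq _ _ _ _ _ _ _ H _ _ ((2 * s)^-1 + s * K)) => z.
have := hw z; rewrite /action.
have -> : y - z = s *: rho - (z - w) by rewrite -ywE opprB addrA subrK.
have := J_left w y (z - w); rewrite [w + _]addrC subrK ywE -/J -/G.
move: (z - w) => a; rewrite ler_norml => /andP[j _].
have {}j : s * (J w y + dotv (G w y) a - K * dotv a a) <= s * J z y.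
  by rewrite ler_wpM2l ?(ltW s0) //; lra.
have -> : (2 * s)^-1 * dotv (s *: rho - a) (s *: rho - a) =
    s / 2 * dotv rho rho - dotv rho a + (2 * s)^-1 * dotv a a.
  by rewrite !dotvE (dotvC a rho); field; rewrite gt_eqF.
rewrite !dotvE.
have -> : (2 * s)^-1 * (s * (s * dotv rho rho)) = s / 2 * dotv rho rho.
  by field; rewrite gt_eqF.
lra.
Qed.

(** In the Hamilton-Jacobi equation at [w] the cross term [s rho.G] equals [J w y - V w] by the
    segment identity, and [V w] cancels. *)
Lemma action_min_avg :
  J w y = - (2^-1 * dotv rho rho) - s ^+ 2 / 2 * dotv (G w y) (G w y).
Proof.
have [_] := action_min_upgrad; have := J_segment w y.
rewrite ywE -/J -/G !dotvE (dotvC (G w y) rho) expr2; lra.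
Qed.

Lemma action_min_speed : enorm rho <= 3 * K.
Proof.
have [/(upgrad_le H) h _] := action_min_upgrad.
have := enormD (rho + s *: G w y) (- (s *: G w y)); rewrite addrK enormN enormZ.
rewrite (gtr0_norm s0); have : s * enorm (G w y) <= 1 * K.
  by rewrite ler_pM ?enorm_ge0 // ltW.
lra.
Qed.

Lemma action_min_grad : enorm (G w y - 2^-1 *: g y) <= 3 * K ^+ 2 * s.
Proof.
apply: le_trans (G_near w y) _; rewrite ywE enormZ (gtr0_norm s0).
rewrite (_ : 3 * K ^+ 2 * s = K * (s * (3 * K))); last by ring.
by rewrite !ler_wpM2l ?(ltW s0) // action_min_speed.
Qed.

Lemma action_min_residual :
  `|s ^+ 2 / 2 * dotv (G w y) (G w y) - s ^+ 2 / 8 * dotv (g y) (g y)| <=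
    3 * K ^+ 3 * s ^+ 3.
Proof.
have E : s ^+ 2 / 2 * dotv (G w y) (G w y) - s ^+ 2 / 8 * dotv (g y) (g y) =
  s ^+ 2 / 2 * dotv (G w y - 2^-1 *: g y) (G w y + 2^-1 *: g y).
  by rewrite !dotvE (dotvC (g y)); field.
rewrite E normrM (ger0_norm (_ : 0 <= s ^+ 2 / 2)); last by rewrite divr_ge0 ?sqr_ge0.
have h1 : enorm (G w y + 2^-1 *: g y) <= 2 * K.
  apply: le_trans (enormD _ _) _; rewrite enormZ ger0_norm //.
  have := G_le w y; have := sol_g_le H y; rewrite -/G; have := enorm_ge0 (g y); lra.
have h2 : `|dotv (G w y - 2^-1 *: g y) (G w y + 2^-1 *: g y)| <=
    3 * K ^+ 2 * s * (2 * K).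
  apply: le_trans (dotv_norm_le _ _) _.
  by rewrite ler_pM ?enorm_ge0 // action_min_grad.
rewrite (_ : 3 * K ^+ 3 * s ^+ 3 = s ^+ 2 / 2 * (3 * K ^+ 2 * s * (2 * K))); last by field.
by rewrite ler_wpM2l // divr_ge0 ?sqr_ge0.
Qed.

(** With fixed endpoints the time derivative of the action is [- |rho|^2 / 2 - J], which
    [action_min_avg] turns into [s^2 |G|^2 / 2]. The last term is the exact remainder of the convex
    function [1 / s]. *)
Lemma action_time_change s' : 0 < s' ->
  action s' w y = action s w y + (s' - s) * (s ^+ 2 / 2 * dotv (G w y) (G w y))
    + 2^-1 * dotv rho rho * ((s' - s) ^+ 2 / s').
Proof.
move=> s'0; rewrite /action action_min_avg ywE !dotvE.
by field; rewrite !gt_eqF.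
Qed.

End Minimizer.

(* The coefficient 1/24 is the second-order correction of the straight-line
   action: the Hamilton-Jacobi residual of [action s z y] at a minimizer is
   [s^2/2 |G|^2 = s^2/8 |g y|^2 + O(s^3)]. *)
Lemma action_min_value s y w : 0 < s -> s <= 1 -> action_min s y w ->
  `|u w + action s w y - u y - s ^+ 3 / 24 * dotv (g y) (g y)| <= 3 * K ^+ 3 * s ^+ 4.
Proof.
move=> s0 s1 hw.
have /choice[W hW] (t : R) : exists w', 0 < t -> action_min t y w'.
  have [t0|_] := ltP 0 t; last by exists 0.
  by have [w' hw'] := action_min_exists y t0; exists w'.
have [F FE] : exists F, forall t, F t = u (W t) + action t (W t) y by eexists.
have -> : u w + action s w y = F s.
  by apply/eqP; rewrite FE eq_le hw (hW s s0).
set ga := dotv (g y) (g y).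
have ga0 : 0 <= ga by exact: dotv_ge0.
have [Q QE] : exists Q, Q = 3 * K ^+ 3 by eexists.
have Q0 : 0 <= Q by rewrite QE mulr_ge0 // exprn_ge0.
(* The minimizer for time [a] competes at time [b]. Both orders of [a] and [b] are used, giving the
   two sides of the estimate. *)
have comp a b : 0 < a -> a <= 1 -> 0 < b ->
    F b <= F a + (b - a) * (a ^+ 2 / 8 * ga) + `|b - a| * (Q * a ^+ 3)
       + 9 * K ^+ 2 / 2 * ((b - a) ^+ 2 / b).
  move=> a0 a1 b0; rewrite !FE; apply: le_trans (hW b b0 (W a)) _.
  have ha := hW a a0; pose rho := a^-1 *: (y - W a).
  have ywE : y - W a = a *: rho by rewrite scalerA divff ?scale1r // gt_eqF.
  rewrite (action_time_change a0 ha ywE b0).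
  have := action_min_residual a0 a1 ha ywE; rewrite -/ga -QE.
  have := action_min_speed a0 a1 ha ywE.
  set GG := _ * dotv _ _ => h1 h2.
  have h3 : dotv rho rho <= 9 * K ^+ 2.
    rewrite -enorm_sqr (_ : 9 * K ^+ 2 = (3 * K) ^+ 2); last by ring.
    by rewrite ler_pXn2r ?nnegrE ?enorm_ge0 ?mulr_ge0.
  have h4 : (b - a) * (GG - a ^+ 2 / 8 * ga) <= `|b - a| * (Q * a ^+ 3).
    by apply: le_trans (ler_norm _) _; rewrite normrM ler_wpM2l.
  have h5 : 2^-1 * dotv rho rho * ((b - a) ^+ 2 / b) <= 9 * K ^+ 2 / 2 * ((b - a) ^+ 2 / b).
    by rewrite ler_wpM2r ?divr_ge0 ?sqr_ge0 ?(ltW b0) //; move: h3; real_lra.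
  by move: h4 h5; real_lra.
(* The quadratic error has a constant that blows up as [al] tends to 0, but [increment_halving]
   discards it, so the resulting bound is uniform in [al]. *)
have diff al : 0 < al -> al <= s ->
    `|F s - F al - (s ^+ 3 - al ^+ 3) / 24 * ga| <= Q * s ^+ 4.
  move=> al0 als.
  have pw a : 0 <= a -> a <= s -> Q * a ^+ 3 <= Q * s ^+ 3.
    by move=> a0 as_; rewrite ler_wpM2l // ler_pXn2r ?nnegrE // ltW.
  have Qs : Q * s ^+ 3 * (s - al) <= Q * s ^+ 4.
    rewrite (_ : Q * s ^+ 4 = Q * s ^+ 3 * s); last by ring.
    rewrite ler_wpM2l //; last by rewrite gerBl ltW.
    by rewrite mulr_ge0 ?exprn_ge0 // ltW.
  have ord a b : al <= a -> a <= b -> b <= s -> [/\ 0 < a, a <= 1, 0 < b & b <= 1].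
    by move=> k1 k2 k3; move: k1 k2 k3 al0 s1; real_lra2.
  have sq a b : al <= a -> a <= b -> b <= s ->
     9 * K ^+ 2 / 2 * ((b - a) ^+ 2 / b) <= 9 * K ^+ 2 / (2 * al) * (b - a) ^+ 2 /\
     9 * K ^+ 2 / 2 * ((b - a) ^+ 2 / a) <= 9 * K ^+ 2 / (2 * al) * (b - a) ^+ 2.
    move=> ala ab bs; have [a0 _ b0 _] := ord _ _ ala ab bs.
    have X c : al <= c -> 9 * K ^+ 2 / 2 * ((b - a) ^+ 2 / c) <=
        9 * K ^+ 2 / (2 * al) * (b - a) ^+ 2.
      move=> alc; rewrite invfM (_ : 9 * K ^+ 2 * (2^-1 * al^-1) * (b - a) ^+ 2 =
        9 * K ^+ 2 / 2 * ((b - a) ^+ 2 / al)); last by ring.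
      rewrite ler_wpM2l ?divr_ge0 ?mulr_ge0 ?sqr_ge0 //.
      by rewrite ler_wpM2l ?sqr_ge0 // lef_pV2 ?posrE //; exact: lt_le_trans alc.
    by split; apply: X => //; exact: le_trans ab.
  have U : (F s - s ^+ 3 / 24 * ga) - (F al - al ^+ 3 / 24 * ga) <= Q * s ^+ 3 * (s - al).
    apply: (@increment_halving _ (fun t => F t - t ^+ 3 / 24 * ga) _ _ _
      (9 * K ^+ 2 / (2 * al))) => // a b ala ab bs.
    have [a0 a1 b0 _] := ord _ _ ala ab bs.
    have := comp a b a0 a1 b0; have [+ _] := sq _ _ ala ab bs.
    have := pw a (ltW a0) (le_trans ab bs).
    rewrite ger0_norm ?subr_ge0 // => k1 k2 k3.
    have k4 : (b - a) * (Q * a ^+ 3) <= (b - a) * (Q * s ^+ 3).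
      by rewrite ler_wpM2l // subr_ge0.
    (* This is [b^3 - a^3 - 3 a^2 (b - a)]: the increment of the cube dominates its tangent at
       [a]. *)
    have k5 : 0 <= (b - a) ^+ 2 * (b + 2 * a) * ga.
      apply: mulr_ge0 => //; apply: mulr_ge0; first exact: sqr_ge0.
      by move: a0 b0; real_lra.
    by move: k1 k2 k3 k4 k5; real_lra.
  have L : (s ^+ 3 / 24 * ga - F s) - (al ^+ 3 / 24 * ga - F al) <= Q * s ^+ 3 * (s - al).
    apply: (@increment_halving _ (fun t => t ^+ 3 / 24 * ga - F t) _ _ _
      (9 * K ^+ 2 / (2 * al))) => // a b ala ab bs.
    have [a0 _ b0 b1] := ord _ _ ala ab bs.
    have := comp b a b0 b1 a0; have [_ +] := sq _ _ ala ab bs.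
    have := pw b (ltW b0) bs.
    rewrite distrC ger0_norm ?subr_ge0 // => k1 k2 k3.
    have k4 : (b - a) * (Q * b ^+ 3) <= (b - a) * (Q * s ^+ 3).
      by rewrite ler_wpM2l // subr_ge0.
    have k5 : 0 <= (b - a) ^+ 2 * (2 * b + a) * ga.
      apply: mulr_ge0 => //; apply: mulr_ge0; first exact: sqr_ge0.
      by move: a0 b0; real_lra.
    rewrite -[in (a - b) ^+ 2]opprB sqrrN in k3.
    by move: k1 k2 k3 k4 k5; real_lra.
  by rewrite ler_norml; apply/andP; move: U L Qs; real_lra2.
(* The initial value of [F]: for the upper bound [y] itself competes, for the lower one the foot is
   within [3 K al] of [y]. *)
have start al : 0 < al -> al <= 1 -> `|F al - u y| <= 3 * K ^+ 2 * al.
  move=> al0 al1; have hal := hW al al0.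
  have /andP[j1 _] := J_bounds y y; have /andP[_ j2] := J_bounds (W al) y.
  have K2 : K * al <= 3 * K ^+ 2 * al.
    have kk := sol_K_ge1 H; rewrite ler_wpM2r ?(ltW al0) // expr2.
    have : 0 <= K * (3 * K - 1) by rewrite mulr_ge0 //; move: kk; real_lra.
    by real_lra.
  rewrite ler_norml; apply/andP; split.
    have := sol_u_lip H (W al) y; rewrite ler_norml => /andP[l1 _].
    have ywE : y - W al = al *: (al^-1 *: (y - W al)).
      by rewrite scalerA divff ?scale1r // gt_eqF.
    have := action_min_speed al0 al1 hal ywE.
    rewrite enormZ gtr0_norm ?invr_gt0 // ler_pdivrMl // => l2.
    have l3 : K * enorm (W al - y) <= K * (al * (3 * K)).
      by rewrite enormB ler_wpM2l.
    have l4 : 0 <= action al (W al) y.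
      rewrite /action subr_ge0; apply: (@le_trans _ _ 0).
        by rewrite mulr_ge0_le0 // ltW.
      by rewrite mulr_ge0 ?dotv_ge0 // invr_ge0 mulr_ge0 // ltW.
    by rewrite FE expr2; move: l1 l3 l4; real_lra.
  have := hal y; rewrite FE {2}/action subrr dotv0r mulr0.
  have k1 : al * - K <= al * J y y by rewrite ler_wpM2l // ltW.
  by move=> k2; move: k1 k2 K2; real_lra.
apply/ler_addgt0Pr => e e0.
pose M := 3 * K ^+ 2 + ga.
have M1 : 0 < M.
  by rewrite ltr_pwDl // mulr_gt0 // exprn_gt0 // (lt_le_trans ltr01) // (sol_K_ge1 H).
pose al := Num.min s (e / M).
have al0 : 0 < al by rewrite lt_min s0 divr_gt0.
have als : al <= s by rewrite ge_min lexx.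
have al1 : al <= 1 by exact: le_trans s1.
have alM : al * M <= e.
  by rewrite -ler_pdivlMr // ge_min lexx orbT.
have := diff al al0 als; have := start al al0 al1.
have a3 : al ^+ 3 <= al.
  by rewrite exprS -[leRHS]mulr1 ler_wpM2l ?(ltW al0) // expr_le1 // ltW.
have a30 : 0 <= al ^+ 3 by rewrite exprn_ge0 // ltW.
have a4 : al ^+ 3 * ga <= al * ga by rewrite ler_wpM2r.
have a5 : 0 <= al ^+ 3 * ga by rewrite mulr_ge0.
rewrite !ler_norml => /andP[s2 s3] /andP[s4 s5]; apply/andP.
rewrite -QE /M in alM *; move: alM s2 s3 s4 s5 a3 a30 a4 a5 ga0 al0; have := K_ge0; real_lra2.
Qed.

End OneStep.

(** * Velocity and value bounds from a one-step minimizer *)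

Section BackwardBound.
Variables (R : realType) (d : nat).
Implicit Types (x y z w p r v b c : 'rV[R]_d) (s e : R).
Variables (V u : 'rV[R]_d -> R) (g : 'rV[R]_d -> 'rV[R]_d) (C K : R).
Hypothesis H : semiconcave_solution V u g C K.

Let K_ge0 : 0 <= K.
Proof. by have := sol_K_ge1 H; lra. Qed.

Ltac real_lra := lra_but K_ge0.

(** The foot [w], optimal for [y + b], competes for [y]. The two actions differ by [rho.b] to
    leading order, while the minimal values differ as [u] does, hence by at most [p.b] to leading
    order. The two [s^3 / 24] corrections cancel up to a multiple of [|b|]. *)
Lemma action_min_slope s y p b w rho : 0 < s -> s <= 1 ->
  upgrad u C y p -> action_min V u s (y + b) w -> y + b - w = s *: rho ->
  dotv rho b <= dotv p b + s / 2 * dotv (g y) b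
    + dotv b b * ((2 * s)^-1 + 3 * K) + 4 * K ^+ 2 * s ^+ 2 * enorm b
    + 6 * K ^+ 3 * s ^+ 4.
Proof.
move=> s0 s1 hp hw ywE.
have [w0 hw0] := action_min_exists H y s0.
have h1 := action_min_value H s0 s1 hw0.
have h2 := action_min_value H s0 s1 hw.
have h3 := hw0 w.
have ybE : y + b - y = b by rewrite addrAC subrr add0r.
have h4 := hp (y + b); rewrite ybE in h4.
have speed := action_min_speed H s0 s1 hw ywE.
have gb : `|dotv (g (y + b) - g y) b| <= K * dotv b b.
  apply: le_trans (dotv_norm_le _ _) _; rewrite -enorm_sqr expr2 mulrA.
  by rewrite ler_wpM2r ?enorm_ge0 // (sol_g_lip H).
have gg : `|dotv (g (y + b)) (g (y + b)) - dotv (g y) (g y)| <= 2 * K ^+ 2 * enorm b.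
  have -> : dotv (g (y + b)) (g (y + b)) - dotv (g y) (g y) =
      dotv (g (y + b) - g y) (g (y + b) + g y).
    by rewrite !dotvE (dotvC (g y) (g (y + b))); ring.
  apply: le_trans (dotv_norm_le _ _) _.
  have -> : 2 * K ^+ 2 * enorm b = K * enorm b * (2 * K) by ring.
  rewrite ler_pM ?enorm_ge0 // ?(sol_g_lip H) //.
  apply: le_trans (enormD _ _) _; have := sol_g_le H (y + b); have := sol_g_le H y; lra.
have J := avg_line_expand_right K_ge0 (sol_V_taylor H) (sol_g_lip H) w (y + b) (- b).
rewrite addrK enormN ywE enormZ (gtr0_norm s0) in J.
have act : action V s w (y + b) - action V s w y =
    dotv rho b - (2 * s)^-1 * dotv b b - s * (avg_line V w (y + b) - avg_line V w y).
  rewrite /action; have -> : y - w = s *: rho - b by rewrite -ywE addrAC addrK.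
  by rewrite ywE !dotvE (dotvC b rho); field; rewrite gt_eqF.
have sJ : s * (avg_line V w (y + b) - avg_line V w y) <=
    s / 2 * dotv (g y) b + 2 * K * dotv b b + 3 * K ^+ 2 * s ^+ 2 * enorm b.
  have j1 : avg_line V w (y + b) - avg_line V w y <=
    2^-1 * dotv (g (y + b)) b + K * dotv b b + K * (s * (3 * K) * enorm b).
    have j2 : K * (s * enorm rho * enorm b) <= K * (s * (3 * K) * enorm b).
      by rewrite ler_wpM2l // ler_wpM2r ?enorm_ge0 // ler_wpM2l // ltW.
    move: J; rewrite !dotvE ler_norml => /andP[j3 j4]; move: j2 j3 j4.
    move: (avg_line V w (y + b)) (avg_line V w y) => ? ?.
    real_lra.
  have j3 : dotv (g (y + b)) b <= dotv (g y) b + K * dotv b b.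
    by move: gb; rewrite !dotvE ler_norml => /andP[_]; real_lra.
  apply: le_trans (_ : s * (2^-1 * dotv (g (y + b)) b + K * dotv b b +
     K * (s * (3 * K) * enorm b)) <= _); first by rewrite ler_wpM2l // ltW.
  have j4 : s * (2^-1 * dotv (g (y + b)) b) <= s * (2^-1 * (dotv (g y) b + K * dotv b b)).
    by rewrite ler_wpM2l ?(ltW s0) // ler_wpM2l.
  have j5 : s * (K * dotv b b) <= K * dotv b b.
    by rewrite -[leRHS]mul1r ler_wpM2r // mulr_ge0 ?dotv_ge0.
  by move: (mulr_ge0 K_ge0 (dotv_ge0 b)) j4 j5; real_lra.
have s3 : `|s ^+ 3 / 24 * (dotv (g (y + b)) (g (y + b)) - dotv (g y) (g y))| <=
    K ^+ 2 * s ^+ 2 * enorm b.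
  rewrite normrM ger0_norm; last by rewrite divr_ge0 // exprn_ge0 // ltW.
  apply: le_trans (_ : s ^+ 3 / 24 * (2 * K ^+ 2 * enorm b) <= _).
    by rewrite ler_wpM2l // divr_ge0 // exprn_ge0 // ltW.
  have P0 : 0 <= K ^+ 2 * s ^+ 2 * enorm b by rewrite mulr_ge0 ?enorm_ge0 // mulr_ge0 ?sqr_ge0.
  have -> : s ^+ 3 / 24 * (2 * K ^+ 2 * enorm b) = s * (K ^+ 2 * s ^+ 2 * enorm b) / 12.
    by field.
  have : s * (K ^+ 2 * s ^+ 2 * enorm b) <= 1 * (K ^+ 2 * s ^+ 2 * enorm b).
    by rewrite ler_wpM2r.
  by move: P0; move: (K ^+ 2 * s ^+ 2 * enorm b) => X; real_lra.
have Cb : C / 2 * dotv b b <= K / 2 * dotv b b.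
  by rewrite ler_wpM2r ?dotv_ge0 // ler_wpM2r // (sol_C_le H).
have Kb := mulr_ge0 K_ge0 (dotv_ge0 b).
move: h1 h2 s3; rewrite mulrBr !ler_norml => /andP[h1 _] /andP[_ h2] /andP[_ s3].
move: h1 h2 s3 h3 h4 act sJ Cb Kb.
move: (action _ _ _ _) (action V s w0 y) (action V s w y) => ? ? ?.
move: (avg_line V w (y + b)) (avg_line V w y) => ? ?.
move: (K ^+ 3) (K ^+ 2) (s ^+ 4) (s ^+ 3) (s ^+ 2) ((2 * s)^-1) => ? ? ? ? ? ?.
move: (u _) (u _) (u _) (u _) => ? ? ? ?.
real_lra.
Qed.

(** The supergradient at the foot [w] is known explicitly, so [u (y - c)] is estimated from [w], and
    [u w] is recovered from [u y] through the minimal value. *)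
Lemma action_min_upper s y w rho c : 0 < s -> s <= 1 ->
  action_min V u s y w -> y - w = s *: rho ->
  u (y - c) <= u y - dotv rho c + s * dotv (avg_grad g w y) (s *: rho - c)
    + C / 2 * dotv (s *: rho - c) (s *: rho - c) + K ^+ 2 * s ^+ 3 + 3 * K ^+ 3 * s ^+ 4.
Proof.
move=> s0 s1 hw ywE.
have h1 := action_min_value H s0 s1 hw.
have [hr _] := action_min_upgrad H s0 hw ywE.
have h2 := hr (y - c).
have E : y - c - w = s *: rho - c by rewrite -ywE addrAC.
rewrite E in h2.
have act : action V s w y = s * dotv rho rho + s ^+ 3 / 2 *
    dotv (avg_grad g w y) (avg_grad g w y).
  by rewrite /action (action_min_avg H s0 hw ywE) ywE !dotvE; field; rewrite gt_eqF.
have G0 : 0 <= s ^+ 3 / 2 * dotv (avg_grad g w y) (avg_grad g w y).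
  by rewrite mulr_ge0 ?dotv_ge0 // divr_ge0 // exprn_ge0 // ltW.
have gg : s ^+ 3 / 24 * dotv (g y) (g y) <= K ^+ 2 * s ^+ 3.
  have g2 : dotv (g y) (g y) <= K ^+ 2.
    by rewrite -enorm_sqr ler_pXn2r ?nnegrE ?enorm_ge0 // (sol_g_le H).
  have s30 : 0 <= s ^+ 3 by rewrite exprn_ge0 // ltW.
  apply: le_trans (_ : s ^+ 3 / 24 * K ^+ 2 <= _).
    by rewrite ler_wpM2l // divr_ge0.
  by move: (mulr_ge0 s30 (sqr_ge0 K)); real_lra.
move: h1; rewrite act ler_norml => /andP[_ h1].
move: h2; rewrite dotvDl dotvZl.
have -> : dotv rho (s *: rho - c) = s * dotv rho rho - dotv rho c by rewrite !dotvE.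
move: h1 gg G0; move: (K ^+ 3) (K ^+ 2) (s ^+ 4) (s ^+ 3) => ? ? ? ?.
move: (u _) (u _) (u _) => ? ? ?.
real_lra.
Qed.

End BackwardBound.

(** * Second-order expansion of [u] backwards from a supergradient *)

Section BackwardExpansion.
Variables (R : realType) (d : nat).
Implicit Types (x y z w p r v b c : 'rV[R]_d) (s e : R).
Variables (V u : 'rV[R]_d -> R) (g : 'rV[R]_d -> 'rV[R]_d) (C K : R).
Hypothesis H : semiconcave_solution V u g C K.

Let K_ge0 : 0 <= K.
Proof. by have := sol_K_ge1 H; lra. Qed.

Ltac real_lra := lra_but K_ge0.

Lemma V_lipschitz x a : `|V (x + a) - V x| <= K * dotv a a + K * enorm a.
Proof.
have := sol_V_taylor H x a; have := dotv_norm_le (g x) a.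
have : enorm (g x) * enorm a <= K * enorm a by rewrite ler_wpM2r ?enorm_ge0 // (sol_g_le H).
rewrite !ler_norml; lra.
Qed.

Lemma dotv_le_bounds x y (a b : R) : enorm x <= a -> enorm y <= b ->
  `|dotv x y| <= a * b.
Proof.
move=> xa yb; apply: le_trans (dotv_norm_le _ _) _.
by rewrite ler_pM ?enorm_ge0.
Qed.

(* A one-step minimizer at [y] itself may have any velocity; the minimizer at a
   nearby point [y + b] has a velocity [rho] whose product with [b] is bounded by
   that of [p]. The direction [l] of [b] is the coefficient of [rho] in the
   expansion of [u (y - s *: v)], so that [rho] can be eliminated; its size
   [k s^2] balances the errors [k] and [s / k]. *)
Lemma backward_bound_expand s k D y p v : 0 < s -> s <= 1 -> 0 < k -> k <= 1 ->
  1 <= D -> K <= D -> upgrad u C y p -> enorm v <= D ->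
  u (y - s *: v) <= u y - s * dotv p v + s ^+ 2 *
    (2^-1 * dotv (g y) p - dotv (g y) v
     + C / 2 * (- 2 * V y - 2 * dotv p v + dotv v v)
     + k * (25 * D ^+ 5) + s * (200 * D ^+ 6 / k)).
Proof.
move=> s0 s1 k0 k1 D1 KD hp hv.
have C0 := sol_C_gt0 H; have CD : C <= D := le_trans (sol_C_le H) KD.
have D0 : 0 <= D by exact: le_trans D1.
have s0' := ltW s0; have k0' := ltW k0.
pose l := - v + (s / 2) *: g y - (C * s) *: v.
have hg : enorm (g y) <= D by exact: le_trans (sol_g_le H y) KD.
have pl n : D ^+ n <= D ^+ n.+1 by rewrite exprS ler_peMl ?exprn_ge0.
have hl : enorm l <= 3 * D ^+ 2.
  apply: le_trans (enormD _ _) _; apply: le_trans (lerD (enormD _ _) (lexx _)) _.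
  rewrite !enormN !enormZ !ger0_norm ?mulr_ge0 // ?(ltW C0) //.
  have h1 : s / 2 * enorm (g y) <= 1 * D by rewrite ler_pM ?enorm_ge0 ?divr_ge0 //; lra.
  have h2 : C * s * enorm v <= D * 1 * D by rewrite !ler_pM ?mulr_ge0 ?enorm_ge0 // ltW.
  have := pl 1; rewrite expr1 expr2; move: h1 h2 hv; real_lra.
have [b bl] : exists b : 'rV[R]_d, b = (k * s ^+ 2) *: l by eexists.
have [w hw] := action_min_exists H (y + b) s0.
pose rho := s^-1 *: (y + b - w).
have ywE : y + b - w = s *: rho by rewrite /rho scalerA divff ?scale1r // gt_eqF.
have speed := action_min_speed H s0 s1 hw ywE.
have hrho : enorm rho <= 3 * D by apply: le_trans speed _; rewrite ler_wpM2l.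
move: (rho) ywE speed hrho => {rho} rho ywE speed hrho.
have slope := action_min_slope H s0 s1 hp hw ywE.
have upper := action_min_upper H (s *: v + b) s0 s1 hw ywE.
have hub := hp (y + b).
have ybE : y + b - y = b by rewrite addrAC subrr add0r.
rewrite ybE in hub.
have E : y + b - (s *: v + b) = y - s *: v by apply/rowP => i; rewrite !mxE; ring.
rewrite E in upper.
have [e el] : exists e : 'rV[R]_d, e = (k * s) *: l by eexists.
have bE : b = s *: e by rewrite el scalerA bl; congr (_ *: _); ring.
have he : enorm e <= k * s * (3 * D ^+ 2).
  by rewrite el enormZ ger0_norm ?mulr_ge0 // ler_wpM2l ?mulr_ge0.
have he1 : enorm e <= s * (3 * D ^+ 2).
  apply: le_trans he _; rewrite -mulrA ler_piMl // mulr_ge0 // mulr_ge0 //.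
  exact: exprn_ge0.
have hb : enorm b <= s * (3 * D ^+ 2).
  rewrite bE enormZ ger0_norm //; apply: le_trans (_ : 1 * (s * (3 * D ^+ 2)) <= _).
    by rewrite ler_pM ?enorm_ge0.
  by rewrite mul1r.
have pw m n : (m <= n)%N -> D ^+ m <= D ^+ n by move=> mn; rewrite ler_weXn2l.
have hp' : enorm p <= 2 * D by apply: le_trans (upgrad_le H hp) _; rewrite ler_wpM2l.
have [G GA] : exists G : 'rV[R]_d, G = avg_grad g w (y + b) by eexists.
have [G' G'E] : exists G' : 'rV[R]_d, G' = G - 2^-1 *: g y by eexists.
have hG : enorm G <= D.
  by rewrite GA; apply: le_trans (avg_grad_bounded K_ge0 (sol_g_lip H) (sol_g_le H) _ _) _.
have GE : G = G' + 2^-1 *: g y by rewrite G'E subrK.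
have hG' : enorm G' <= s * (5 * D ^+ 3).
  have -> : G' = (G - 2^-1 *: g (y + b)) + 2^-1 *: (g (y + b) - g y).
    by rewrite G'E scalerBr addrA subrK.
  apply: le_trans (enormD _ _) _; rewrite enormZ ger0_norm //.
  have h1 : enorm (G - 2^-1 *: g (y + b)) <= 3 * D ^+ 2 * s.
    rewrite GA; apply: le_trans (action_min_grad H s0 s1 hw ywE) _.
    by rewrite ler_wpM2r // ler_wpM2l // ler_pXn2r ?nnegrE.
  have h2 : enorm (g (y + b) - g y) <= D * (s * (3 * D ^+ 2)).
    by apply: le_trans (sol_g_lip H _ _) _; rewrite ler_pM ?enorm_ge0.
  have h3 : s * D ^+ 2 <= s * D ^+ 3 by rewrite ler_wpM2l // pw.
  have h4 : 0 <= s * D ^+ 3 by rewrite mulr_ge0 // exprn_ge0.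
  by move: h1 h2 h3 h4; real_lra.
(* The target [y - s v] lies at [s q] from the foot [w]; [e] is [b] measured on the scale of
   velocities. *)
have [q qE] : exists q : 'rV[R]_d, q = rho - v - e by eexists.
have hq : enorm q <= 7 * D ^+ 2.
  rewrite qE.
  apply: le_trans (enormD _ _) _; apply: le_trans (lerD (enormD _ _) (lexx _)) _.
  rewrite !enormN; have := pw 1%N 2%N isT; rewrite expr1.
  have : s * (3 * D ^+ 2) <= 1 * (3 * D ^+ 2).
    by rewrite ler_wpM2r // mulr_ge0 // exprn_ge0.
  by move: hv he1 hrho; move: (D ^+ 2) => ?; real_lra.
have Vw : - 2 * V w <= - 2 * V y + s * (84 * D ^+ 5).
  have h1 := V_lipschitz y (w - y); rewrite [y + _]addrC subrK in h1.
  have h2 : enorm (w - y) <= s * (6 * D ^+ 2).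
    have -> : w - y = s *: (e - rho).
      by rewrite scalerBr -ywE -bE; apply/rowP => i; rewrite !mxE; ring.
    rewrite enormZ ger0_norm // ler_wpM2l //.
    apply: le_trans (enormD _ _) _; rewrite enormN.
    have := pw 1%N 2%N isT; rewrite expr1.
    have : s * (3 * D ^+ 2) <= 1 * (3 * D ^+ 2).
      by rewrite ler_wpM2r // mulr_ge0 // exprn_ge0.
    by move: he1 hrho; move: (D ^+ 2) => ?; real_lra.
  have h3 : K * enorm (w - y) <= s * (6 * D ^+ 5).
    apply: le_trans (_ : D * (s * (6 * D ^+ 2)) <= _).
      by rewrite ler_pM ?enorm_ge0.
    rewrite mulrCA ler_wpM2l // mulrCA ler_wpM2l // -exprS; exact: pw.
  have h4 : K * dotv (w - y) (w - y) <= s * (36 * D ^+ 5).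
    rewrite -enorm_sqr; apply: le_trans (_ : D * (s * (6 * D ^+ 2)) ^+ 2 <= _).
      rewrite ler_pM ?sqr_ge0 // ler_pXn2r ?nnegrE ?enorm_ge0 //.
      by rewrite mulr_ge0 // mulr_ge0 // exprn_ge0.
    have -> : D * (s * (6 * D ^+ 2)) ^+ 2 = s * (s * (36 * D ^+ 5)) by ring.
    by rewrite ler_wpM2l // ler_piMl // mulr_ge0 // exprn_ge0.
  move: h1; rewrite ler_norml => /andP[h1 _]; move: h1 h3 h4.
  by move: (D ^+ 5) (V _) (V _) => ? ? ?; real_lra.
(* The Hamilton-Jacobi equation at the foot bounds the speed: [|rho|^2] is at most [-2 V y] up to
   [O(s)]. This is how the potential enters the coefficient of [C / 2]. *)
have rr : dotv rho rho <= - 2 * V y + s * (90 * D ^+ 5).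
  have [_ h1] := action_min_upgrad H s0 hw ywE.
  have h2 := dotv_le_bounds hrho hG.
  have h3 : s * `|dotv rho G| <= s * (3 * D ^+ 5).
    rewrite ler_wpM2l //; apply: le_trans h2 _.
    rewrite -mulrA ler_wpM2l // -expr2; exact: pw.
  have h4 : - (s * dotv rho G) <= s * `|dotv rho G|.
    by rewrite -mulrN ler_wpM2l // -normrN ler_norm.
  have h5 : 0 <= s * (s * dotv G G) by rewrite !mulr_ge0 ?dotv_ge0.
  move: h1; rewrite -GA !dotvE (dotvC G rho); move: Vw h3 h4 h5.
  by move: (D ^+ 5) (V _) (V _) `|dotv rho G| => ? ? ? ?; real_lra.
have qq : C / 2 * dotv q q <= C / 2 * (- 2 * V y + dotv v v - 2 * dotv rho v)
    + s * (62 * D ^+ 6).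
  have ee : dotv e e <= s * (9 * D ^+ 5).
    apply: le_trans (ler_norm _) _; apply: le_trans (dotv_le_bounds he1 he1) _.
    have -> : s * (3 * D ^+ 2) * (s * (3 * D ^+ 2)) = s * (s * (9 * D ^+ 4)) by ring.
    rewrite ler_wpM2l //; apply: le_trans (_ : 1 * (9 * D ^+ 4) <= _).
      by rewrite ler_wpM2r // mulr_ge0 // exprn_ge0.
    by rewrite mul1r ler_wpM2l // pw.
  have re : - dotv rho e <= s * (9 * D ^+ 5).
    apply: le_trans (ler_norm _) _; rewrite normrN; apply: le_trans (dotv_le_bounds hrho he1) _.
    have -> : 3 * D * (s * (3 * D ^+ 2)) = s * (9 * D ^+ 3) by ring.
    by rewrite ler_wpM2l // ler_wpM2l // pw.
  have ve : dotv v e <= s * (3 * D ^+ 5).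
    apply: le_trans (ler_norm _) _; apply: le_trans (dotv_le_bounds hv he1) _.
    have -> : D * (s * (3 * D ^+ 2)) = s * (3 * D ^+ 3) by ring.
    by rewrite ler_wpM2l // ler_wpM2l // pw.
  have q1 : dotv q q <= - 2 * V y + dotv v v - 2 * dotv rho v + s * (123 * D ^+ 5).
    rewrite qE !dotvE (dotvC v rho) (dotvC e rho) (dotvC e v).
    by move: ee re ve rr; move: (D ^+ 5) (V _) => ? ?; real_lra.
  have CD5 : C * (s * D ^+ 5) <= s * D ^+ 6.
    by rewrite mulrCA ler_wpM2l // [D ^+ 6]exprS ler_wpM2r // exprn_ge0.
  have sD6 : 0 <= s * D ^+ 6 by rewrite mulr_ge0 // exprn_ge0.
  apply: le_trans (_ : C / 2 * (- 2 * V y + dotv v v - 2 * dotv rho v + s * (123 * D ^+ 5)) <= _).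
    by rewrite ler_wpM2l // divr_ge0 // ltW.
  by move: CD5 sD6; move: (D ^+ 5) (D ^+ 6) (V _) => ? ? ?; real_lra.
have Gq : dotv G q <= 2^-1 * dotv (g y) rho - 2^-1 * dotv (g y) v + s * (37 * D ^+ 6).
  have h1 : dotv G' q <= s * (35 * D ^+ 6).
    apply: le_trans (ler_norm _) _; apply: le_trans (dotv_le_bounds hG' hq) _.
    have -> : s * (5 * D ^+ 3) * (7 * D ^+ 2) = s * (35 * D ^+ 5) by ring.
    by rewrite ler_wpM2l // ler_wpM2l // pw.
  have h2 : - dotv (g y) e <= s * (3 * D ^+ 6).
    apply: le_trans (ler_norm _) _; rewrite normrN; apply: le_trans (dotv_le_bounds hg he1) _.
    have -> : D * (s * (3 * D ^+ 2)) = s * (3 * D ^+ 3) by ring.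
    by rewrite ler_wpM2l // ler_wpM2l // pw.
  have sD6 : 0 <= s * D ^+ 6 by rewrite mulr_ge0 // exprn_ge0.
  rewrite GE dotvDl dotvZl; move: h1; rewrite [in dotv (g y) q]qE; move: (dotv G' q) => ?.
  by rewrite !dotvE; move: h2 sD6; move: (D ^+ 6) => ?; real_lra.
have re : - dotv rho e <= s * k * (9 * D ^+ 5).
  apply: le_trans (ler_norm _) _; rewrite normrN; apply: le_trans (dotv_le_bounds hrho he) _.
  have -> : 3 * D * (k * s * (3 * D ^+ 2)) = s * k * (9 * D ^+ 3) by ring.
  by rewrite ler_wpM2l ?mulr_ge0 // ler_wpM2l // pw.
have pe : dotv p e <= s * k * (6 * D ^+ 5).
  apply: le_trans (ler_norm _) _; apply: le_trans (dotv_le_bounds hp' he) _.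
  have -> : 2 * D * (k * s * (3 * D ^+ 2)) = s * k * (6 * D ^+ 3) by ring.
  by rewrite ler_wpM2l ?mulr_ge0 // ler_wpM2l // pw.
have bb : C / 2 * dotv b b <= s ^+ 2 * (s * (5 * D ^+ 6)).
  have h1 : dotv b b <= s ^+ 2 * (s * (9 * D ^+ 5)).
    rewrite bE dotvZl dotvZr mulrA -expr2 ler_wpM2l ?sqr_ge0 //.
    apply: le_trans (ler_norm _) _; apply: le_trans (dotv_le_bounds he1 he1) _.
    have -> : s * (3 * D ^+ 2) * (s * (3 * D ^+ 2)) = s * (s * (9 * D ^+ 4)) by ring.
    rewrite ler_wpM2l //; apply: le_trans (_ : 1 * (9 * D ^+ 4) <= _).
      by rewrite ler_wpM2r // mulr_ge0 // exprn_ge0.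
    by rewrite mul1r ler_wpM2l // pw.
  apply: le_trans (_ : D / 2 * (s ^+ 2 * (s * (9 * D ^+ 5))) <= _).
    by rewrite ler_pM ?dotv_ge0 ?divr_ge0 ?(ltW C0) // ler_wpM2r.
  have h2 : 0 <= s ^+ 2 * (s * D ^+ 6).
    by rewrite mulr_ge0 ?sqr_ge0 // mulr_ge0 // exprn_ge0.
  by rewrite [D ^+ 6]exprS in h2 *; move: h2; move: (D ^+ 5) => ?; real_lra.
have cub : K ^+ 2 * s ^+ 3 + 3 * K ^+ 3 * s ^+ 4 <= s ^+ 2 * (s * (4 * D ^+ 6)).
  have KD2 : K ^+ 2 <= D ^+ 6.
    by apply: le_trans (pw 2%N 6%N isT); rewrite ler_pXn2r ?nnegrE.
  have KD3 : K ^+ 3 <= D ^+ 6.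
    by apply: le_trans (pw 3%N 6%N isT); rewrite ler_pXn2r ?nnegrE.
  have h1 : s ^+ 3 * K ^+ 2 <= s ^+ 3 * D ^+ 6 by rewrite ler_wpM2l // exprn_ge0.
  have h2 : s ^+ 4 * K ^+ 3 <= s ^+ 3 * D ^+ 6.
    by rewrite ler_pM ?exprn_ge0 // ler_wiXn2l.
  have -> : s ^+ 2 * (s * (4 * D ^+ 6)) = 4 * (s ^+ 3 * D ^+ 6) by ring.
  by move: h1 h2; move: (K ^+ 2) (K ^+ 3) (s ^+ 3) (s ^+ 4) (D ^+ 6) => ? ? ? ? ?; real_lra.
(* Since [b = (k s) (s l)], this is the slope bound divided by [k s]; the quadratic term in [b]
   leaves an error of order [k], the remaining ones are of order [s / k]. *)
have slopel : s * dotv rho l <= s * dotv p l + s ^+ 2 / 2 * dotv (g y) l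
    + s ^+ 2 * (k * (5 * D ^+ 5)) + s ^+ 2 * (s * (45 * D ^+ 6 / k)).
  have ks : 0 < k * s by rewrite mulr_gt0.
  have ll : dotv l l <= 9 * D ^+ 4.
    apply: le_trans (ler_norm _) _; apply: le_trans (dotv_le_bounds hl hl) _.
    by have -> : 3 * D ^+ 2 * (3 * D ^+ 2) = 9 * D ^+ 4 by ring.
  have h1 : dotv b b * ((2 * s)^-1 + 3 * K) <=
      k * s * (s ^+ 2 * (k * (5 * D ^+ 5)) + s ^+ 2 * (s * (27 * D ^+ 6 / k))).
    have t1 : dotv b b * (2 * s)^-1 = k * s * (s ^+ 2 * (k * dotv l l / 2)).
      by rewrite bl dotvZl dotvZr; field; rewrite gt_eqF.
    have t2 : dotv b b * (3 * K) = k * s * (s ^+ 2 * (s * (k * (3 * K * dotv l l)))).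
      by rewrite bl dotvZl dotvZr; ring.
    rewrite mulrDr t1 t2 -mulrDr ler_wpM2l ?(ltW ks) // lerD //.
      rewrite ler_wpM2l ?sqr_ge0 // -mulrA ler_wpM2l //.
      have := pw 4%N 5%N isT; have : 0 <= D ^+ 5 by rewrite exprn_ge0.
      by move: ll; move: (D ^+ 4) (D ^+ 5) => ? ?; real_lra.
    rewrite ler_wpM2l ?sqr_ge0 // ler_wpM2l // ler_pdivlMr //.
    apply: le_trans (_ : 1 * (3 * K * dotv l l) <= _).
      rewrite mulrAC -[leLHS]mulrA mulrA.
      rewrite ler_wpM2r ?mulr_ge0 ?dotv_ge0 //.
      by rewrite -[1]mulr1 ler_pM.
    rewrite mul1r; apply: le_trans (_ : 3 * D * (9 * D ^+ 4) <= _).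
      by rewrite ler_pM ?dotv_ge0 ?mulr_ge0 // ler_wpM2l.
    have -> : 3 * D * (9 * D ^+ 4) = 27 * D ^+ 5 by ring.
    by rewrite ler_wpM2l // pw.
  have h2 : 4 * K ^+ 2 * s ^+ 2 * enorm b <= k * s * (s ^+ 2 * (s * (12 * D ^+ 6 / k))).
    have -> : k * s * (s ^+ 2 * (s * (12 * D ^+ 6 / k))) = 4 * D ^+ 2 * s ^+ 2 *
      (s ^+ 2 * (3 * D ^+ 4)) by field; rewrite gt_eqF.
    rewrite ler_pM ?enorm_ge0 // ?mulr_ge0 ?sqr_ge0 //.
      by rewrite ler_wpM2r ?sqr_ge0 // ler_wpM2l // ler_pXn2r ?nnegrE.
    rewrite bl enormZ ger0_norm ?mulr_ge0 ?sqr_ge0 //.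
    rewrite -mulrA mulrCA ler_wpM2l ?sqr_ge0 //.
    apply: le_trans (_ : 1 * (3 * D ^+ 2) <= _); first by rewrite ler_pM ?enorm_ge0.
    by rewrite mul1r ler_wpM2l // pw.
  have h3 : 6 * K ^+ 3 * s ^+ 4 <= k * s * (s ^+ 2 * (s * (6 * D ^+ 6 / k))).
    have -> : k * s * (s ^+ 2 * (s * (6 * D ^+ 6 / k))) = 6 * D ^+ 6 * s ^+ 4.
      by field; rewrite gt_eqF.
    rewrite ler_wpM2r ?exprn_ge0 // ler_wpM2l //.
    by apply: le_trans (pw 3%N 6%N isT); rewrite ler_pXn2r ?nnegrE.
  rewrite -(ler_pM2l ks).
  have b1 : dotv rho b = k * s * (s * dotv rho l) by rewrite bl dotvZr; ring.
  have b2 : dotv p b = k * s * (s * dotv p l) by rewrite bl dotvZr; ring.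
  have b3 : s / 2 * dotv (g y) b = k * s * (s ^+ 2 / 2 * dotv (g y) l).
    by rewrite bl dotvZr; ring.
  rewrite b1 b2 b3 in slope; move: slope h1 h2 h3.
  move: (dotv b b * ((2 * s)^-1 + 3 * K)) => ?; move: (4 * K ^+ 2 * s ^+ 2 * enorm b) => ?.
  move: (6 * K ^+ 3 * s ^+ 4) => ?.
  rewrite ![_ / k]mulrAC; move: (s ^+ 2) (D ^+ 5) (D ^+ 6) (k^-1) => ? ? ? ?; real_lra.
have E2 : s *: rho - (s *: v + b) = s *: q.
  by rewrite qE bE !scalerBr opprD addrA.
have pb : dotv p b = s * dotv p e by rewrite bE dotvZr.
have rb : dotv rho b = s * dotv rho e by rewrite bE dotvZr.
rewrite E2 -GA !dotvE rb in upper.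
rewrite pb in hub.
rewrite /l !dotvE in slopel.
have gg : dotv (g y) (g y) <= D ^+ 6.
  apply: le_trans (ler_norm _) _; apply: le_trans (dotv_le_bounds hg hg) _.
  by rewrite -expr2 pw.
have gv : - (C * dotv (g y) v) <= D ^+ 6.
  apply: le_trans (ler_norm _) _; rewrite normrN normrM (gtr0_norm C0).
  apply: le_trans (_ : D * (D * D) <= _); last by rewrite -expr2 -exprS pw.
  by rewrite ler_pM ?(ltW C0) // dotv_le_bounds.
have s20 : 0 <= s ^+ 2 by exact: sqr_ge0.
have s30 : 0 <= s ^+ 2 * s by rewrite mulr_ge0.
have gg' := ler_wpM2l s30 gg.
have gv' := ler_wpM2l s30 gv.
have Gq' := ler_wpM2l s20 Gq.
have qq' := ler_wpM2l s20 qq.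
have re' := ler_wpM2l s0' re.
have pe' := ler_wpM2l s0' pe.
have D60 : 0 <= D ^+ 6 by exact: exprn_ge0.
have D50 : 0 <= D ^+ 5 by exact: exprn_ge0.
have Y0 : 0 <= s ^+ 2 * s * D ^+ 6 by rewrite mulr_ge0.
have X0 : 0 <= s ^+ 2 * k * D ^+ 5 by rewrite !mulr_ge0.
(* As [k <= 1], errors without the factor [1 / k] are absorbed by those that carry it. *)
have YZ : s ^+ 2 * s * D ^+ 6 <= s ^+ 2 * s * D ^+ 6 / k.
  by rewrite ler_pdivlMr // ler_piMr.
rewrite (dotvC rho (g y)) (dotvC p (g y)) in slopel.
move: upper hub slopel gg' gv' Gq' qq' re' pe' Y0 X0 YZ bb cub.
have -> : s ^+ 2 * (s * (45 * D ^+ 6 / k)) = 45 * (s ^+ 2 * s * D ^+ 6 / k) by ring.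
have -> : s ^+ 2 * (2^-1 * dotv (g y) p - dotv (g y) v +
    C / 2 * (- 2 * V y - 2 * dotv p v + dotv v v) + k * (25 * D ^+ 5)
    + s * (200 * D ^+ 6 / k)) =
    s ^+ 2 * (2^-1 * dotv (g y) p - dotv (g y) v +
    C / 2 * (- 2 * V y - 2 * dotv p v + dotv v v)) + 25 * (s ^+ 2 * k * D ^+ 5)
    + 200 * (s ^+ 2 * s * D ^+ 6 / k) by ring.
move: (s ^+ 2 * s * D ^+ 6 / k) => Z.
move: (u _) (u _) (u _) (V _) (D ^+ 5) (D ^+ 6) => ? ? ? ? ? ?.
real_lra.
Qed.

End BackwardExpansion.

Section MaxPrinciple.
Variable R : realType.

(** Subtracting a parabola of curvature slightly above [B] makes the backward bound strict. By the
    mean value theorem this excludes a maximum of the modified derivative at a positive point, so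
    the maximum is at 0. *)
Lemma derivative_growth_from_backward_bound (m k : R -> R) (b B s0 : R) :
  0 <= b -> 0 < s0 -> (forall s : R, is_derive s 1 m (k s)) -> continuous k ->
  (forall s h : R, 0 < s -> s <= b -> 0 < h -> h <= s0 ->
     m (s - h) <= m s - h * k s + h ^+ 2 / 2 * B) ->
  k b - k 0 <= b * B.
Proof.
move=> b0 s00 dm ck hB; apply/ler_addgt0Pr => e e0.
pose th := B + e / (b + 1).
have b1 : 0 < b + 1 by lra.
have eb : 0 < e / (b + 1) by rewrite divr_gt0.
pose kt s := k s - th * s.
pose mt s := m s - th / 2 * s ^+ 2.
have dmt (s : R) : is_derive s 1 mt (kt s).
  have h1 := dm s.
  have h2 : is_derive s 1 (fun s : R => th / 2 * s ^+ 2) (th * s).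
    apply: (@is_derive_quadratic _ _ _ _ (`|th| / 2)) => t _.
    have -> : th / 2 * (s + t) ^+ 2 - th / 2 * s ^+ 2 - t * (th * s) = th / 2 * t ^+ 2 by field.
    by rewrite normrM normrM (ger0_norm (sqr_ge0 t)) (ger0_norm (_ : 0 <= 2^-1)).
  exact: (is_deriveB h1 h2).
have ckt : continuous kt.
  move=> s; apply: (@continuousB _ _ _ k (fun s => th * s)); first exact: ck.
  by apply: (@continuousM _ _ (cst th) id); [exact: cst_continuous | exact: cvg_id].
have cmt : continuous mt.
  move=> s; apply: differentiable_continuous; apply/derivable1_diffP.
  by case: (dmt s).
have [z] := EVT_max b0 (continuous_subspaceT ckt).
rewrite in_itv /= => /andP[z0 zb] hz.
have [zp|] := ltP 0 z; last first.
  move=> z0'; have zz : z = 0 by apply/eqP; rewrite eq_le z0 z0'.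
  have := hz b; rewrite in_itv /= b0 lexx => /(_ isT); rewrite zz /kt mulr0 subr0.
  have bb : e / (b + 1) * b <= e by rewrite mulrAC ler_pdivrMr // ler_wpM2l // ?(ltW e0) // lerDl.
  rewrite /th mulrDl; move: bb; move: (e / (b + 1)) => ? ? ?; lra.
pose h := Num.min s0 z.
have h0 : 0 < h by rewrite lt_min s00.
have hs : h <= s0 by rewrite ge_min lexx.
have hz' : h <= z by rewrite ge_min lexx orbT.
have zh : z - h <= z by lra.
have [r] := MVT_segment zh (fun x _ => dmt x) (continuous_subspaceT cmt).
rewrite in_itv /= => /andP[r1 r2]; rewrite subKr => E.
have hr : kt r <= kt z by apply: hz; rewrite in_itv /=; lra.
have := hB z h zp zb h0 hs.
have hk : kt r * h <= kt z * h by rewrite ler_wpM2r // ltW.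
have hh : 0 < h ^+ 2 by rewrite exprn_gt0.
have : 0 < h ^+ 2 * (e / (b + 1)) by rewrite mulr_gt0.
move: E hk; rewrite /kt /mt /th; move: (m z) (m _) (k z) (k r) (e / (b + 1)) => ? ? ? ? ?.
move=> E; rewrite -E; lra.
Qed.

End MaxPrinciple.

(** * Regularization by sup-convolution *)

Section Moreau.
Variables (R : realType) (d : nat).
Implicit Types (x y z w p r v b c : 'rV[R]_d) (s : R).
Variables (V u : 'rV[R]_d -> R) (g : 'rV[R]_d -> 'rV[R]_d) (C K : R).
Hypothesis H : semiconcave_solution V u g C K.

Let K_ge0 : 0 <= K.
Proof. by have := sol_K_ge1 H; lra. Qed.

Lemma backward_bound A eta : 0 < eta -> exists2 s0 : R, 0 < s0 &
  forall s y p v, 0 < s -> s <= s0 -> upgrad u C y p -> enorm v <= A ->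
  u (y - s *: v) <= u y - s * dotv p v + s ^+ 2 *
    (2^-1 * dotv (g y) p - dotv (g y) v
     + C / 2 * (- 2 * V y - 2 * dotv p v + dotv v v) + eta).
Proof.
move=> eta0; have K1 := sol_K_ge1 H.
pose D := 1 + K + `|A|.
have D1 : 1 <= D by rewrite /D -addrA lerDl addr_ge0.
have KD : K <= D by rewrite /D addrAC lerDr addr_ge0.
have AD : A <= D by rewrite /D (le_trans (ler_norm A)) // lerDr addr_ge0.
have D0 : 0 < D by exact: lt_le_trans D1.
(* [k] is fixed before [s0], because the error proportional to [s] carries the factor [1 / k]. *)
pose k := Num.min 1 (eta / (50 * D ^+ 5)).
have k0 : 0 < k by rewrite lt_min ltr01 divr_gt0 ?mulr_gt0 ?exprn_gt0 ?ltr0n.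
have k1 : k <= 1 by rewrite ge_min lexx.
have kD : k * (25 * D ^+ 5) <= eta / 2.
  have : k <= eta / (50 * D ^+ 5) by rewrite ge_min lexx orbT.
  rewrite ler_pdivlMr ?mulr_gt0 ?exprn_gt0 //; move: (D ^+ 5) => ? ?; lra.
pose s0 := Num.min 1 (eta / (400 * D ^+ 6 / k)).
have X0 : 0 < 400 * D ^+ 6 / k by rewrite divr_gt0 ?mulr_gt0 ?exprn_gt0 ?ltr0n.
exists s0; first by rewrite lt_min ltr01 divr_gt0.
move=> s y p v sp ss0 hp hv.
have s1 : s <= 1 by apply: le_trans ss0 _; rewrite ge_min lexx.
have sD : s * (200 * D ^+ 6 / k) <= eta / 2.
  have : s <= eta / (400 * D ^+ 6 / k) by apply: le_trans ss0 _; rewrite ge_min lexx orbT.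
  rewrite ler_pdivlMr //; move: (D ^+ 6) => ? ?; lra.
apply: le_trans (backward_bound_expand H sp s1 k0 k1 D1 KD hp (le_trans hv AD)) _.
rewrite lerD2l ler_wpM2l ?sqr_ge0 // -addrA lerD2l.
by move: kD sD; move: (k * _) (s * _) => ? ? ? ?; lra.
Qed.

(* [P x] realizes the sup-convolution [u_e] of [u] at [x], and [q] is the gradient
   of [u_e]. *)
Record proximal_map (e : R) (P q : 'rV[R]_d -> 'rV[R]_d) : Prop := ProximalMap {
  prox_gt0 : 0 < e;
  prox_small : 8 * e * K <= 1;
  prox_max : forall x z, u z - (2 * e)^-1 * dotv (z - x) (z - x) <=
    u (P x) - (2 * e)^-1 * dotv (P x - x) (P x - x);
  prox_shift : forall x, P x = x + e *: q x }.

Variables (e : R) (P mgrad : 'rV[R]_d -> 'rV[R]_d).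
Hypothesis M : proximal_map e P mgrad.
Let e0 := prox_gt0 M.
Let eK := prox_small M.
Let hP := prox_max M.
Let PE := prox_shift M.

Definition moreau x := u (P x) - (2 * e)^-1 * dotv (P x - x) (P x - x).
Definition defect x := - (2^-1 * dotv (mgrad x) (mgrad x)) - V x.
(** [mgrad x] is a supergradient at [P x], so evaluating [V] there gives the defect of an actual
    element of [D^+u], which has a sign. [defect] evaluates [V] at [x], the point that is moved. *)
Definition prox_defect x := - (2^-1 * dotv (mgrad x) (mgrad x)) - V (P x).

Let mgradE x : mgrad x = e^-1 *: (P x - x).
Proof. by rewrite PE addrAC subrr add0r scalerA mulVf ?gt_eqF // scale1r. Qed.

Lemma mgrad_upgrad x : upgrad u C (P x) (mgrad x).
Proof. by rewrite mgradE; exact: (prox_upgrad H e0 (hP x)). Qed.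

Lemma mgrad_le x : enorm (mgrad x) <= 2 * K.
Proof. exact: (upgrad_le H (mgrad_upgrad x)). Qed.

(** The one-sided Lipschitz bound gives [(1 - e C) |D|^2 <= a.D] for the increments [D] of [P] and
    [a] of the argument, and [e C <= 1/2]. *)
Lemma prox_lip x y : enorm (P x - P y) <= 2 * enorm (x - y).
Proof.
have := upgrad_monotone (mgrad_upgrad x) (mgrad_upgrad y).
have -> : mgrad x - mgrad y = e^-1 *: ((P x - P y) - (x - y)).
  by rewrite !mgradE -scalerBr; congr (_ *: _); apply/rowP => i; rewrite !mxE; ring.
move: (P x - P y) (x - y) => D a; rewrite dotvZl ler_pdivrMl // !dotvE => h.
have eC : e * C <= 1 / 2.
  have := ler_wpM2l (ltW e0) (sol_C_le H); have := eK => ? ?; lra.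
have h1 : e * C * dotv D D <= 1 / 2 * dotv D D by rewrite ler_wpM2r // dotv_ge0.
have := dotv_le a D; rewrite mulrA in h; move: h h1; rewrite -!enorm_sqr expr2.
move: (enorm_ge0 D) (enorm_ge0 a); move: (enorm D) (enorm a) (dotv a D) => X Y Z X0 Y0 h h1 h2.
have [->|Xp] := eqVneq X 0; first by rewrite mulr_ge0.
rewrite -(ler_pM2r (_ : 0 < X)); last by rewrite lt_neqAle eq_sym Xp.
lra.
Qed.

Lemma mgrad_lip x y : enorm (mgrad x - mgrad y) <= 3 / e * enorm (x - y).
Proof.
rewrite !mgradE -scalerBr enormZ gtr0_norm ?invr_gt0 // mulrAC ler_pdivlMr // mulrAC mulVf ?gt_eqF // mul1r.
have -> : P x - x - (P y - y) = (P x - P y) - (x - y).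
  by apply/rowP => i; rewrite !mxE; ring.
apply: le_trans (enormD _ _) _; rewrite enormN; have := prox_lip x y; lra.
Qed.

(** Keeping the maximizer of [z] as a competitor at [z + b] gives the lower bound. Exchanging the
    two points and using that the gradient is Lipschitz gives the upper one. *)
Lemma moreau_expand x a :
  `|moreau (x + a) - moreau x - dotv (mgrad x) a| <= 4 / e * dotv a a.
Proof.
have low z b : moreau z + dotv (mgrad z) b - (2 * e)^-1 * dotv b b <= moreau (z + b).
  have := hP (z + b) (P z); rewrite -/(moreau (z + b)); apply: le_trans.
  have -> : P z - (z + b) = e *: mgrad z - b.
    by rewrite PE; apply/rowP => i; rewrite !mxE; ring.
  have Pz : P z - z = e *: mgrad z by rewrite {1}PE addrAC subrr add0r.
  rewrite /moreau Pz !dotvE (dotvC b (mgrad z)).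
  rewrite le_eqVlt; apply/orP; left; apply/eqP; field; rewrite gt_eqF //.
have h1 := low x a; have := low (x + a) (- a); rewrite addrK !dotvE => h2.
have h3 : dotv (mgrad (x + a) - mgrad x) a <= 3 / e * dotv a a.
  apply: le_trans (dotv_le _ _) _; rewrite -enorm_sqr expr2 mulrA ler_wpM2r ?enorm_ge0 //.
  by apply: le_trans (mgrad_lip _ _) _; rewrite addrAC subrr add0r.
have h4 : 0 <= e^-1 * dotv a a by rewrite mulr_ge0 ?dotv_ge0 // invr_ge0 ltW.
move: h1 h2 h3 h4; rewrite invfM !dotvE ler_norml.
move: (moreau _) (moreau _) (e^-1) => ? ? ? h1 h2 h3 h4; apply/andP; split; lra.
Qed.

End Moreau.

Section MoreauFlow.
Variables (R : realType) (d : nat).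
Implicit Types (x y z w p r v b c : 'rV[R]_d) (s : R).
Variables (V u : 'rV[R]_d -> R) (g : 'rV[R]_d -> 'rV[R]_d) (C K : R).
Hypothesis H : semiconcave_solution V u g C K.
Variables (e : R) (P q : 'rV[R]_d -> 'rV[R]_d).
Hypothesis M : proximal_map u K e P q.

Let K_ge0 : 0 <= K.
Proof. by have := sol_K_ge1 H; lra. Qed.

Let phi x := prox_defect V P q x.
Let psi x := defect V q x.
Let ue x := moreau u e P x.

Lemma prox_defect_ge0 x : 0 <= phi x.
Proof.
have := sol_sub H (mgrad_upgrad H M x); rewrite /phi /prox_defect; lra.
Qed.

Lemma prox_small1 : 8 * e <= 1.
Proof.
apply: le_trans (prox_small M); rewrite ler_peMr ?(sol_K_ge1 H) //.
by rewrite mulr_ge0 // ltW // (prox_gt0 M).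
Qed.

Lemma dist_prox_le x : enorm (P x - x) <= 2 * K * e.
Proof.
rewrite (prox_shift M) addrAC subrr add0r enormZ gtr0_norm ?(prox_gt0 M) // mulrC.
by rewrite ler_wpM2r ?(ltW (prox_gt0 M)) // (mgrad_le H M).
Qed.

Lemma defect_near x : `|psi x - phi x| <= 3 * K ^+ 2 * e.
Proof.
have h := V_lipschitz H x (P x - x); rewrite [x + _]addrC subrK in h.
have -> : psi x - phi x = V (P x) - V x by rewrite /psi /phi /defect /prox_defect; ring.
apply: le_trans h _; rewrite -enorm_sqr expr2.
have := dist_prox_le x; have := enorm_ge0 (P x - x); move: (enorm _) => n n0 h.
have e0 := ltW (prox_gt0 M).
have h1 : n <= 1 / 4.
  by have := prox_small M; lra.
have h2 : K * (n * n) <= K * (1 / 4 * n) by rewrite ler_wpM2l // ler_wpM2r.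
have h3 : K * n <= K * (2 * K * e) by rewrite ler_wpM2l.
have h4 : 0 <= K ^+ 2 * e by rewrite mulr_ge0 ?sqr_ge0.
rewrite expr2 in h4 *; lra.
Qed.

(** From [P x] the point [P (x - h v)] is reached with a velocity that is not under control. Its
    deviation [f] from [v] costs [h^2 |f|^2 / (2 e)] in the sup-convolution, which for small [e]
    pays for every error term quadratic or linear in [f]. *)
Lemma moreau_backward A eta : 0 < eta -> exists2 h0 : R, 0 < h0 &
  forall x (h : R) v, 0 < h -> h <= h0 -> enorm v <= A ->
  ue (x - h *: v) <= ue x - h * dotv (q x) v + h ^+ 2 / 2 *
    (2 * C * phi x - dotv (g (P x)) (q x) + 2 * K ^+ 2 * e
     + 2 * K * enorm (q x - v) + 2 * K * enorm (q x - v) ^+ 2 + eta).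
Proof.
move=> eta0.
have eta2 : 0 < eta / 2 by rewrite divr_gt0.
have [s0 s00 hs] := backward_bound H (2 * A) eta2.
exists s0 => // x h v0 h0 hs0 hv.
pose w := x - h *: v0.
pose v := h^-1 *: (P x - P w).
have vE : P x - h *: v = P w by rewrite /v scalerA divff ?gt_eqF // scale1r subKr.
have hv2 : enorm v <= 2 * A.
  rewrite /v enormZ gtr0_norm ?invr_gt0 // ler_pdivrMl //.
  apply: le_trans (prox_lip H M _ _) _.
  rewrite /w subKr enormZ gtr0_norm // mulrCA ler_wpM2l ?(ltW h0) // ler_wpM2l //.
have hp := mgrad_upgrad H M x.
have key := hs h (P x) (q x) v h0 hs0 hp hv2.
rewrite vE in key.
have [f fE] : exists f, f = v - v0 by eexists.
have {}fE : v = v0 + f by rewrite fE addrC subrK.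
have uw : ue w = u (P w) - e / 2 * dotv (q x) (q x) + h * dotv (q x) f
    - h ^+ 2 / (2 * e) * dotv f f.
  rewrite /ue /moreau; have -> : P w - w = e *: q x - h *: f.
    have -> : e *: q x = P x - x by rewrite (prox_shift M) addrAC subrr add0r.
    rewrite -vE fE /w; apply/rowP => i; rewrite !mxE; ring.
  by rewrite !dotvE (dotvC f (q x)); field; rewrite gt_eqF // (prox_gt0 M).
have ux : ue x = u (P x) - e / 2 * dotv (q x) (q x).
  rewrite /ue /moreau (_ : P x - x = e *: q x); last first.
    by rewrite (prox_shift M) addrAC subrr add0r.
  by rewrite !dotvE; field; rewrite gt_eqF // (prox_gt0 M).
rewrite -/w uw ux.
move: key; rewrite {vE hv2 uw ux}fE.
have [r rE] : exists r, r = q x - v0 by eexists.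
have {}rE : v0 = q x - r by rewrite rE subKr.
rewrite rE subKr => key.
have e0 := prox_gt0 M.
(* This completes the square: the coefficient of [C / 2] becomes twice the defect plus the squared
   distance from the momentum to the velocity. *)
have phiE : - 2 * V (P x) = 2 * phi x + dotv (q x) (q x).
  by rewrite /phi /prox_defect; field.
rewrite phiE !dotvE in key.
rewrite !dotvE.
have CK := sol_C_le H.
(* Of the available [|f|^2 / (2 e)], a part [1 / (4 e)] is spent in this Young inequality and
   [1 / (8 e)] on the curvature term in [Cf]. *)
have gf : - dotv (g (P x)) f <= dotv f f / (4 * e) + K ^+ 2 * e.
  have h1 : - dotv (g (P x)) f <= K * enorm f.
    rewrite -dotvNl; apply: le_trans (dotv_le _ _) _; rewrite enormN.
    by rewrite ler_wpM2r ?enorm_ge0 // (sol_g_le H).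
  apply: le_trans h1 _; rewrite -enorm_sqr; move: (enorm f) => n.
  have : 0 <= (n - 2 * e * K) ^+ 2 / (4 * e) by rewrite divr_ge0 ?sqr_ge0 // mulr_ge0 // ltW.
  have -> : (n - 2 * e * K) ^+ 2 / (4 * e) = n ^+ 2 / (4 * e) + K ^+ 2 * e - K * n.
    by field; rewrite gt_eqF.
  by rewrite subr_ge0.
have gr : dotv (g (P x)) r <= K * enorm r.
  by apply: le_trans (dotv_le _ _) _; rewrite ler_wpM2r ?enorm_ge0 // (sol_g_le H).
have rf : dotv (r - f) (r - f) <= 2 * dotv r r + 2 * dotv f f.
  by have := dotv_ge0 (r + f); rewrite !dotvE; lra.
have Cf : C / 2 * dotv (r - f) (r - f) <= K * dotv r r + dotv f f / (8 * e).
  have h1 : C / 2 * dotv (r - f) (r - f) <= K / 2 * (2 * dotv r r + 2 * dotv f f).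
    rewrite ler_pM ?dotv_ge0 //; first by rewrite divr_ge0 // ltW // (sol_C_gt0 H).
    by rewrite ler_wpM2r.
  have h2 : K * dotv f f <= dotv f f / (8 * e).
    rewrite ler_pdivlMr ?mulr_gt0 // mulrAC -[leRHS]mul1r ler_wpM2r ?dotv_ge0 //.
    by have := prox_small M; rewrite mulrC.
  lra.
have ff : 0 <= dotv f f / (8 * e) by rewrite divr_ge0 ?dotv_ge0 // mulr_ge0 // ltW.
have hh : 0 <= h ^+ 2 by exact: sqr_ge0.
have gf' := ler_wpM2l hh gf.
have gr' := ler_wpM2l hh gr.
have Cf' := ler_wpM2l hh Cf.
have ff' := mulr_ge0 hh ff.
rewrite enorm_sqr.
move: key gf' gr' Cf' ff'; rewrite !dotvE !invfM.
rewrite (dotvC r (q x)) (dotvC f (q x)) (dotvC f r).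
move: (u _) (u _) (phi x) (e^-1) (enorm r) (dotv (g (P x)) r) (dotv (g (P x)) f)
  (dotv (g (P x)) (q x)) => ? ? ? ? ? ? ? ?.
lra_but K_ge0.
Qed.

End MoreauFlow.

Lemma ler_sqr_mono (R : realType) (x y : R) : 0 <= x -> x <= y -> x ^+ 2 <= y ^+ 2.
Proof. by move=> x0 xy; rewrite ler_pXn2r ?nnegrE // (le_trans x0). Qed.

(** * Growth of the defect along the regularized gradient *)

Section DefectGrowth.
Variables (R : realType) (d : nat).
Implicit Types (x y z w p r v b c : 'rV[R]_d) (s : R).
Variables (V u : 'rV[R]_d -> R) (g : 'rV[R]_d -> 'rV[R]_d) (C K : R).
Hypothesis H : semiconcave_solution V u g C K.
Variables (e : R) (P q : 'rV[R]_d -> 'rV[R]_d).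
Hypothesis M : proximal_map u K e P q.

Let K_ge0 : 0 <= K.
Proof. by have := sol_K_ge1 H; lra. Qed.

Let phi x := prox_defect V P q x.
Let psi x := defect V q x.

(** [N] grows as [e] tends to 0, but it only multiplies the step length, which is chosen after
    [e]. *)
Lemma defect_variation : exists2 N : R, 0 < N & forall x s, 0 <= s -> s <= 1 ->
  let y := x + s *: q x in
  [/\ enorm (q y - q x) <= N * s,
      enorm (q y - q x) ^+ 2 <= N * s,
      phi y <= phi x + N * s &
      - dotv (g (P y)) (q y) <= - dotv (g (P x)) (q x) + N * s].
Proof.
have e0 := prox_gt0 M.
have K1 := sol_K_ge1 H.
pose a := 6 * K / e.
have a0 : 0 <= a by rewrite divr_ge0 ?mulr_ge0 // ltW.
pose N := 1 + a + a ^+ 2 + 2 * K * a + 16 * K ^+ 3 + 4 * K ^+ 2 + 8 * K ^+ 3 + K * a.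
have K2 : 0 <= K ^+ 2 by exact: sqr_ge0.
have K3 : 0 <= K ^+ 3 by exact: exprn_ge0.
have Ka : 0 <= K * a by exact: mulr_ge0.
have a2 : 0 <= a ^+ 2 by exact: sqr_ge0.
exists N; first by rewrite /N; lra.
move=> x s s0 s1 y.
have yx : y - x = s *: q x by rewrite /y addrAC subrr add0r.
have hq := mgrad_le H M x; have hqy := mgrad_le H M y.
have h1 : enorm (q y - q x) <= a * s.
  apply: le_trans (mgrad_lip H M _ _) _; rewrite yx enormZ ger0_norm //.
  have -> : a * s = 3 / e * (s * (2 * K)) by rewrite /a; field; rewrite gt_eqF.
  by rewrite ler_wpM2l ?divr_ge0 // ?(ltW e0) // ler_wpM2l.
have h2 : enorm (P y - P x) <= 4 * K * s.
  apply: le_trans (prox_lip H M _ _) _; rewrite yx enormZ ger0_norm //.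
  have -> : 4 * K * s = 2 * (s * (2 * K)) by ring.
  by rewrite ler_wpM2l // ler_wpM2l.
have s2 : s ^+ 2 <= s by rewrite expr2 ler_piMr.
have ss k n : 0 <= k -> k <= n -> k * s <= n * s by move=> *; rewrite ler_wpM2r.
split.
- by apply: le_trans h1 _; apply: ss => //; rewrite /N; lra.
- apply: le_trans (_ : (a * s) ^+ 2 <= _).
    exact: ler_sqr_mono (enorm_ge0 _) h1.
  rewrite exprMn; apply: le_trans (_ : a ^+ 2 * s <= _); first by rewrite ler_wpM2l.
  by apply: ss => //; rewrite /N; lra.
- have v1 := V_lipschitz H (P y) (P x - P y); rewrite [P y + _]addrC subrK in v1.
  rewrite enormB -enorm_sqr enormB in v1.
  have v2 : K * enorm (P y - P x) <= 4 * K ^+ 2 * s.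
    have -> : 4 * K ^+ 2 * s = K * (4 * K * s) by ring.
    by rewrite ler_wpM2l.
  have v3 : K * enorm (P y - P x) ^+ 2 <= 16 * K ^+ 3 * s.
    apply: le_trans (_ : K * (4 * K * s) ^+ 2 <= _).
      by rewrite ler_wpM2l // ler_sqr_mono ?enorm_ge0.
    have -> : K * (4 * K * s) ^+ 2 = 16 * K ^+ 3 * s ^+ 2 by ring.
    by rewrite ler_wpM2l ?mulr_ge0.
  have q1 : dotv (q x) (q x) - dotv (q y) (q y) <= 4 * K * a * s.
    have -> : dotv (q x) (q x) - dotv (q y) (q y) = dotv (q x - q y) (q x + q y).
      by rewrite !dotvE (dotvC (q y) (q x)); ring.
    apply: le_trans (dotv_le _ _) _; rewrite enormB.
    have -> : 4 * K * a * s = (a * s) * (2 * K + 2 * K) by ring.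
    rewrite ler_pM ?enorm_ge0 //; apply: le_trans (enormD _ _) _; exact: lerD.
  have N1 : (2 * K * a + 16 * K ^+ 3 + 4 * K ^+ 2) * s <= N * s.
    by apply: ss; rewrite /N; lra.
  move: v1; rewrite ler_norml => /andP[_ v1].
  rewrite /phi /prox_defect; move: v1 v2 v3 q1 N1.
  move: N (V _) (V _) (K ^+ 3) (K ^+ 2) => ? ? ? ? ?; lra_but K_ge0.
- have -> : - dotv (g (P y)) (q y) = - dotv (g (P x)) (q x)
     + (dotv (g (P x) - g (P y)) (q y) - dotv (g (P x)) (q y - q x)).
    by rewrite !dotvE; ring.
  rewrite lerD2l.
  have g1 : dotv (g (P x) - g (P y)) (q y) <= 8 * K ^+ 3 * s.
    apply: le_trans (dotv_le _ _) _.
    have -> : 8 * K ^+ 3 * s = K * (4 * K * s) * (2 * K) by ring.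
    rewrite ler_pM ?enorm_ge0 // enormB.
    have := sol_g_lip H (P x) (P y - P x); rewrite [P x + _]addrC subrK.
    by move/le_trans; apply; rewrite ler_wpM2l.
  have g2 : - dotv (g (P x)) (q y - q x) <= K * a * s.
    rewrite -dotvNl; apply: le_trans (dotv_le _ _) _; rewrite enormN -mulrA.
    by rewrite ler_pM ?enorm_ge0 // (sol_g_le H).
  have N1 : (8 * K ^+ 3 + K * a) * s <= N * s.
    by apply: ss; rewrite /N; lra.
  move: g1 g2 N1; move: N (K ^+ 3) => ? ?; lra_but K_ge0.
Qed.

(** The backward bound with velocity [q x] holds along the whole segment, so the maximum principle
    bounds the increase of [dotv (q _) (q x)], the derivative of the sup-convolution. This controls
    [|q|^2] at the new point up to [O(h^2)]. *)
Lemma defect_growth x eta : 0 < eta -> exists2 h0 : R, 0 < h0 &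
  forall h : R, 0 < h -> h <= h0 ->
  psi x - h * (2 * C * phi x + 6 * K ^+ 3 * e + eta) <= psi (x + h *: q x).
Proof.
move=> eta0; have e0 := prox_gt0 M; have K1 := sol_K_ge1 H.
have C0 := ltW (sol_C_gt0 H).
have eta4 : 0 < eta / 4 by rewrite divr_gt0.
have [s0 s00 back] := moreau_backward H M (2 * K) eta4.
have [N N0 var] := defect_variation.
pose N2 : R := N * (2 * C + 1 + 4 * K).
have N20 : 0 < N2.
  by rewrite mulr_gt0 //; move: C0 (K_ge0); lra_but K_ge0.
pose N3 : R := N ^+ 2 / 2 + 4 * K ^+ 3.
have N30 : 0 < N3 by rewrite ltr_wpDr ?mulr_ge0 ?exprn_ge0 // divr_gt0 ?exprn_gt0.
pose h0 := Num.min 1 (Num.min (eta / (4 * N2)) (eta / (2 * N3))).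
exists h0; first by rewrite !lt_min ltr01 !divr_gt0 // mulr_gt0.
move=> h hp hh0.
have [h1 hN2 hN3] : [/\ h <= 1, h * N2 <= eta / 4 & h * N3 <= eta / 2].
  move: hh0; rewrite !le_min => /and3P[-> + +].
  have n2 : 0 < 4 * N2 by exact: mulr_gt0.
  have n3 : 0 < 2 * N3 by exact: mulr_gt0.
  rewrite (ler_pdivlMr _ _ n2) (ler_pdivlMr _ _ n3).
  by move: (N2) (N3) => ? ? k1 k2; split=> //; move: k1 k2; lra_but K_ge0.
(* The term with [g (P x)] cancels the variation of [V] along the step up to [O(e)], leaving the
   loss [2 C phi x]. *)
pose B := 2 * C * phi x - dotv (g (P x)) (q x) + 2 * K ^+ 2 * e + eta / 2.
pose m (s : R) := moreau u e P (x + s *: q x).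
pose k (s : R) := dotv (q (x + s *: q x)) (q x).
have dm (s : R) : is_derive s 1 m (k s).
  apply: (@is_derive_quadratic _ _ _ _ (4 / e * dotv (q x) (q x))) => t _.
  have := moreau_expand H M (x + s *: q x) (t *: q x).
  have -> : x + s *: q x + t *: q x = x + (s + t) *: q x by rewrite scalerDl addrA.
  rewrite !dotvE -/(k s) => /le_trans; apply.
  by rewrite le_eqVlt; apply/orP; left; apply/eqP; ring.
have ck : continuous k.
  apply: (@lipschitz_continuous1 _ k (3 / e * enorm (q x) * enorm (q x))) => s t.
  rewrite /k -dotvNl -dotvDl; apply: le_trans (dotv_norm_le _ _) _.
  rewrite [leRHS]mulrAC ler_wpM2r ?enorm_ge0 //.
  apply: le_trans (mgrad_lip H M _ _) _.
  have -> : x + t *: q x - (x + s *: q x) = (t - s) *: q x.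
    by rewrite scalerBl; apply/rowP => i; rewrite !mxE; ring.
  by rewrite enormZ [_ * enorm (q x)]mulrC mulrA.
have kk : k h - k 0 <= h * B.
  apply: (@derivative_growth_from_backward_bound _ m k h B s0 (ltW hp) s00 dm ck).
  move=> s t sp sh tp ts.
  have s1 : s <= 1 by exact: le_trans h1.
  have [v1 v2 v3 v4] := var x s (ltW sp) s1.
  have := back (x + s *: q x) t (q x) tp ts (mgrad_le H M x).
  have -> : x + s *: q x - t *: q x = x + (s - t) *: q x.
    by rewrite scalerBl addrA.
  rewrite -/(m (s - t)) -/(m s) -/(k s) => b1.
  apply: le_trans b1 _; rewrite lerD2l ler_wpM2l ?divr_ge0 ?sqr_ge0 //.
  have w1 : 2 * K * enorm (q (x + s *: q x) - q x) <= 2 * K * (N * s) by rewrite ler_wpM2l ?mulr_ge0.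
  have w2 : 2 * K * enorm (q (x + s *: q x) - q x) ^+ 2 <= 2 * K * (N * s) by rewrite ler_wpM2l ?mulr_ge0.
  have w3 : 2 * C * phi (x + s *: q x) <= 2 * C * (phi x + N * s) by rewrite ler_wpM2l ?mulr_ge0.
  have w4 : s * N2 <= h * N2 by rewrite ler_wpM2r // ltW.
  have [Gs GsE] : exists Gs : R, Gs = dotv (g (P (x + s *: q x))) (q (x + s *: q x)).
    by eexists.
  rewrite -GsE in v4; rewrite -GsE.
  move: w1 w2 w3 v4 w4 hN2; rewrite /B /N2 -!/(phi _).
  move: (enorm (_ - _) ^+ 2) (phi x) (phi _) (K ^+ 2) => ? ? ? ?; lra_but K_ge0.
have k0 : k 0 = dotv (q x) (q x) by rewrite /k scale0r addr0.
have [n1 _ _ _] := var x h (ltW hp) h1.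
have n2 : dotv (q (x + h *: q x) - q x) (q (x + h *: q x) - q x) <= h * (h * N ^+ 2).
  rewrite -enorm_sqr; have -> : h * (h * N ^+ 2) = (N * h) ^+ 2 by ring.
  exact: ler_sqr_mono (enorm_ge0 _) n1.
have qq : dotv (q x) (q x) <= 4 * K ^+ 2.
  rewrite -enorm_sqr; have -> : 4 * K ^+ 2 = (2 * K) ^+ 2 by ring.
  exact: ler_sqr_mono (enorm_ge0 _) (mgrad_le H M x).
have := sol_V_taylor H x (h *: q x); rewrite dotvZr dotvZl dotvZr ler_norml => /andP[_ T].
have T2 : K * (h * (h * dotv (q x) (q x))) <= h * (h * (4 * K ^+ 3)).
  rewrite mulrCA ler_wpM2l ?(ltW hp) // mulrCA ler_wpM2l ?(ltW hp) //.
  have -> : 4 * K ^+ 3 = K * (4 * K ^+ 2) by ring.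
  by rewrite ler_wpM2l.
have gx : dotv (g x) (q x) <= dotv (g (P x)) (q x) + 4 * K ^+ 3 * e.
  have G1 : dotv (g x - g (P x)) (q x) <= 4 * K ^+ 3 * e.
    apply: le_trans (dotv_le _ _) _.
    have -> : 4 * K ^+ 3 * e = K * (2 * K * e) * (2 * K) by ring.
    rewrite ler_pM ?enorm_ge0 ?(mgrad_le H M) // enormB.
    have := sol_g_lip H x (P x - x); rewrite [x + _]addrC subrK.
    by move/le_trans; apply; rewrite ler_wpM2l // (dist_prox_le H M).
  by move: G1; rewrite !dotvE; lra.
have K23 : K ^+ 2 * e <= K ^+ 3 * e.
  by rewrite ler_wpM2r ?(ltW e0) // [K ^+ 3]exprS ler_peMl // sqr_ge0.
have f1 := ler_wpM2l (ltW hp) gx.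
have f2 := ler_wpM2l (ltW hp) K23.
have f3 := ler_wpM2l (ltW hp) hN3.
rewrite k0 in kk; move: kk n2 T T2 f1 f2 f3.
rewrite /psi /defect /B /N3 /k !dotvE (dotvC (q x) (q (x + h *: q x))).
move: (phi x) (V _) (V _) (K ^+ 2) (K ^+ 3) (N ^+ 2) => ? ? ? ? ? ?; lra_but K_ge0.
Qed.

End DefectGrowth.

(** * Growth estimates from almost every time *)

Section AlmostEverywhereGrowth.
Variable R : realType.
Let mu := @lebesgue_measure R.

Lemma negligible_open_cover (N : set R) (e : R) : mu.-negligible N -> 0 < e ->
  exists U : set R, [/\ open U, N `<=` U & (mu U < e%:E)%E].
Proof.
move=> [A [mA A0 NA]] e0.
have [|U [oU AU UA]] := @lebesgue_regularity_outer R A e mA _ e0.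
  by rewrite [X in (X < _)%E]A0 ltry.
exists U; split => //; first exact: subset_trans AU.
have mU : measurable U by exact: measurable_realfun.open_measurable.
have -> : U = (U `\` A) `|` A by rewrite setUC setDUK.
apply: le_lt_trans (measureU2 _ _ _) _ => //; first exact: measurableD.
by rewrite [X in (_ + X)%E]A0 adde0.
Qed.

(* The loss on the exceptional set is compensated by [L + |eta|] times the measure
   of a small open cover of it lying to the left of [t]. *)
Lemma ae_growth_uniform (f : R -> R) (a b L eta : R) (N : set R) : a <= b -> 0 <= L ->
  mu.-negligible N ->
  (forall r s, a <= r -> r <= s -> s <= b -> f r - L * (s - r) <= f s) ->
  (forall t, a <= t -> t < b -> ~ N t -> exists2 h0 : R, 0 < h0 &
     forall h : R, 0 < h -> h <= h0 -> f t - h * eta <= f (t + h)) ->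
  f a - eta * (b - a) <= f b.
Proof.
move=> ab L0 N0 hL hN.
pose L' := L + `|eta|.
have L'0 : 0 <= L' by rewrite addr_ge0.
apply/ler_addgt0Pr => e e0.
have L'1 : 0 < L' + 1 by rewrite ltr_wpDl.
have [U [oU NU muU]] := negligible_open_cover N0 (divr_gt0 e0 L'1).
have mU : measurable U by exact: measurable_realfun.open_measurable.
pose S t := U `&` `[a, t]%classic.
have mS t : measurable (S t) by exact: measurableI.
have Sfin t : (mu (S t) <= (e / (L' + 1))%:E)%E.
  apply: le_trans (ltW muU); apply: le_measure; [by rewrite inE; exact: mS | by rewrite inE | by move=> x []].
have Sge0 t : (0 <= mu (S t))%E by exact: measure_ge0.
have Sfn t : mu (S t) \is a fin_num.
  by rewrite ge0_fin_numE //; apply: le_lt_trans (Sfin t) _; rewrite ltry.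
pose lam t := fine (mu (S t)).
have lamE t : (lam t)%:E = mu (S t) by rewrite /lam fineK.
have lam0 t : 0 <= lam t by rewrite -lee_fin lamE.
have lame t : lam t <= e / (L' + 1) by rewrite -lee_fin lamE.
have lam_mono s t : s <= t -> lam s <= lam t.
  move=> st; rewrite -lee_fin !lamE; apply: le_measure; [by rewrite inE; exact: mS | by rewrite inE; exact: mS |].
  by apply: setIS => x /=; rewrite !in_itv /= => /andP[-> /= xs]; exact: le_trans st.
have lam_add s t : a <= s -> s <= t -> (forall x, s < x -> x <= t -> U x) ->
    lam s + (t - s) <= lam t.
  move=> as_ st hU; rewrite -lee_fin EFinD !lamE.
  have mI : measurable (`]s, t]%classic : set R) by exact: measurable_itv.
  have -> : (t - s)%:E = mu `]s, t]%classic.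
    rewrite /mu lebesgue_measure_itv /= lte_fin.
    move: st; rewrite le_eqVlt => /orP[/eqP ->|->]; last by rewrite EFinB.
    by rewrite ltxx subrr.
  have dis : S s `&` `]s, t]%classic = set0.
    apply/seteqP; split=> // x [[_]] /=; rewrite !in_itv /= => /andP[_ xs] /andP[sx _].
    by move: (le_lt_trans xs sx); rewrite ltxx.
  rewrite -(measureU mu (mS s) mI dis).
  apply: le_measure; [by rewrite inE; apply: measurableU; [exact: mS|exact: mI] |
    by rewrite inE; exact: mS |].
  move=> x [[Ux]|] /=; rewrite !in_itv /= => /andP[x1 x2].
    by split=> //=; rewrite in_itv /= x1 (le_trans x2).
  split; first exact: hU.
  by rewrite /= in_itv /= x2 (le_trans as_) // ltW.
(* [F] stays above [F a]: inside [U] the last term grows with slope [L + |eta|] and covers the worst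
   decrease of [f], outside [U] the bound at good times applies. *)
pose F t := f t + eta * (t - a) + L' * lam t.
have Fb : F a <= F b.
  apply: (@real_induction _ a b (fun t => F a <= F t)) => //.
  - move=> t at_ tb hQ; have Ft := hQ t at_ (lexx t).
    have [Ut|nUt] := pselect (U t).
      have /nbhs_ballP[r /= r0 hr] : nbhs t U by exact: open_nbhs_nbhs.
      exists (r / 2) => [|s ts sr sb]; first by rewrite divr_gt0.
      apply: le_trans Ft _.
      have h1 := hL t s at_ (ltW ts) sb.
      have h2 : lam t + (s - t) <= lam s.
        apply: lam_add => //; first exact: ltW.
        move=> x tx xs; apply: hr; rewrite /ball /= ltr_norml; apply/andP; split; lra.
      have h3 : L' * (lam t + (s - t)) <= L' * lam s by rewrite ler_wpM2l.
      have h4 : - (`|eta| * (s - t)) <= eta * (s - t).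
        rewrite -mulNr ler_wpM2r //; first by rewrite subr_ge0 ltW.
        by rewrite lerNl -normrN ler_norm.
      rewrite /F; move: h1 h3 h4; rewrite /L'.
      move: (f t) (f s) (lam t) (lam s) `|eta| => ? ? ? ? ?; lra.
    have [h0 h00 hh] := hN t at_ tb (fun Nt => nUt (NU t Nt)).
    exists h0 => // s ts sh sb; apply: le_trans Ft _.
    have := hh (s - t); rewrite subr_gt0 lerBlDl [t + (s - t)]addrC subrK => /(_ ts sh) h1.
    have h2 : L' * lam t <= L' * lam s by rewrite ler_wpM2l // lam_mono // ltW.
    rewrite /F; lra.
  - move=> t at_ tb hQ; apply/ler_addgt0Pr => r r0.
    pose c := L + `|eta| + 1.
    have c0 : 0 < c by rewrite ltr_wpDl // addr_ge0.
    pose s := Num.max a (t - r / c).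
    have st : s < t by rewrite gt_max at_ /= gtrBl divr_gt0.
    have as_ : a <= s by rewrite le_max lexx.
    have ts : c * (t - s) <= r.
      rewrite mulrC -ler_pdivlMr // lerBlDr addrC -lerBlDr.
      by rewrite le_max lexx orbT.
    have := hQ s as_ st; have h1 := hL s t as_ (ltW st) tb.
    have h2 : L' * lam s <= L' * lam t by rewrite ler_wpM2l // lam_mono // ltW.
    have h4 : - (`|eta| * (t - s)) <= eta * (t - s).
      rewrite -mulNr ler_wpM2r //; first by rewrite subr_ge0 ltW.
      by rewrite lerNl -normrN ler_norm.
    move: ts h1 h2 h4 st; rewrite /F /c /L'.
    move: (f s) (f t) (f a) (lam a) (lam s) (lam t) `|eta| => *; lra.
have h1 : L' * lam b <= e.
  apply: le_trans (_ : L' * (e / (L' + 1)) <= _); first by rewrite ler_wpM2l.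
  by rewrite mulrCA ger_pMr // ler_pdivrMr // mul1r lerDl.
have h2 : 0 <= L' * lam a by rewrite mulr_ge0.
by move: Fb h1 h2; rewrite /F; move: (f a) (f b) (L' * _) (L' * _) => *; lra.
Qed.

(** The uniform version is applied on short intervals, where a local constant [L] is available, and
    real induction glues them. At a limit from the left the local bound excludes a downward jump. *)
Lemma ae_growth (f : R -> R) (a b eta : R) (N : set R) : a <= b ->
  mu.-negligible N ->
  (forall t, a <= t -> t <= b -> exists L e : R, [/\ 0 <= L, 0 < e &
     forall r s, a <= r -> r <= s -> s <= b -> t - e <= r -> s <= t + e ->
       f r - L * (s - r) <= f s]) ->
  (forall t, a <= t -> t < b -> ~ N t -> exists2 h0 : R, 0 < h0 &
     forall h : R, 0 < h -> h <= h0 -> f t - h * eta <= f (t + h)) ->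
  f a - eta * (b - a) <= f b.
Proof.
move=> ab N0 hloc hN.
apply: (@real_induction _ a b (fun t => f a - eta * (t - a) <= f t)) => //.
- by rewrite subrr mulr0 subr0.
- move=> t at_ tb hQ; have [L [e [L0 e0 hL]]] := hloc t at_ (ltW tb).
  exists e => // s ts se sb.
  have := hQ t at_ (lexx t).
  have h : f t - eta * (s - t) <= f s.
    apply: (@ae_growth_uniform f t s L eta N) => //; first exact: ltW.
      move=> r r' tr rr' r's; apply: hL => //; lra.
    move=> r tr rs; apply: hN; lra.
  lra.
- move=> t at_ tb hQ; have [L [e [L0 e0 hL]]] := hloc t (ltW at_) tb.
  apply/ler_addgt0Pr => r r0.
  pose c := L + `|eta| + 1.
  have c0 : 0 < c by rewrite ltr_wpDl // addr_ge0.
  pose s := Num.max a (Num.max (t - e) (t - r / c)).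
  have st : s < t by rewrite !gt_max at_ /= !gtrBl divr_gt0 // e0.
  have as_ : a <= s by rewrite le_max lexx.
  have es : t - e <= s by rewrite !le_max lexx !orbT.
  have ts : c * (t - s) <= r.
    rewrite mulrC -ler_pdivlMr // lerBlDr addrC -lerBlDr.
    by rewrite !le_max lexx !orbT.
  have := hQ s as_ st; have h1 : f s - L * (t - s) <= f t.
    by apply: hL => //; [exact: ltW | rewrite lerDl ltW].
  have h4 : - (`|eta| * (t - s)) <= eta * (t - s).
    rewrite -mulNr ler_wpM2r //; first by rewrite subr_ge0 ltW.
    by rewrite lerNl -normrN ler_norm.
  move: ts h1 h4 st; rewrite /c.
  move: (f s) (f t) (f a) `|eta| => *; lra.
Qed.

End AlmostEverywhereGrowth.

(** * Superdifferentials and singular points *)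

Section Differentials.
Variables (R : realType) (d : nat).
Implicit Types (u : 'rV[R]_d -> R) (x y p q a : 'rV[R]_d).

Lemma superdifferentialP u x p : superdifferential u x p <->
  (forall e : R, 0 < e -> exists2 r : R, 0 < r & forall y, enorm (y - x) < r ->
     u y - u x - dotv p (y - x) <= e * enorm (y - x)).
Proof.
split=> h.
- move=> e e0; have : (limf_esup (diff_quotient u x p) x^' < e%:E)%E.
    by apply: (le_lt_trans h); rewrite lte_fin.
  rewrite limf_esupE => /ereal_inf_lt[_ [A Ax <-] Ae].
  have [r r0 hr] := nbhs_enorm Ax; exists r => // y yr.
  have [->|yx] := eqVneq y x; first by rewrite !subrr dotv0r subrr enorm0 mulr0.
  have yx0 : 0 < enorm (y - x).
    rewrite lt_neqAle enorm_ge0 andbT eq_sym; apply: contra_neq yx => /enorm_eq0.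
    by move=> /eqP; rewrite subr_eq0 => /eqP.
  have Ay : A y by exact: hr.
  have : (diff_quotient u x p y < e%:E)%E.
    by apply: le_lt_trans Ae; apply: ereal_sup_ubound; exists y.
  by rewrite /diff_quotient lte_fin ltr_pdivrMr // => /ltW.
- apply/lee_addgt0Pr => e e0; rewrite add0e.
  have [r r0 hr] := h e e0.
  apply: (@le_trans _ _ (ereal_sup (diff_quotient u x p @` [set y | y != x /\ enorm (y - x) < r]))).
    apply: ereal_inf_lbound; exists [set y | y != x /\ enorm (y - x) < r] => //.
    have := enorm_nbhs x r0; rewrite /dnbhs /within /=.
    by apply: filterS => y yr yx.
  apply: ge_ereal_sup => _ [y [yx yr] <-]; rewrite lee_fin.
  have yx0 : 0 < enorm (y - x).
    rewrite lt_neqAle enorm_ge0 andbT eq_sym; apply: contra_neq yx => /enorm_eq0.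
    by move=> /eqP; rewrite subr_eq0 => /eqP.
  by rewrite ler_pdivrMr // hr.
Qed.

Lemma subdifferential_opp u x p :
  subdifferential u x p <-> superdifferential (fun y => - u y) x (- p).
Proof.
rewrite /subdifferential /superdifferential /= /limf_einf oppe_ge0.
suff -> : (\- diff_quotient u x p)%E = diff_quotient (fun y => - u y) x (- p) by [].
apply/funext => y; rewrite /diff_quotient /=; congr (_%:E).
by rewrite dotvNl -mulNr; congr (_ / _); ring.
Qed.

Lemma upper_quadratic_superdifferential u x p (c : R) :
  (forall z, u z <= u x + dotv p (z - x) + c * dotv (z - x) (z - x)) ->
  superdifferential u x p.
Proof.
move=> h; apply/superdifferentialP => e e0.
have c1 : 0 < `|c| + 1 by rewrite ltr_wpDl.
exists (e / (`|c| + 1)) => [|y yr]; first exact: divr_gt0.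
have := h y; rewrite -enorm_sqr; move: yr (enorm_ge0 (y - x)).
rewrite ltr_pdivlMr //; move: (enorm _) => n yr n0 hy.
have h1 : c * n ^+ 2 <= (n * (`|c| + 1)) * n.
  rewrite mulrAC [leLHS]mulrC -expr2 ler_wpM2l ?sqr_ge0 //.
  by rewrite (le_trans (ler_norm c)) // lerDl.
have h2 : (n * (`|c| + 1)) * n <= e * n by rewrite ler_wpM2r // ltW.
by move: h1 h2 hy; move: (n * _ * n) => *; lra.
Qed.

(** Semiconcavity on the segment from [x] to [z] carries the first-order bound at a point close to
    [x] over to [z]: dividing by the small parameter [l] leaves the global paraboloid. *)
Lemma semiconcave_superdifferential u C x p :
  (forall x y (l : R), 0 <= l <= 1 ->
      l * u x + (1 - l) * u y - u (l *: x + (1 - l) *: y)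
        <= C / 2 * l * (1 - l) * enorm (x - y) ^+ 2) ->
  0 < C -> superdifferential u x p -> upgrad u C x p.
Proof.
move=> sc C0 /superdifferentialP hp z; rewrite -enorm_sqr.
have [->|zx] := eqVneq z x.
  by rewrite subrr dotv0r enorm0 expr0n /= mulr0 !addr0.
have n0 : 0 < enorm (z - x).
  rewrite lt_neqAle enorm_ge0 andbT eq_sym; apply: contra_neq zx => /enorm_eq0.
  by move=> /eqP; rewrite subr_eq0 => /eqP.
apply/ler_addgt0Pr => e e0.
have [r r0 hr] := hp _ (divr_gt0 e0 n0).
pose l := Num.min 1 (r / (2 * enorm (z - x))).
have l0 : 0 < l by rewrite lt_min ltr01 divr_gt0 // mulr_gt0.
have l1 : l <= 1 by rewrite ge_min lexx.
have lr : l * enorm (z - x) < r.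
  have : l <= r / (2 * enorm (z - x)) by rewrite ge_min lexx orbT.
  rewrite ler_pdivlMr ?mulr_gt0 //; lra.
have E : l *: z + (1 - l) *: x - x = l *: (z - x).
  by apply/rowP => i; rewrite !mxE; ring.
have := hr (l *: z + (1 - l) *: x); rewrite E enormZ gtr0_norm // => /(_ lr).
have := sc z x l; rewrite (ltW l0) l1 => /(_ isT).
have -> : e / enorm (z - x) * (l * enorm (z - x)) = l * e by field; rewrite gt_eqF.
rewrite dotvZr => h1 h2.
rewrite -(ler_pM2l l0).
have h3 : C / 2 * l * (1 - l) * enorm (z - x) ^+ 2 <= C / 2 * l * enorm (z - x) ^+ 2.
  rewrite ler_wpM2r ?sqr_ge0 // ler_piMr //; last by rewrite gerBl ltW.
  by rewrite mulr_ge0 ?divr_ge0 // ltW.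
move: h1 h2 h3; move: (u _) (u _) (u _) (enorm _ ^+ 2) (dotv _ _) => *; lra.
Qed.

Lemma dotv_differentiable u x p :
  (forall e : R, 0 < e -> exists2 r : R, 0 < r & forall y, enorm (y - x) < r ->
     `|u y - u x - dotv p (y - x)| <= e * enorm (y - x)) ->
  differentiable u x.
Proof.
move=> h.
have lin : linear (dotv p : 'rV[R]_d -> R^o) by move=> k y z; rewrite dotvDr dotvZr.
pose linM := GRing.isLinear.Build _ _ _ _ (dotv p : 'rV[R]_d -> R^o) lin.
pose f : {linear 'rV[R]_d -> R^o} := HB.pack (dotv p : 'rV[R]_d -> R^o) linM.
have D : u \o shift x = cst (u x) + f +o_ (0 : 'rV[R]_d) id.
  apply/eqaddoP => e e0.
  have d0 : 0 < d%:R + 1 :> R by rewrite ltr_wpDl.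
  have [r r0 hr] := h _ (divr_gt0 e0 d0).
  have := enorm_nbhs (0 : 'rV[R]_d) r0; apply: filterS => y /=; rewrite subr0 => yr.
  have := hr (y + x); rewrite addrK => /(_ yr).
  rewrite /shift /= -[(_ - _) y]/(u (y + x) - (u x + dotv p y)) opprD addrA => /le_trans; apply.
  rewrite mulrAC ler_pdivrMr // -mulrA ler_wpM2l ?(ltW e0) //.
  by apply: le_trans (enorm_le_norm _) _; rewrite mulrC ler_wpM2l // lerDl.
apply/diff_locallyP.
have cf : continuous f by exact: continuous_dotvr.
by rewrite (diff_unique cf D).
Qed.

Lemma differentiable_dotv u x : differentiable u x ->
  exists p, forall e : R, 0 < e -> exists2 r : R, 0 < r & forall y, enorm (y - x) < r ->
     `|u y - u x - dotv p (y - x)| <= e * enorm (y - x).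
Proof.
move=> du; pose p : 'rV[R]_d := \row_i 'd u x (delta_mx 0 i).
have pE y : 'd u x y = dotv p y.
  rewrite {1}(row_sum_delta y) linear_sum; apply: eq_bigr => i _.
  by rewrite linearZ /= mxE mulrC.
exists p => e e0.
have /diff_locallyP[_ /eqaddoP /(_ e e0)] := du.
move=> /nbhs_enorm[r r0 hr]; exists r => // y yr.
have := hr (y - x); rewrite subr0 => /(_ yr).
rewrite -[(_ - _) _]/(u (y - x + x) - (u x + 'd u x (y - x))) subrK opprD addrA pE.
move=> /le_trans; apply; rewrite ler_wpM2l ?(ltW e0) //; exact: norm_le_enorm.
Qed.

End Differentials.

Section Regularity.
Variables (R : realType) (d : nat).
Implicit Types (V u : 'rV[R]_d -> R) (x y p q a : 'rV[R]_d).

(** For [y] near [x], the segment is prolonged to the point [z] at distance 1 from [x].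
    Semiconcavity between [x] and [z] bounds the drop of [u] at [y] by the fraction [enorm (x - y)]
    of the oscillation [2 B], plus curvature. *)
Lemma semiconcave_lipschitz u (C B : R) : 0 < C -> 0 <= B ->
  (forall x y (l : R), 0 <= l <= 1 ->
      l * u x + (1 - l) * u y - u (l *: x + (1 - l) *: y)
        <= C / 2 * l * (1 - l) * enorm (x - y) ^+ 2) ->
  (forall x, `|u x| <= B) ->
  forall x y, `|u x - u y| <= (2 * B + C) * enorm (x - y).
Proof.
move=> C0 B0 sc hB.
have osc x y : u x - u y <= 2 * B.
  by have := hB x; have := hB y; rewrite !ler_norml => /andP[? ?] /andP[? ?]; lra.
have half x y : u x - u y <= (2 * B + C) * enorm (x - y).
  have [n1|n1] := leP 1 (enorm (x - y)).
    apply: le_trans (osc x y) _; apply: le_trans (_ : (2 * B + C) * 1 <= _).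
      by rewrite mulr1 lerDl ltW.
    by rewrite ler_wpM2l // addr_ge0 ?mulr_ge0 // ltW.
  have [xy|xy] := eqVneq y x; first by rewrite xy !subrr enorm0 mulr0.
  set n := enorm (x - y) in n1 *.
  have n0 : 0 < n.
    rewrite lt_neqAle enorm_ge0 andbT eq_sym; apply: contra_neq xy => /enorm_eq0.
    by move=> /eqP; rewrite subr_eq0 => /eqP.
  pose z := x + n^-1 *: (y - x).
  have zx : enorm (z - x) = 1.
    by rewrite /z addrAC subrr add0r enormZ gtr0_norm ?invr_gt0 // enormB mulVf // gt_eqF.
  have E : n *: z + (1 - n) *: x = y.
    rewrite /z scalerDr scalerA divff ?gt_eqF // scale1r.
    by apply/rowP => i; rewrite !mxE; ring.
  have := sc z x n; rewrite (ltW n0) (ltW n1) E zx expr1n mulr1 => /(_ isT) h.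
  have h1 : n * (u x - u z) <= n * (2 * B) by rewrite ler_wpM2l ?osc // ltW.
  have h2 : C / 2 * n * (1 - n) <= C / 2 * n * 1.
    by rewrite ler_wpM2l ?mulr_ge0 ?divr_ge0 ?(ltW C0) ?(ltW n0) // gerBl ltW.
  have h3 : 0 <= n * C by rewrite mulr_ge0 // ltW.
  move: h h1 h2 h3; move: (u _) (u _) (u _) => *; lra.
move=> x y; rewrite ler_norml half andbT lerNl opprB enormB; exact: half.
Qed.

Lemma semiconcave_solution_exists V u : Zperiodic V -> Ck 2 V ->
  (forall x, V x <= 0) -> Zperiodic u -> semiconcave u -> viscosity_solution V u ->
  exists C K, semiconcave_solution V u (grad V) C K /\
    forall x p, superdifferential u x p -> upgrad u C x p.
Proof.
move=> Vp V2 Vle up [cu [C C0 sc]] [_ sub sup].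
have [L L0 [T lip gL]] := C2_gradient_bounds Vp V2.
have [BV BV0 hBV] := periodic_bounded Vp V2.1.
have [B B0 hB] := periodic_bounded up cu.
have up_super x p : upgrad u C x p -> superdifferential u x p.
  by move=> h; exact: (upper_quadratic_superdifferential h).
have super_up x p : superdifferential u x p -> upgrad u C x p.
  exact: semiconcave_superdifferential.
exists C, (1 + L + BV + 2 * B + C); split; last exact: super_up.
have lipu := semiconcave_lipschitz C0 B0 sc hB.
set K := 1 + L + BV + 2 * B + C.
have [LK BVK BK B2K] : [/\ L <= K, BV <= K, B <= K & 2 * B + C <= K].
  by rewrite /K; split; lra.
split => //.
- by rewrite /K; lra.
- by rewrite /K; lra.
- by move=> x a; apply: le_trans (T x a) _; rewrite ler_wpM2r // dotv_ge0.
- by move=> x a; apply: le_trans (lip x a) _; rewrite ler_wpM2r // enorm_ge0.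
- by move=> x; apply: le_trans (gL x) _.
- move=> x; rewrite Vle andbT; have := hBV x; rewrite ler_norml => /andP[h _].
  by apply: le_trans h; rewrite lerN2.
- by move=> x; apply: le_trans (hB x) _.
- by move=> x y; apply: le_trans (lipu x y) _; rewrite ler_wpM2r // enorm_ge0.
- move=> x a; have h2 : 0 <= (2^-1 : R) <= 1 by apply/andP; split; lra.
  have := sc (x + a) (x - a) 2^-1 h2.
  have -> : x + a - (x - a) = 2 *: a by apply/rowP => i; rewrite !mxE; ring.
  have -> : 2^-1 *: (x + a) + (1 - 2^-1) *: (x - a) = x.
    by apply/rowP => i; rewrite !mxE; field.
  rewrite enorm_sqr !dotvE; move: (u _) (u _) (u _) (dotv _ _) => *; lra.
- move=> x p c h; exact: super_up (upper_quadratic_superdifferential h).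
- by move=> x p /up_super /sub; rewrite enorm_sqr.
- move=> x p c h; rewrite -enorm_sqr; apply: sup; apply/subdifferential_opp.
  apply: (@upper_quadratic_superdifferential _ _ _ _ _ c) => z.
  by have := h z; rewrite dotvNl; move: (u _) (u _) => *; lra.
Qed.

End Regularity.

(** * Defect at singular and at differentiability points *)

Section Singular.
Variables (R : realType) (d : nat).
Implicit Types (x y z p q a : 'rV[R]_d).
Variables (V u : 'rV[R]_d -> R) (g : 'rV[R]_d -> 'rV[R]_d) (C K : R).
Hypothesis H : semiconcave_solution V u g C K.

(** Supergradients are bounded and have a closed graph: a sequence violating the claim would have a
    cluster point that is a supergradient at [x] different from [p]. *)
Lemma upgrad_unique_near x p : (forall q, upgrad u C x q -> q = p) ->
  forall eta : R, 0 < eta -> exists2 r : R, 0 < r &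
    forall z q, enorm (z - x) < r -> upgrad u C z q -> enorm (q - p) < eta.
Proof.
move=> huniq eta eta0; apply: contrapT => hno.
have /choice[zq hzq] (n : nat) : exists zq : 'rV[R]_d * 'rV[R]_d,
    [/\ enorm (zq.1 - x) < n.+1%:R^-1, upgrad u C zq.1 zq.2 & eta <= enorm (zq.2 - p)].
  apply: contrapT => hn; apply: hno; exists n.+1%:R^-1; first by rewrite invr_gt0.
  move=> z q zx hq; rewrite ltNge; apply/negP => pe; apply: hn.
  by exists (z, q).
pose z n := (zq n).1; pose q n := (zq n).2.
have hz n : enorm (z n - x) < n.+1%:R^-1 by case: (hzq n).
have hq n : upgrad u C (z n) (q n) by case: (hzq n).
have hp n : eta <= enorm (q n - p) by case: (hzq n).
have cpt := @closed_ball_compact R d 0 (2 * K).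
have [|q0 [_ cl]] := cpt (q @ \oo) _.
  by exists 0%N => // n _ /=; rewrite subr0; exact: (upgrad_le H (hq n)).
have close (e : R) (N : nat) : 0 < e -> exists2 n, (N <= n)%N & enorm (q n - q0) < e.
  move=> e0; have := cl (q @` [set n | (N <= n)%N]) [set y | enorm (y - q0) < e].
  case.
  - by exists N => // n Nn; exists n.
  - exact: enorm_nbhs.
  - by move=> y [[n Nn <-] /=]; exists n.
have q0p : q0 = p.
  apply: huniq => y; apply/ler_addgt0Pr => e e0.
  have K1 := sol_K_ge1 H; have C0 := sol_C_gt0 H.
  have [D DE] : exists D : R, D = enorm (y - x) + 1 by eexists.
  have D0 : 0 < D by rewrite DE ltr_wpDl ?enorm_ge0.
  (* The four summands bound, per unit of [e / M], the errors of replacing [u (z n)] by [u x], [q n]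
     by [q0], and the base point [z n] by [x] in the linear and in the quadratic part. *)
  pose M := K + D + 2 * K + C * D.
  have M0 : 0 < M.
    by have := mulr_gt0 C0 D0; rewrite /M; lra.
  have eM : 0 < e / M by rewrite divr_gt0.
  have [N hN] : exists N : nat, M / e < N%:R.
    by exists (Num.bound (M / e)); rewrite archi_boundP // divr_ge0 // ltW.
  have [n Nn qn] := close (e / M) N eM.
  have zn : enorm (z n - x) <= e / M.
    apply: le_trans (ltW (hz n)) _.
    rewrite -(invrK (e / M)) invf_div lef_pV2 ?posrE ?divr_gt0 //.
    by apply: le_trans (ltW hN) _; rewrite ler_nat (leq_trans Nn).
  have zn1 : enorm (z n - x) <= 1.
    apply: le_trans (ltW (hz n)) _; rewrite invf_le1 ?ltr0n // ler1n //.
  have := hq n y.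
  have yz : y - z n = (y - x) - (z n - x) by rewrite opprB addrA subrK.
  have b1 := sol_u_lip H (z n) x; rewrite ler_norml in b1; case/andP: b1 => _ b1.
  have K0 : 0 <= K by exact: le_trans K1.
  have b1' : K * enorm (z n - x) <= K * (e / M) by rewrite ler_wpM2l.
  have b2 : dotv (q n) (y - z n) <= dotv q0 (y - x) + e / M * D + 2 * K * (e / M).
    have -> : dotv (q n) (y - z n) = dotv q0 (y - x) + dotv (q n - q0) (y - x)
       + dotv (q n) (x - z n) by rewrite !dotvE; ring.
    rewrite -!addrA lerD2l lerD //.
      apply: le_trans (dotv_le _ _) _; rewrite ler_pM ?enorm_ge0 ?(ltW qn) //.
      by rewrite DE lerDl.
    apply: le_trans (dotv_le _ _) _; rewrite enormB ler_pM ?enorm_ge0 //.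
    exact: (upgrad_le H (hq n)).
  have b3 : C / 2 * dotv (y - z n) (y - z n) <=
      C / 2 * dotv (y - x) (y - x) + C * D * (e / M).
    have t : enorm (y - z n) <= enorm (y - x) + enorm (z n - x).
      by rewrite yz; apply: le_trans (enormD _ _) _; rewrite enormN.
    have -> : C / 2 * dotv (y - x) (y - x) + C * D * (e / M) =
      C / 2 * (dotv (y - x) (y - x) + 2 * D * (e / M)) by field; rewrite gt_eqF.
    rewrite ler_wpM2l ?divr_ge0 ?(ltW C0) // -!enorm_sqr.
    apply: le_trans (_ : (enorm (y - x) + enorm (z n - x)) ^+ 2 <= _).
      by rewrite ler_pXn2r ?nnegrE ?addr_ge0 ?enorm_ge0.
    have h1 : enorm (z n - x) * (2 * enorm (y - x) + enorm (z n - x)) <= e / M * (2 * D).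
      rewrite ler_pM ?addr_ge0 ?mulr_ge0 ?enorm_ge0 //.
      by rewrite DE; move: zn1; move: (enorm _) (enorm _) => *; lra.
    by move: h1; move: (e / M) (enorm _) (enorm _) => *; lra.
  have eMM : e / M * M = e by rewrite divfK // gt_eqF.
  move: eMM; rewrite {2}/M.
  move: b1 b1' b2 b3; move: (e / M) (u _) (u _) (u _) (dotv q0 _) (dotv (q n) _)
    (dotv (y - z n) _) (dotv (y - x) _) (enorm _) => *; lra.
have [n _ qn] := close eta 0%N eta0.
by have := hp n; rewrite -q0p leNgt qn.
Qed.

(** Supergradients near a given point are supplied by proximal points. With parameter [n^2], where
    [n] is the distance to [x], the proximal point is within [2 K n^2] of its base point, which is
    negligible against [n]. *)
Lemma differentiable_of_upgrad_near x p :
  (forall eta : R, 0 < eta -> exists2 r : R, 0 < r &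
    forall z q, enorm (z - x) < r -> upgrad u C z q -> enorm (q - p) < eta) ->
  differentiable u x.
Proof.
move=> h; apply: (@dotv_differentiable _ _ _ _ p) => e e0.
have K1 := sol_K_ge1 H; have C0 := sol_C_gt0 H; have K0 : 0 <= K by exact: le_trans K1.
have [r r0 hr] := h (e / 2) (divr_gt0 e0 (ltr0n _ 2)).
pose M := 10 * K ^+ 2 + 10 * C * K ^+ 2 + 10 * C.
have M0 : 0 < M by rewrite /M ltr_wpDl ?addr_ge0 ?mulr_ge0 ?sqr_ge0 ?(ltW C0) // mulr_gt0.
pose r1 := Num.min (r / (4 * K)) (Num.min 1 (e / (2 * M))).
have r10 : 0 < r1 by rewrite !lt_min ltr01 !divr_gt0 ?mulr_gt0 // (lt_le_trans ltr01).
exists r1 => // y yr.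
have [yx|yx] := eqVneq y x; first by rewrite yx !subrr dotv0r subrr normr0 enorm0 mulr0.
have n0 : 0 < enorm (y - x).
  rewrite lt_neqAle enorm_ge0 andbT eq_sym; apply: contra_neq yx => /enorm_eq0.
  by move=> /eqP; rewrite subr_eq0 => /eqP.
have [nr n1 nM] : [/\ enorm (y - x) * (4 * K) < r, enorm (y - x) <= 1 &
    enorm (y - x) * (2 * M) <= e].
  move: yr; rewrite !lt_min => /and3P[a1 /ltW a2 /ltW a3]; split => //.
    by rewrite -ltr_pdivlMr // mulr_gt0 // (lt_le_trans ltr01).
  by rewrite -ler_pdivlMr // mulr_gt0.
set n := enorm (y - x) in n0 nr n1 nM *.
have n20 : 0 < n ^+ 2 by rewrite exprn_gt0.
have [P hP] := prox_choice H.
have nn : n ^+ 2 <= n by rewrite expr2 ler_piMr // ltW.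
(* A single upper estimate, used for both orders of [x] and [y], bounds the increment from both
   sides. *)
have one w w' : enorm (w - w') = n -> (w = x \/ w' = x) ->
    u w - u w' - dotv p (w - w') <= e * n.
  move=> ww wx.
  pose z := P (n ^+ 2) w'.
  have [q qE] : exists q : 'rV[R]_d, q = (n ^+ 2)^-1 *: (z - w') by eexists.
  have hq : upgrad u C z q by rewrite qE; exact: (prox_upgrad H n20 (hP _ w' n20)).
  have zE : z - w' = n ^+ 2 *: q by rewrite qE scalerA divff ?gt_eqF // scale1r.
  have qK := upgrad_le H hq.
  have zw : enorm (z - w') <= n ^+ 2 * (2 * K).
    by rewrite zE enormZ gtr0_norm // ler_wpM2l // ltW.
  have zx : enorm (z - x) < r.
    apply: le_lt_trans nr; case: wx => E; rewrite -E; last first.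
      apply: le_trans zw _; apply: le_trans (_ : n * (2 * K) <= _).
        by rewrite ler_wpM2r // mulr_ge0.
      by rewrite ler_wpM2l ?(ltW n0) // ler_wpM2r //; lra.
    apply: le_trans (enorm_triangle w' _ _) _; rewrite [enorm (w' - w)]enormB ww.
    have : n ^+ 2 * (2 * K) <= n * (2 * K) by rewrite ler_wpM2r // mulr_ge0.
    have : n <= n * K by rewrite ler_peMr // ltW.
    by move: zw; move: (enorm _) (n ^+ 2) => *; lra.
  have qp := hr z q zx hq.
  have h1 := hq w.
  have wz : w - z = (w - w') - n ^+ 2 *: q by rewrite -zE opprB addrA subrK.
  have h2 := sol_u_lip H z w'; rewrite ler_norml in h2; case/andP: h2 => _ h2.
  have h2' : K * enorm (z - w') <= 2 * K ^+ 2 * n ^+ 2.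
    have -> : 2 * K ^+ 2 * n ^+ 2 = K * (n ^+ 2 * (2 * K)) by ring.
    by rewrite ler_wpM2l.
  have h3 : dotv (q - p) (w - w') <= e / 2 * n.
    apply: le_trans (dotv_le _ _) _; rewrite ww ler_wpM2r ?(ltW n0) //; exact: ltW.
  have h4 : dotv (w - z) (w - z) <= (2 * (1 + 4 * K ^+ 2)) * n ^+ 2.
    have := dotv_ge0 ((w - w') + n ^+ 2 *: q); rewrite wz.
    have a1 : dotv (w - w') (w - w') = n ^+ 2 by rewrite -enorm_sqr ww.
    have a2 : n ^+ 2 * (n ^+ 2 * dotv q q) <= 4 * K ^+ 2 * n ^+ 2.
      have b1 : dotv q q <= 4 * K ^+ 2.
        rewrite -enorm_sqr; have -> : 4 * K ^+ 2 = (2 * K) ^+ 2 by ring.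
        by rewrite ler_pXn2r ?nnegrE ?enorm_ge0 ?mulr_ge0.
      rewrite mulrC ler_wpM2r ?(ltW n20) //; apply: le_trans b1.
      by rewrite ler_piMl ?dotv_ge0 // (le_trans nn).
    move: (w - w') a1 => b a1; rewrite !dotvE a1 (dotvC q b).
    by move: a2; move: (n ^+ 2) (K ^+ 2) => ? ?; gen_atoms; intros; lra.
  have h4' : C / 2 * dotv (w - z) (w - z) <= C / 2 * ((2 * (1 + 4 * K ^+ 2)) * n ^+ 2).
    by rewrite ler_wpM2l // divr_ge0 // ltW.
  have h5 : - (n ^+ 2 * dotv q q) <= 0.
    by rewrite oppr_le0 mulr_ge0 ?dotv_ge0 // ltW.
  have h6 : n * (n * (2 * M)) <= n * e by rewrite ler_wpM2l // ltW.
  have h7 : dotv q (w - z) = dotv (q - p) (w - w') + dotv p (w - w') - n ^+ 2 * dotv q q.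
    by rewrite wz !dotvE; ring.
  rewrite h7 in h1.
  have Cn : 0 <= C * n ^+ 2 by rewrite mulr_ge0 // ltW.
  have Kn : 0 <= K ^+ 2 * n ^+ 2 by rewrite mulr_ge0 ?sqr_ge0.
  have CKn : 0 <= C * (K ^+ 2 * n ^+ 2) by rewrite mulr_ge0 // ltW.
  have {}h6 : 2 * M * n ^+ 2 <= e * n by move: h6; rewrite expr2; move: (M) => ? ?; lra.
  move: h1 h2 h2' h3 h4' h5 h6 Cn Kn CKn; rewrite /M.
  move: (n ^+ 2) (K ^+ 2) (u _) (u _) (u _) (dotv (q - p) _) (dotv p _) (dotv (w - z) _)
    (dotv q q) (enorm _) => *; lra.
rewrite ler_norml; apply/andP; split.
  have := one x y; rewrite enormB => /(_ erefl (or_introl erefl)).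
  by rewrite !dotvE; move: (u _) (u _) => *; lra.
by apply: one => //; right.
Qed.

(** If no supergradient at [x] has positive defect, all of them have zero defect, hence the same
    norm. The set being convex and the Euclidean norm strictly convex, there is at most one, and [u]
    is differentiable. *)
Lemma singular_upgrad x : ~ differentiable u x ->
  exists2 p, upgrad u C x p & 2^-1 * dotv p p + V x < 0.
Proof.
move=> nd; apply: contrapT => hno; apply: nd.
have hge p : upgrad u C x p -> 0 <= 2^-1 * dotv p p + V x.
  by move=> hp; rewrite leNgt; apply/negP => hlt; apply: hno; exists p.
have huniq : exists p, forall q, upgrad u C x q -> q = p.
  (* For an empty set of supergradients uniqueness is vacuous and any vector, here 0, serves. *)
  have [[p hp]|no] := pselect (exists p, upgrad u C x p); last first.
    by exists 0 => q hq; case: no; exists q.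
  exists p => q hq; apply/eqP; rewrite -subr_eq0; apply/eqP; apply: dotv_eq0.
  have hm : upgrad u C x (2^-1 *: (p + q)).
    by move=> z; have := hp z; have := hq z; rewrite !dotvE;
      move: (u _) (u _) => ? ?; gen_atoms; intros; lra.
  have h0 := hge _ hm; have h1 := sol_sub H hp; have h2 := sol_sub H hq.
  apply/eqP; rewrite eq_le dotv_ge0 andbT.
  move: h0 h1 h2; rewrite !dotvE (dotvC q p); move: (V x) => ?; gen_atoms; intros; lra.
have [p hp] := huniq.
apply: (@differentiable_of_upgrad_near x p); exact: upgrad_unique_near.
Qed.

Lemma differentiable_upgrad x : differentiable u x ->
  (forall y p, superdifferential u y p -> upgrad u C y p) ->
  (forall y p, subdifferential u y p -> 0 <= 2^-1 * dotv p p + V y) ->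
  exists p, [/\ 2^-1 * dotv p p + V x = 0 & forall q, upgrad u C x q -> q = p].
Proof.
move=> /differentiable_dotv[p hp] sup_up sub_ge; exists p.
have hup : upgrad u C x p.
  apply: sup_up; apply/superdifferentialP => e /hp[r r0 hr]; exists r => // y /hr.
  by rewrite ler_norml => /andP[].
have hge : 0 <= 2^-1 * dotv p p + V x.
  apply: sub_ge; apply/subdifferential_opp; apply/superdifferentialP.
  move=> e /hp[r r0 hr]; exists r => // y /hr.
  by rewrite ler_norml dotvNl => /andP[]; move: (u _) (u _) => *; lra.
split; first by apply/eqP; rewrite eq_le hge (sol_sub H hup).
move=> q hq; apply/eqP; rewrite -subr_eq0; apply/eqP.
apply: enorm_eq0; apply/eqP; rewrite eq_le enorm_ge0 andbT; apply/ler_addgt0Pr => e e0.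
have [r r0 hr] := hp (e / 2) (divr_gt0 e0 (ltr0n _ 2)).
rewrite add0r; have [->|n0] := eqVneq (enorm (q - p)) 0; first exact: ltW.
have {}n0 : 0 < enorm (q - p) by rewrite lt_neqAle eq_sym n0 enorm_ge0.
have C0 := sol_C_gt0 H.
set n := enorm (q - p) in n0 *.
(* At [x - t (q - p)] the affine parts given by [p] and [q] differ by [t n^2]. The choice of [t]
   keeps the remainders below [t n e], whence [n <= e]. *)
pose t := Num.min (r / (2 * n)) (e / (C * n)).
have t0 : 0 < t by rewrite lt_min !divr_gt0 ?mulr_gt0.
have tr : t * (2 * n) <= r by rewrite -ler_pdivlMr ?mulr_gt0 // ge_min lexx.
have te : t * (C * n) <= e by rewrite -ler_pdivlMr ?mulr_gt0 // ge_min lexx orbT.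
pose y := x - t *: (q - p).
have yx : y - x = - (t *: (q - p)) by rewrite /y addrAC subrr add0r.
have := hr y; rewrite yx enormN enormZ (gtr0_norm t0) -/n.
have tn : t * n < r by have : 0 < t * n by [rewrite mulr_gt0 // ]; move=> ?; lra.
move=> /(_ tn); rewrite ler_norml => /andP[h1 _].
have := hq y; rewrite yx => h2.
have h3 : dotv (q - p) (q - p) = n ^+ 2 by rewrite -enorm_sqr.
have h4 : t * (n * n) <= t * (n * e).
  have te' : n * (t * (C * n)) <= n * e by rewrite ler_wpM2l // ltW.
  have : dotv q (t *: (q - p)) - dotv p (t *: (q - p)) = t * n ^+ 2.
    by rewrite -h3 !dotvE; ring.
  have : C / 2 * dotv (- (t *: (q - p))) (- (t *: (q - p))) = C / 2 * (t * (t * n ^+ 2)).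
    by rewrite -h3 dotvNl dotvNr opprK dotvZl dotvZr.
  have te2 : t * (n * (t * (C * n))) <= t * (n * e) by rewrite ler_wpM2l // ltW.
  move: h1 h2 te2; rewrite !dotvNr !expr2.
  move: (dotv _ _) (dotv q _) (dotv p _) (u _) (u _) => *; lra.
by move: h4; rewrite ler_pM2l // ler_pM2l.
Qed.

End Singular.

Section CurveFacts.
Variables (R : realType) (d : nat) (xi : R -> 'rV[R]_d).

Lemma locally_lipschitz_enorm (t : R) : 0 <= t ->
  locally_lipschitz [set t | 0 <= t] xi ->
  exists l e : R, [/\ 0 <= l, 0 < e & forall r s, 0 <= r -> 0 <= s ->
     `|r - t| <= e -> `|s - t| <= e -> enorm (xi s - xi r) <= l * `|s - r|].
Proof.
move=> t0 /(_ t t0)[U /nbhs_ballP[e /= e0 Ue] lip].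
have [M M0 hM] : exists2 M : R, 0 < M & forall r s : R, 0 <= r -> 0 <= s -> U r -> U s ->
    `|xi s - xi r| <= M * `|s - r|.
  have := lip; rewrite /lipschitz_on => /pinfty_ex_gt0[M M0 hM]; exists M => // r s r0 s0 Ur Us.
  by have := hM (s, r); apply; split.
exists (d%:R * M), (e / 2); split; [by rewrite mulr_ge0 // ltW|by rewrite divr_gt0|].
move=> r s r0 s0 rt st; apply: le_trans (enorm_le_norm _) _.
rewrite -mulrA ler_wpM2l //; apply: hM => //; apply: Ue; rewrite /ball /= distrC;
  apply: le_lt_trans (_ : e / 2 < e) => //; lra.
Qed.

Lemma derivable_enorm (t : R) : derivable xi t 1 -> forall eta : R, 0 < eta ->
  exists2 h0 : R, 0 < h0 & forall h : R, 0 < h -> h <= h0 ->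
    enorm (xi (t + h) - xi t - h *: derive1 xi t) <= eta * h.
Proof.
move=> dx eta eta0.
have d0 : 0 < d%:R + 1 :> R by rewrite ltr_wpDl.
have := dx; rewrite /derivable => /cvgrPdist_lt /(_ _ (divr_gt0 eta0 d0)).
rewrite /dnbhs /= => /nbhs_ballP[e /= e0 he]; exists (e / 2); first by rewrite divr_gt0.
move=> h h0 he2; have := he h; rewrite /ball /= sub0r normrN gtr0_norm //.
have -> : h < e by lra.
rewrite gt_eqF // => /(_ isT isT) hh.
apply: le_trans (enorm_le_norm _) _.
have E : xi (t + h) - xi t - h *: derive1 xi t =
    - (h *: (derive1 xi t - h^-1 *: (xi (h + t) - xi t))).
  by rewrite scalerBr scalerA divff ?gt_eqF // scale1r opprB [h + t]addrC.
rewrite E normrN normrZ gtr0_norm // mulrCA [eta * h]mulrC ler_wpM2l ?(ltW h0) //.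
apply: le_trans (_ : d%:R * (eta / (d%:R + 1)) <= _).
  rewrite ler_wpM2l //; apply: ltW; move: hh; rewrite derive1E.
  by rewrite [h%:A]mulr1.
by rewrite mulrCA ger_pMr // ler_pdivrMr // mul1r lerDl.
Qed.

End CurveFacts.

(** * Comparison with the generalized gradient flow *)

Section PenalizedMaximum.
Variables (R : realType) (d : nat).
Implicit Types (x y z p r v : 'rV[R]_d) (s t h : R).
Variables (V u : 'rV[R]_d -> R) (g : 'rV[R]_d -> 'rV[R]_d) (C K : R).
Hypothesis H : semiconcave_solution V u g C K.
Variables (e : R) (P q : 'rV[R]_d -> 'rV[R]_d).
Hypothesis M : proximal_map u K e P q.
Variables (xi : R -> 'rV[R]_d) (t0 T N : R).
Hypothesis N1 : 1 <= N.
Hypothesis t00 : 0 <= t0.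
Hypothesis t0T : t0 <= T.
Hypothesis Tshort : 4 * (C + 1) * (T - t0) <= 1.

Let K1 := sol_K_ge1 H.
Let C0 := sol_C_gt0 H.
Let CK := sol_C_le H.
Let e0 := prox_gt0 M.
Let K_ge0 : 0 <= K.
Proof. by apply: le_trans K1. Qed.
Let N0 : 0 <= N.
Proof. by apply: le_trans N1. Qed.

Let psi x := defect V q x.
Let phi x := prox_defect V P q x.

(* The first weight absorbs the decay rate [2 C] of the defect along [q], the
   second one the expansion rate [C] of the flow of the superdifferential. *)
Definition penalized t x := (1 + 4 * C * (t - t0)) * psi x
  - N * (2 - 4 * (C + 1) * (t - t0)) * dotv (x - xi t) (x - xi t).

(** The bound on [T - t0] is there to keep both weights between 1 and 2; longer times are reached by
    iteration. *)
Let weights t : t0 <= t -> t <= T ->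
  [/\ 1 <= 1 + 4 * C * (t - t0), 1 + 4 * C * (t - t0) <= 2,
      1 <= 2 - 4 * (C + 1) * (t - t0) & 2 - 4 * (C + 1) * (t - t0) <= 2].
Proof.
move=> tt tT.
have h1 : 0 <= C * (t - t0) by rewrite mulr_ge0 ?subr_ge0 // ltW.
have h2 : (C + 1) * (t - t0) <= (C + 1) * (T - t0).
  by rewrite ler_wpM2l ?lerD2r // addr_ge0 // ltW.
have h3 := Tshort; split; lra.
Qed.

Let psi_bounds x : - (2 * K ^+ 2) <= psi x <= K.
Proof.
have /andP[v1 v2] := sol_V_bounds H x.
have h1 : dotv (q x) (q x) <= 4 * K ^+ 2.
  rewrite -enorm_sqr; have -> : 4 * K ^+ 2 = (2 * K) ^+ 2 by ring.
  exact: ler_sqr_mono (enorm_ge0 _) (mgrad_le H M x).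
have h2 := dotv_ge0 (q x); rewrite /psi /defect; apply/andP.
by move: v1 v2 h1 h2; move: (V x) (K ^+ 2) (dotv _ _) => *; split; lra.
Qed.

Let penalized_continuous t : continuous (penalized t).
Proof.
have cq : continuous (fun x => dotv (q x) (q x)).
  move=> x; apply/(@cvgrPdist_lt _ _ _ (nbhs x)) => r r0.
  have c0 : 0 < 3 / e * (4 * K) + 1 by rewrite ltr_wpDl ?mulr_ge0 ?invr_ge0 // ltW.
  have := enorm_nbhs x (divr_gt0 r0 c0); apply: filterS => y /= yx.
  have -> : dotv (q x) (q x) - dotv (q y) (q y) = dotv (q x - q y) (q x + q y).
    by rewrite !dotvE (dotvC (q y) (q x)); ring.
  apply: le_lt_trans (dotv_norm_le _ _) _.
  apply: le_lt_trans (_ : 3 / e * enorm (y - x) * (4 * K) < r).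
    have hq : enorm (q x - q y) <= 3 / e * enorm (y - x).
      by rewrite [enorm (y - x)]enormB; exact: (mgrad_lip H M x y).
    rewrite ler_pM ?enorm_ge0 //.
    by apply: le_trans (enormD _ _) _; have := mgrad_le H M x; have := mgrad_le H M y; lra.
  move: yx; rewrite ltr_pdivlMr //.
  by have := enorm_ge0 (y - x); move: (enorm _) (e^-1) => *; lra.
have cV : continuous V.
  by apply: (@taylor_continuous _ _ _ K) => x; exists (g x) => a; exact: (sol_V_taylor H).
have cd : continuous (fun x => dotv (x - xi t) (x - xi t)).
  move=> x; apply: (@continuous_comp _ _ _ (fun y => y - xi t) (fun z => dotv z z)).
    by apply: continuousB; [exact: cvg_id | exact: cst_continuous].
  exact: continuous_sqnorm.
have cM (c : R) (f : 'rV[R]_d -> R) : continuous f -> continuous (fun x => c * f x).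
  move=> cf x; apply: (@continuousM _ _ (cst c) f); last exact: cf.
  exact: cst_continuous.
have cB (f1 f2 : 'rV[R]_d -> R) : continuous f1 -> continuous f2 ->
    continuous (fun x => f1 x - f2 x).
  by move=> c1 c2 x; apply: (@continuousB _ _ _ f1 f2); [exact: c1 | exact: c2].
apply: (cB) (cM _ _ cd); apply: (cM); apply: (cB) => //.
by move=> x; apply: (@continuousN _ _ _ (fun x => 2^-1 * dotv (q x) (q x))); exact: cM.
Qed.

(** [N] times the second weight is at least 1, so a point farther than [3 K] from [xi t] pays more
    than [9 K^2], beyond the possible gain [2 K + 4 K^2] of the weighted defect. *)
Lemma penalized_max t : t0 <= t -> t <= T ->
  exists x, (forall y, penalized t y <= penalized t x) /\ enorm (x - xi t) <= 3 * K.
Proof.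
move=> tt tT; have [a1 a2 b1 b2] := weights tt tT.
have far x : 3 * K < enorm (x - xi t) -> penalized t x < penalized t (xi t).
  move=> hx; rewrite /penalized subrr dotv0r mulr0 subr0 -enorm_sqr.
  have /andP[_ h1] := psi_bounds x; have /andP[h2 _] := psi_bounds (xi t).
  set a := 1 + _ in a1 a2 *; set b := 2 - _ in b1 b2 *.
  have a0 : 0 <= a by exact: le_trans a1.
  have h3 : a * psi x <= 2 * K.
    apply: le_trans (ler_wpM2l a0 h1) _; by rewrite ler_wpM2r.
  have h4 : - (4 * K ^+ 2) <= a * psi (xi t).
    apply: le_trans (ler_wpM2l a0 h2); rewrite mulrN lerN2 mulrA ler_wpM2r ?sqr_ge0 //; lra.
  have h5 : (3 * K) ^+ 2 < enorm (x - xi t) ^+ 2.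
    by rewrite ltr_pXn2r ?nnegrE ?enorm_ge0 ?mulr_ge0.
  have h6 : enorm (x - xi t) ^+ 2 <= N * b * enorm (x - xi t) ^+ 2.
    by rewrite ler_peMl ?sqr_ge0 // -[1]mulr1 ler_pM.
  have h7 : K <= K ^+ 2 by rewrite expr2 ler_peMl.
  move: (K1) h3 h4 h5 h6 h7; rewrite exprMn.
  move: (N * b * _) (psi x) (psi _) (K ^+ 2) => *; lra.
have [x hx] := argmax_coercive (@penalized_continuous t) (fun y hy => ltW (far y hy)).
exists x; split => //; rewrite leNgt; apply/negP => /far.
by rewrite ltNge hx.
Qed.

Hypothesis xi_lip : forall t, 0 <= t -> exists l r : R, [/\ 0 <= l, 0 < r &
  forall s s', 0 <= s -> 0 <= s' -> `|s - t| <= r -> `|s' - t| <= r ->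
    enorm (xi s' - xi s) <= l * `|s' - s|].

(** A crude bound valid at every time: [L] need not be small, since [ae_growth] resorts to it only
    near the null set where the flow equation fails. *)
Lemma penalized_local_growth t : t0 <= t -> t <= T ->
  exists L r : R, [/\ 0 <= L, 0 < r & forall s s' x, t0 <= s -> s <= s' -> s' <= T ->
    t - r <= s -> s' <= t + r -> enorm (x - xi s) <= 3 * K ->
    penalized s x - L * (s' - s) <= penalized s' x].
Proof.
move=> tt tT; have [l [r [l0 r0 hl]]] := xi_lip (le_trans t00 tt).
exists (8 * C * K ^+ 2 + 2 * N * (l * (6 * K + l))), r.
have CK2 : 0 <= C * K ^+ 2 by rewrite mulr_ge0 ?sqr_ge0 // ltW.
have NL : 0 <= N * (l * (6 * K + l)) by rewrite !mulr_ge0 ?addr_ge0 ?mulr_ge0.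
split => //; first by lra.
move=> s s' x ts ss sT tr rt hx.
have ts' : t0 <= s' by exact: le_trans ss.
have [a1 a2 b1 b2] := weights ts' sT.
have dl : enorm (xi s' - xi s) <= l * (s' - s).
  have := hl s s' (le_trans t00 ts) (le_trans t00 ts').
  rewrite [`|s' - s|]ger0_norm ?subr_ge0 //; apply; rewrite ler_norml; apply/andP; split; lra.
have ss1 : s' - s <= 1.
  have h1 := Tshort; have : 0 <= C * (T - t0) by rewrite mulr_ge0 ?subr_ge0 // ltW.
  move: ts sT h1; move: (C * _) => *; lra.
have dl1 : enorm (xi s' - xi s) <= l.
  by apply: le_trans dl _; rewrite ler_piMr.
have sq : dotv (x - xi s') (x - xi s') - dotv (x - xi s) (x - xi s) <=
    l * (s' - s) * (6 * K + l).
  have -> : x - xi s' = (x - xi s) - (xi s' - xi s) by rewrite opprB addrA subrK.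
  have -> : dotv (x - xi s - (xi s' - xi s)) (x - xi s - (xi s' - xi s)) - dotv (x - xi s) (x - xi s)
    = dotv (xi s' - xi s) ((xi s' - xi s) - 2 *: (x - xi s)).
    move: (xi s' - xi s) (x - xi s) => A B; rewrite !dotvE (dotvC B A); ring.
  apply: le_trans (dotv_le _ _) _; rewrite ler_pM ?enorm_ge0 //.
  apply: le_trans (enormD _ _) _; rewrite enormN enormZ ger0_norm //.
  by move: hx dl1; move: (enorm _) (enorm _) => *; lra.
have /andP[p1 p2] := psi_bounds x.
set D := dotv (x - xi s) (x - xi s) in sq *; set D' := dotv (x - xi s') _ in sq *.
have D0 : 0 <= D by exact: dotv_ge0.
have ss0 : 0 <= s' - s by rewrite subr_ge0.
have k1 : C * (s' - s) * - (2 * K ^+ 2) <= C * (s' - s) * psi x.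
  by rewrite ler_wpM2l // mulr_ge0 // ltW.
have k2 : 0 <= N * ((C + 1) * (s' - s)) * D.
  by rewrite !mulr_ge0 // addr_ge0 // ltW.
have k3 : N * (2 - 4 * (C + 1) * (s' - t0)) * (D' - D) <=
    N * 2 * (l * (s' - s) * (6 * K + l)).
  apply: le_trans (_ : N * (2 - 4 * (C + 1) * (s' - t0)) * (l * (s' - s) * (6 * K + l)) <= _).
    by rewrite ler_wpM2l // mulr_ge0 // (le_trans ler01).
  have X0 : 0 <= l * (s' - s) * (6 * K + l).
    by apply: mulr_ge0; [exact: mulr_ge0 | apply: addr_ge0 => //; exact: mulr_ge0].
  by rewrite (ler_wpM2r X0) // ler_wpM2l.
rewrite /penalized -/D -/D'.
move: k1 k2 k3; move: (psi x) D D' (K ^+ 2) {sq D0} => ? ? ? ?; lra.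
Qed.

(** The summands pay, in order, for the errors in the growth of the defect, for the distance from
    [x] to [P x] in the monotonicity bound, and for three remainders of at most [e / 4] each. *)
Let rate := (24 * K ^+ 3 + 64 * N * K ^+ 4 + 1) * e.

(** The slope [4 C] of the first weight covers the loss [2 C] times a weight at most 2. The slope
    [4 (C + 1)] of the second covers the growth rate [2 (C + 1)] of the squared distance, again
    times a weight at most 2. *)
Lemma penalized_growth t x v : t0 <= t -> t < T -> enorm (x - xi t) <= 3 * K ->
  upgrad u C (xi t) v ->
  (forall eta : R, 0 < eta -> exists2 h0 : R, 0 < h0 & forall h, 0 < h -> h <= h0 ->
     enorm (xi (t + h) - xi t - h *: v) <= eta * h) ->
  exists2 h0 : R, 0 < h0 & forall h, 0 < h -> h <= h0 ->
    penalized t x - h * rate <= penalized (t + h) (x + h *: q x).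
Proof.
move=> tt tT hx hv hd.
have Npos : 0 < N by exact: lt_le_trans N1.
have Kpos : 0 < K by exact: lt_le_trans K1.
have e8 : 0 < e / 8 by rewrite divr_gt0.
have [h1 h10 hpsi] := defect_growth H M x e8.
pose eta := Num.min 1 (e / (48 * N * K)).
have NK : 0 < 48 * N * K by rewrite !mulr_gt0.
have eta0 : 0 < eta by rewrite lt_min ltr01 divr_gt0.
have eta1 : eta <= 1 by rewrite ge_min lexx.
have etaN : eta * (48 * N * K) <= e by rewrite -ler_pdivlMr // ge_min lexx orbT.
have [h2 h20 hxi] := hd eta eta0.
pose A := 8 * N * (4 * K + 1) ^+ 2.
have A0 : 0 < A by rewrite /A !mulr_gt0 ?exprn_gt0 // addr_gt0 // mulr_gt0.
pose h0 := Num.min (Num.min h1 h2) (Num.min (T - t) (e / A)).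
exists h0; first by rewrite !lt_min h10 h20 subr_gt0 tT divr_gt0.
move=> h hp; rewrite !le_min => /andP[/andP[hh1 hh2] /andP[hT hA]].
have {}hA : h * A <= e by rewrite -ler_pdivlMr.
have thT : t + h <= T by rewrite addrC -lerBrDr.
have tth : t0 <= t + h by rewrite (le_trans tt) // lerDl ltW.
have [a1 a2 b1 b2] := weights tth thT.
have hpsi' := hpsi h hp hh1.
have hxi' := hxi h hp hh2.
have near := defect_near H M x.
have phi0 := prox_defect_ge0 H M x.
set a := 1 + 4 * C * (t + h - t0) in a1 a2.
set b := 2 - 4 * (C + 1) * (t + h - t0) in b1 b2.
pose D := x - xi t.
have [r rE] : exists r : 'rV[R]_d, r = xi (t + h) - xi t - h *: v by eexists.
have hr : enorm r <= eta * h by rewrite rE.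
have hqv : enorm (q x - v) <= 4 * K.
  apply: le_trans (enormD _ _) _; rewrite enormN.
  by have := mgrad_le H M x; have := upgrad_le H hv; lra.
have K3 : 0 <= K ^+ 3 by rewrite exprn_ge0.
have partA : (1 + 4 * C * (t - t0)) * psi x - h * (24 * K ^+ 3 * e + e / 4) <=
    a * psi (x + h *: q x).
  have g1 : a * (psi x - h * (2 * C * phi x + 6 * K ^+ 3 * e + e / 8)) <=
      a * psi (x + h *: q x) by rewrite ler_wpM2l // (le_trans ler01).
  apply: le_trans g1.
  have g2 : a * (h * (2 * C * phi x + 6 * K ^+ 3 * e + e / 8)) <=
      2 * (h * (2 * C * phi x + 6 * K ^+ 3 * e + e / 8)).
    rewrite ler_wpM2r // mulr_ge0 ?(ltW hp) // addr_ge0 ?(ltW e8) // addr_ge0 //.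
      by rewrite mulr_ge0 // mulr_ge0 // ltW.
    by rewrite mulr_ge0 ?(ltW e0) // mulr_ge0.
  move: near; rewrite ler_norml => /andP[near _].
  have g3 : C * h * - (3 * K ^+ 2 * e) <= C * h * (psi x - phi x).
    by rewrite ler_wpM2l // mulr_ge0 // ltW.
  have g4 : C * h * (K ^+ 2 * e) <= h * (K ^+ 3 * e).
    have -> : h * (K ^+ 3 * e) = K * h * (K ^+ 2 * e) by ring.
    have X0 : 0 <= K ^+ 2 * e by rewrite mulr_ge0 ?sqr_ge0 // ltW.
    by rewrite (ler_wpM2r X0) // ler_wpM2r // ltW.
  have aE : a * psi x = (1 + 4 * C * (t - t0)) * psi x + 4 * C * h * psi x.
    by rewrite /a; ring.
  rewrite [a * (_ - _)]mulrBr; apply: le_trans (_ : a * psi x -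
    2 * (h * (2 * C * phi x + 6 * K ^+ 3 * e + e / 8)) <= _); last by rewrite lerD2l lerN2.
  rewrite aE; move: g3 g4.
  move: (psi x) (phi x) (K ^+ 3) (K ^+ 2) => ? ? ? ?; lra.
have [W WE] : exists W : 'rV[R]_d, W = h *: (q x - v) - r by eexists.
have xE : x + h *: q x - xi (t + h) = D + W.
  by rewrite WE rE /D; apply/rowP => i; rewrite !mxE; ring.
(* Monotonicity holds between [P x] and [xi t], where [q x] and [v] are supergradients. Returning
   from [P x] to [x] costs [O(e)], and the extra 1 in [C + 1] absorbs a cross term. *)
have c1 : dotv (q x - v) D <= (C + 1) * dotv D D + 16 * K ^+ 4 * e.
  have [B BE] : exists B : 'rV[R]_d, B = P x - xi t by eexists.
  have [S SE] : exists S : 'rV[R]_d, S = q x - v by eexists.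
  have DE : D = B - e *: q x.
    by rewrite BE (prox_shift M) /D; apply/rowP => i; rewrite !mxE; ring.
  have k1 : dotv S B <= C * dotv B B.
    by rewrite SE BE; exact: (upgrad_monotone (mgrad_upgrad H M x) hv).
  have k2 : - dotv S (q x) <= 8 * K ^+ 2.
    rewrite -dotvNl; apply: le_trans (dotv_le _ _) _; rewrite enormN SE.
    have -> : 8 * K ^+ 2 = 4 * K * (2 * K) by ring.
    by rewrite ler_pM ?enorm_ge0 // (mgrad_le H M).
  have k3 : dotv (q x) (q x) <= 4 * K ^+ 2.
    rewrite -enorm_sqr; have -> : 4 * K ^+ 2 = (2 * K) ^+ 2 by ring.
    exact: ler_sqr_mono (enorm_ge0 _) (mgrad_le H M x).
  have BE' : B = D + e *: q x by rewrite DE subrK.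
  have k4 : 2 * C * e * dotv D (q x) <= dotv D D + C ^+ 2 * e ^+ 2 * dotv (q x) (q x).
    have := dotv_ge0 (D - (C * e) *: q x); move: (D) => D'.
    rewrite !dotvE (dotvC (q x) D'); lra.
  have e1 : e <= 1 by have := prox_small1 H M; lra.
  have ee : e ^+ 2 <= e by rewrite expr2 ler_piMl // ltW.
  have C2 : C ^+ 2 <= K ^+ 2 by exact: ler_sqr_mono (ltW C0) CK.
  have k5 : C ^+ 2 * e ^+ 2 * dotv (q x) (q x) <= 4 * K ^+ 4 * e.
    have -> : 4 * K ^+ 4 * e = K ^+ 2 * e * (4 * K ^+ 2) by ring.
    apply: ler_pM => //; [by rewrite mulr_ge0 ?sqr_ge0 | exact: dotv_ge0 |].
    by apply: ler_pM => //; exact: sqr_ge0.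
  have K24 : K ^+ 2 * e <= K ^+ 4 * e by rewrite ler_wpM2r ?(ltW e0) // ler_weXn2l.
  have K34 : K ^+ 3 * e <= K ^+ 4 * e by rewrite ler_wpM2r ?(ltW e0) // ler_weXn2l.
  have k6 : C * e ^+ 2 * dotv (q x) (q x) <= 4 * K ^+ 3 * e.
    have -> : 4 * K ^+ 3 * e = K * e * (4 * K ^+ 2) by ring.
    apply: ler_pM => //; [by rewrite mulr_ge0 ?sqr_ge0 // ltW | exact: dotv_ge0 |].
    by apply: ler_pM => //; [exact: ltW | exact: sqr_ge0].
  have k7 := ler_wpM2l (ltW e0) k2.
  have k8 : C * dotv B B = C * dotv D D + 2 * C * e * dotv D (q x) + C * e ^+ 2 * dotv (q x) (q x).
    rewrite BE'; move: (D) => D'; rewrite !dotvE (dotvC (q x) D'); ring.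
  have k9 : dotv S D = dotv S B - e * dotv S (q x).
    by rewrite DE dotvDr dotvNr dotvZr.
  rewrite -SE k9; rewrite k8 in k1; move: k1 k4 k5 k6 k7 K24 K34.
  move: (C ^+ 2 * e ^+ 2 * _) (C * e ^+ 2 * _) (2 * C * e * _) => ? ? ?.
  move: (K ^+ 2) (K ^+ 3) (K ^+ 4) (dotv S B) (dotv S (q x)) (dotv D D) => ? ? ? ? ? ?.
  lra.
have c2 : - dotv r D <= eta * h * (3 * K).
  by rewrite -dotvNl; apply: le_trans (dotv_le _ _) _; rewrite enormN ler_pM ?enorm_ge0.
have c3 : dotv W W <= h ^+ 2 * (4 * K + 1) ^+ 2.
  rewrite -exprMn -enorm_sqr; apply: ler_sqr_mono (enorm_ge0 _) _.
  rewrite WE; apply: le_trans (enormD _ _) _; rewrite enormN enormZ gtr0_norm // mulrDr mulr1.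
  apply: lerD; first by rewrite ler_wpM2l // ltW.
  by apply: le_trans hr _; rewrite ler_piMl // ltW.
have DD := dotv_ge0 D.
have K4 : 0 <= K ^+ 4 by rewrite exprn_ge0.
have Nb : 0 <= N * b by rewrite mulr_ge0 // (le_trans ler01).
have N2 : N * b <= N * 2 by rewrite ler_wpM2l.
have c4 : dotv D W <= h * ((C + 1) * dotv D D + 16 * K ^+ 4 * e) + eta * h * (3 * K).
  rewrite WE dotvDr dotvZr dotvNr (dotvC D r) (dotvC D (q x - v)).
  by apply: lerD c2; rewrite ler_wpM2l // ltW.
have Z0 : 0 <= 2 * (h * ((C + 1) * dotv D D + 16 * K ^+ 4 * e) + eta * h * (3 * K))
    + h ^+ 2 * (4 * K + 1) ^+ 2.
  have z1 : 0 <= (C + 1) * dotv D D + 16 * K ^+ 4 * e.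
    apply: addr_ge0; first by rewrite mulr_ge0 // addr_ge0 // ltW.
    by rewrite mulr_ge0 ?mulr_ge0 // ltW.
  have z2 := mulr_ge0 (ltW hp) z1.
  have z3 : 0 <= eta * h * (3 * K) by rewrite mulr_ge0 ?mulr_ge0 // ltW.
  have z4 := mulr_ge0 (sqr_ge0 h) (sqr_ge0 (4 * K + 1)).
  by apply: addr_ge0 => //; rewrite mulr_ge0 // addr_ge0.
have c5 : N * b * dotv (D + W) (D + W) <= N * b * dotv D D + N * 2 *
    (2 * (h * ((C + 1) * dotv D D + 16 * K ^+ 4 * e) + eta * h * (3 * K))
     + h ^+ 2 * (4 * K + 1) ^+ 2).
  apply: le_trans (_ : N * b * dotv D D + N * b * (2 * (h * ((C + 1) * dotv D D + 16 * K ^+ 4 * e)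
      + eta * h * (3 * K)) + h ^+ 2 * (4 * K + 1) ^+ 2) <= _); last first.
    by rewrite lerD2l ler_wpM2r.
  have -> : dotv (D + W) (D + W) = dotv D D + 2 * dotv D W + dotv W W.
    by move: (D) => D'; rewrite !dotvE (dotvC W D'); ring.
  rewrite -mulrDr ler_wpM2l //.
  by move: c3 c4; move: (dotv D D) (dotv D W) (dotv W W) => *; lra.
have bE : 2 - 4 * (C + 1) * (t - t0) = b + 4 * (C + 1) * h by rewrite /b; ring.
have c6 := ler_wpM2l (ltW hp) hA.
have c7 := ler_wpM2l (ltW hp) etaN.
rewrite /penalized xE -/a -/b -/D bE.
have he0 : 0 <= h * e by rewrite mulr_ge0 // ltW.
move: partA c5 c6 c7 he0; rewrite /rate /A.
rewrite -!/(psi _).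
move: ((1 + 4 * C * (t - t0)) * psi x) (a * psi (x + h *: q x)) => X2 X1.
move: (N * b * dotv (D + W) (D + W)) => X3.
move: (K ^+ 3) (K ^+ 4) (dotv D D) (eta) (b) => ? ? ? ? ?.
lra.
Qed.

Lemma penalized_reach (E : set R) y : (@lebesgue_measure R).-negligible E ->
  (forall t, ~ E t -> 0 <= t -> derivable xi t 1 /\ upgrad u C (xi t) (derive1 xi t)) ->
  exists x, penalized t0 y - rate <= penalized T x.
Proof.
move=> negE hE.
have /choice[X hX] t : exists x, t0 <= t -> t <= T ->
    (forall y, penalized t y <= penalized t x) /\ enorm (x - xi t) <= 3 * K.
  have [tt|tt] := leP t0 t; last by exists 0.
  have [tT|tT] := leP t T; last by exists 0.
  by have [x hx] := penalized_max tt tT; exists x.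
pose m t := penalized t (X t).
have mono : m t0 - rate * (T - t0) <= m T.
  apply: (@ae_growth _ m t0 T rate E t0T negE).
  - move=> t tt tT; have [L [r [L0 r0 hL]]] := penalized_local_growth tt tT.
    exists L, r; split => // s s' ts ss sT tr rt.
    have [_ near] := hX s ts (le_trans ss sT).
    have [far _] := hX s' (le_trans ts ss) sT.
    by apply: le_trans (far _); exact: hL.
  - move=> t tt tT nE; have [dx up] := hE t nE (le_trans t00 tt).
    have [_ near] := hX t tt (ltW tT).
    have [h0 h00 hg] := penalized_growth tt tT near up (derivable_enorm dx).
    exists (Num.min h0 (T - t)); first by rewrite lt_min h00 subr_gt0.
    move=> h hp; rewrite le_min => /andP[hh hT].
    have tth : t0 <= t + h by rewrite (le_trans tt) // lerDl ltW.
    have thT : t + h <= T by rewrite addrC -lerBrDr.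
    have [far _] := hX (t + h) tth thT.
    by apply: le_trans (far _); exact: hg.
exists (X T); apply: le_trans mono.
have [far _] := hX t0 (lexx t0) t0T.
apply: lerB; first exact: far.
have rate0 : 0 <= rate.
  by rewrite /rate mulr_ge0 ?(ltW e0) // !addr_ge0 ?mulr_ge0 ?exprn_ge0.
rewrite ler_piMr //.
have h1 := Tshort; have : 0 <= C * (T - t0) by rewrite mulr_ge0 ?subr_ge0 // ltW.
have : 0 <= T - t0 by rewrite subr_ge0.
by move: h1; move: (T - t0) => *; lra.
Qed.

End PenalizedMaximum.

Section Propagation.
Variables (R : realType) (d : nat).
Implicit Types (x y z p r v : 'rV[R]_d) (s t h e : R).
Variables (V u : 'rV[R]_d -> R) (g : 'rV[R]_d -> 'rV[R]_d) (C K : R).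
Hypothesis H : semiconcave_solution V u g C K.
Hypothesis super_up : forall x p, superdifferential u x p -> upgrad u C x p.
Hypothesis sub_ge : forall x p, subdifferential u x p -> 0 <= 2^-1 * dotv p p + V x.

Lemma proximal_map_exists e : 0 < e -> 8 * e * K <= 1 ->
  exists P q, proximal_map u K e P q.
Proof.
move=> e0 eK; have [P hP] := prox_choice H.
exists (P e), (fun x => e^-1 *: (P e x - x)); split => //.
- by move=> x z; exact: hP.
- by move=> x; rewrite scalerA divff ?gt_eqF // scale1r addrC subrK.
Qed.

(** Since [e C < 1], [upgrad_prox] makes the maximizer unique, so whichever one [P] has chosen must
    be [x]. *)
Lemma proximal_map_of_upgrad e P q x p : proximal_map u K e P q ->
  upgrad u C x p -> P (x - e *: p) = x /\ q (x - e *: p) = p.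
Proof.
move=> M hp; have e0 := prox_gt0 M.
have Px : P (x - e *: p) = x.
  have h1 := upgrad_prox e0 hp (P (x - e *: p)).
  have h2 := prox_max M (x - e *: p) x.
  apply/eqP; rewrite -subr_eq0; apply/eqP; apply: dotv_eq0.
  apply/eqP; rewrite eq_le dotv_ge0 andbT.
  have eC : 0 < (e^-1 - C) / 2.
    have h3 := ler_wpM2l (ltW e0) (sol_C_le H); have h4 := prox_small M.
    rewrite divr_gt0 // subr_gt0 -[e^-1]mulr1 ltr_pdivlMl //; lra.
  rewrite -(ler_pM2l eC) mulr0.
  by move: h1 h2; move: (u _ - _) (u _ - _) (_ / 2 * _) => *; lra.
split=> //; have := prox_shift M (x - e *: p); rewrite Px => /esym.
move: (q _) => q0 h; have /eqP : e *: q0 = e *: p.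
  by apply: (addrI (x - e *: p)); rewrite h subrK.
by rewrite -subr_eq0 -scalerBr scaler_eq0 gt_eqF //= subr_eq0 => /eqP.
Qed.

Variables (xi : R -> 'rV[R]_d).
Hypothesis xi_lip : locally_lipschitz [set t | 0 <= t] xi.
Hypothesis xi_flow : {ae (@lebesgue_measure R), forall t, 0 <= t ->
  derivable xi t 1 /\ superdifferential u (xi t) (derive1 xi t)}.

Lemma singular_propagates_short t0 T : 0 <= t0 -> t0 <= T ->
  4 * (C + 1) * (T - t0) <= 1 -> Sing u (xi t0) -> Sing u (xi T).
Proof.
move=> t00 t0T Tshort /(singular_upgrad H)[p0 hp0 hlt] /=.
move=> /(differentiable_upgrad H) /(_ super_up sub_ge)[p [hp huniq]].
have K1 := sol_K_ge1 H; have C0 := sol_C_gt0 H; have CK := sol_C_le H.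
have K0 : 0 < K by exact: lt_le_trans K1.
have [c0 c0E] : exists c0 : R, c0 = - (2^-1 * dotv p0 p0 + V (xi t0)) by eexists.
have c00 : 0 < c0 by rewrite c0E oppr_gt0.
(* Differentiability at [xi T] leaves one momentum, of zero defect; nearby supergradients then have
   defect at most [c0 / 16]. *)
have [dl dl0 hdl] : exists2 dl : R, 0 < dl & forall z q, enorm (z - xi T) < dl ->
    upgrad u C z q -> - (2^-1 * dotv q q) - V z <= c0 / 16.
  pose eta := Num.min 1 (c0 / (32 * (4 * K + 1))).
  have X0 : 0 < 32 * (4 * K + 1) by rewrite mulr_gt0 // addr_gt0 // mulr_gt0.
  have eta0 : 0 < eta by rewrite lt_min ltr01 divr_gt0.
  have eta1 : eta <= 1 by rewrite ge_min lexx.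
  have etaX : eta * (32 * (4 * K + 1)) <= c0 by rewrite -ler_pdivlMr // ge_min lexx orbT.
  have [r r0 hr] := upgrad_unique_near H huniq eta0.
  pose dl := Num.min r (Num.min 1 (c0 / (64 * K))).
  have K64 : 0 < 64 * K by exact: mulr_gt0.
  exists dl => [|z q]; first by rewrite !lt_min r0 ltr01 divr_gt0.
  rewrite !lt_min => /and3P[zr /ltW z1]; rewrite ltr_pdivlMr // => /ltW zc hq.
  have qp := ltW (hr z q zr hq).
  have q2 := upgrad_le H hq.
  have h1 : dotv p p - dotv q q <= eta * (4 * K + 1).
    have -> : dotv p p - dotv q q = dotv (p - q) (2 *: q + (p - q)).
      by rewrite !dotvE (dotvC q p); ring.
    apply: le_trans (dotv_le _ _) _; rewrite enormB ler_pM ?enorm_ge0 //.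
    apply: le_trans (enormD _ _) _; rewrite enormZ ger0_norm // enormB.
    by move: qp q2; move: (enorm _) (enorm _) => *; lra.
  have := V_lipschitz H (xi T) (z - xi T); rewrite [xi T + _]addrC subrK -enorm_sqr.
  rewrite ler_norml => /andP[h2 _].
  have h3 : K * enorm (z - xi T) ^+ 2 <= K * enorm (z - xi T).
    by rewrite ler_wpM2l ?(ltW K0) // expr2 ler_piMr ?enorm_ge0.
  move: h1 h2 h3 zc etaX hp; move: (enorm _) (enorm _ ^+ 2) (dotv p p) (dotv q q) (V _) (V _) (eta) => *; lra.
(* Chosen so that [N (dl / 2)^2 > 2 K]: a maximizer at time [T] with positive value must lie within
   [dl / 2] of [xi T]. *)
pose N := 1 + 8 * K / dl ^+ 2.
have dl2 : 0 < dl ^+ 2 by rewrite exprn_gt0.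
have N0 : 0 <= 8 * K / dl ^+ 2 by rewrite divr_ge0 ?mulr_ge0 // ltW.
have N1 : 1 <= N by rewrite lerDl.
(* The losses per unit of [e]: passing from [prox_defect] to [defect] at the start, the initial
   distance penalty, and the decrease of the maximum. Taking [2 e rt <= c0] preserves [c0 / 2]. *)
pose rt := 3 * K ^+ 2 + 8 * N * K ^+ 2 + (24 * K ^+ 3 + 64 * N * K ^+ 4 + 1).
have rt0 : 0 < rt.
  have NN : 0 <= N by exact: le_trans N1.
  have k2 := exprn_gt0 2 K0; have k3 := exprn_ge0 3 (ltW K0); have k4 := exprn_ge0 4 (ltW K0).
  have := mulr_ge0 NN (ltW k2); have := mulr_ge0 NN k4.
  by rewrite /rt; move: k2 k3; move: (K ^+ 2) (K ^+ 3) (K ^+ 4) (N) => *; lra.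
pose e := Num.min (Num.min (1 / (8 * K)) (dl / (8 * K)))
  (Num.min (c0 / (24 * K ^+ 2)) (c0 / (2 * rt))).
have K8 : 0 < 8 * K by exact: mulr_gt0.
have K24 : 0 < 24 * K ^+ 2 by rewrite mulr_gt0 // exprn_gt0.
have rt2 : 0 < 2 * rt by exact: mulr_gt0.
have e0 : 0 < e by rewrite !lt_min !divr_gt0.
have [e1 e2 e3 e4] : [/\ e * (8 * K) <= 1, e * (8 * K) <= dl, e * (24 * K ^+ 2) <= c0 &
    e * (2 * rt) <= c0].
  have := lexx e; rewrite {2}/e !le_min => /andP[/andP[]].
  by rewrite !ler_pdivlMr // => -> -> /andP[-> ->].
have eK : 8 * e * K <= 1 by move: e1; move: (e) => *; lra.
have [P [q M]] := proximal_map_exists e0 eK.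
have [Py qy] := proximal_map_of_upgrad M hp0.
have [E0 [mE E00 hE]] := xi_flow.
have flow t : ~ E0 t -> 0 <= t -> derivable xi t 1 /\ upgrad u C (xi t) (derive1 xi t).
  move=> nE tt; have [dx sx] : derivable xi t 1 /\ superdifferential u (xi t) (derive1 xi t).
    by apply: contrapT => no; apply: nE; apply: hE => /= h; apply: no; exact: h.
  by split => //; exact: super_up.
have negE : (@lebesgue_measure R).-negligible E0 by exists E0; split.
have lip t : 0 <= t -> exists l r : R, [/\ 0 <= l, 0 < r &
    forall s s', 0 <= s -> 0 <= s' -> `|s - t| <= r -> `|s' - t| <= r ->
    enorm (xi s' - xi s) <= l * `|s' - s|].
  by move=> tt; exact: (locally_lipschitz_enorm tt xi_lip).
(* At this starting point the proximal point is exactly [xi t0] and the gradient is exactly [p0], so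
   the full defect [c0] is available. *)
have [x hx] := penalized_reach H M N1 t00 t0T Tshort lip (xi t0 - e *: p0) negE flow.
set y0 := xi t0 - e *: p0 in hx Py qy.
have phi_y0 : prox_defect V P q y0 = c0 by rewrite /prox_defect Py qy c0E opprD.
have e1' : e <= 1.
  by have := ler_wpM2l (ltW e0) K1; move: e1; move: (e) => *; lra.
have p0_le : dotv p0 p0 <= 4 * K ^+ 2.
  rewrite -enorm_sqr; have -> : 4 * K ^+ 2 = (2 * K) ^+ 2 by ring.
  exact: ler_sqr_mono (enorm_ge0 _) (upgrad_le H hp0).
have start : c0 - 3 * K ^+ 2 * e - 8 * N * K ^+ 2 * e <=
    penalized V C q xi t0 N t0 y0.
  have near := defect_near H M y0; rewrite phi_y0 ler_norml in near.
  have -> : penalized V C q xi t0 N t0 y0 = defect V q y0 - 2 * N * (e ^+ 2 * dotv p0 p0).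
    rewrite /penalized /y0 [xi t0 - _]addrC addrK subrr !mulr0 addr0 subr0 mul1r.
    by rewrite dotvNl dotvNr opprK dotvZl dotvZr; ring.
  have h1 : N * (e ^+ 2 * dotv p0 p0) <= N * (e * (4 * K ^+ 2)).
    rewrite ler_wpM2l ?(le_trans ler01) // ler_pM ?sqr_ge0 ?dotv_ge0 //.
    by rewrite expr2 ler_piMl // ltW.
  move: near => /andP[near _]; move: near h1.
  by move: (defect _ _ _) (N) (K ^+ 2) (_ * dotv _ _) => *; lra.
have {hx start} hx : c0 / 2 <= penalized V C q xi t0 N T x.
  apply: le_trans hx; move: start e4; rewrite /rt.
  by move: (K ^+ 2) (K ^+ 3) (K ^+ 4) (N) (penalized _ _ _ _ _ _ _ _) => *; lra.
have T0 : 0 <= T - t0 by rewrite subr_ge0.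
have CT : 0 <= C * (T - t0) by rewrite mulr_ge0 // ltW.
have [a aE] : exists a : R, a = 1 + 4 * C * (T - t0) by eexists.
have [b bE] : exists b : R, b = 2 - 4 * (C + 1) * (T - t0) by eexists.
have [a1 a2 b1] : [/\ 1 <= a, a <= 2 & 1 <= b].
  by rewrite aE bE; move: Tshort; split; lra.
rewrite /penalized -aE -bE in hx.
have D0 := dotv_ge0 (x - xi T).
have NbD : dotv (x - xi T) (x - xi T) <= N * b * dotv (x - xi T) (x - xi T) /\
    N * dotv (x - xi T) (x - xi T) <= N * b * dotv (x - xi T) (x - xi T).
  have N00 : 0 <= N by exact: le_trans N1.
  by split; [rewrite ler_peMl // -[1]mulr1 ler_pM | rewrite ler_wpM2r // ler_peMr].
have a0 : 0 <= a by exact: le_trans a1.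
have psi_c0 : c0 / 4 <= defect V q x.
  have psi0 : 0 <= defect V q x.
    have : 0 <= a * defect V q x.
      case: NbD; move: hx; move: (dotv _ _) (N * b * _) (a * _) D0 => *; lra.
    by rewrite pmulr_rge0 // (lt_le_trans ltr01).
  have h2 : a * defect V q x <= 2 * defect V q x by rewrite ler_wpM2r.
  case: NbD; move: hx h2; move: (dotv _ _) (N * b * _) (a * _) D0 => *; lra.
have psiK : defect V q x <= K.
  have /andP[v1 v2] := sol_V_bounds H x; have := dotv_ge0 (q x); rewrite /defect.
  by move: v1 v2; move: (V x) (dotv _ _) => *; lra.
have close : enorm (x - xi T) < dl / 2.
  have : enorm (x - xi T) ^+ 2 < (dl / 2) ^+ 2.
    rewrite enorm_sqr.
    have h2 : a * defect V q x <= 2 * K.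
      by apply: le_trans (ler_wpM2l a0 psiK) _; rewrite ler_wpM2r // ltW.
    have h3 : N * dotv (x - xi T) (x - xi T) <= 2 * K.
      by case: NbD => _; move: hx h2; move: (a * _) (N * b * _) => *; lra.
    have h4 : N * (dl / 2) ^+ 2 = (dl ^+ 2) / 4 + 2 * K.
      by rewrite /N; field; rewrite gt_eqF.
    have N00 : 0 < N by exact: lt_le_trans N1.
    by rewrite -(ltr_pM2l N00) h4; apply: le_lt_trans h3 _; rewrite ltrDr divr_gt0.
  by rewrite ltr_pXn2r ?nnegrE ?enorm_ge0 // divr_ge0 // ltW.
have Pclose : enorm (P x - xi T) < dl.
  have -> : P x - xi T = (P x - x) + (x - xi T) by rewrite addrA subrK.
  apply: le_lt_trans (enormD _ _) _; have := dist_prox_le H M x.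
  by move: dl0 e2 close; move: (enorm _) (enorm _) (dl) => *; lra.
(* The contradiction: [defect V q x] is at least [c0 / 4], but at most [c0 / 16] plus
   [3 K^2 e <= c0 / 8]. *)
have small := hdl _ _ Pclose (mgrad_upgrad H M x).
have := defect_near H M x; rewrite ler_norml => /andP[_].
move: small psi_c0 e3; rewrite -[- _ - V (P x)]/(prox_defect V P q x).
by move: (prox_defect _ _ _ _) (defect _ _ _) (K ^+ 2) => *; lra.
Qed.

(** The admissible step [1 / (4 (C + 1))] does not depend on the size of the defect, which may
    shrink from one step to the next; finitely many steps reach any time. *)
Lemma singular_propagates t : 0 <= t -> Sing u (xi 0) -> Sing u (xi t).
Proof.
move=> t0 sing0; have C0 := sol_C_gt0 H.
have [w wE] : exists w : R, w = 4 * (C + 1) by eexists.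
have w0 : 0 < w by rewrite wE mulr_gt0 // addr_gt0.
have steps n s : 0 <= s -> w * s <= n%:R -> Sing u (xi s).
  elim: n s => [|n IH] s s0.
    rewrite mulr0n pmulr_rle0 // => s0'; suff -> : s = 0 by [].
    by apply/eqP; rewrite eq_le s0 s0'.
  have [sn _|sn] := leP (w * s) n%:R; first exact: IH.
  rewrite -natr1 => sn1; pose s' := n%:R / w.
  have s'w : w * s' = n%:R by rewrite mulrC divfK // gt_eqF.
  have s'0 : 0 <= s' by rewrite divr_ge0 // ltW.
  have s's : s' <= s by rewrite -(ler_pM2l w0) s'w ltW.
  apply: (singular_propagates_short s'0 s's); last by apply: IH; rewrite ?s'w.
  by rewrite -wE mulrBr s'w lerBlDl.
have /archi_boundP wt : 0 <= w * t by rewrite mulr_ge0 // ltW.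
exact: steps t0 (ltW wt).
Qed.

End Propagation.

Theorem theorem14 (R : realType) (d : nat) (V u : 'rV[R]_d -> R)
    (V_per : Zperiodic V) (V_C2 : Ck 2 V)
    (V_max : (forall x, V x <= 0) /\ exists x, V x = 0)
    (u_per : Zperiodic u) (u_sc : semiconcave u)
    (u_sol : viscosity_solution V u)
    (x0 : 'rV[R]_d) (x0_sing : Sing u x0)
    (xi : R -> 'rV[R]_d) (xi_flow : generalized_gradient_flow u x0 xi)
    (t : R) (t_ge0 : 0 <= t) :
  Sing u (xi t).
Proof.
have [C [K [H super_up]]] := semiconcave_solution_exists V_per V_C2 V_max.1 u_per u_sc u_sol.
case: u_sol => _ _ sub_ge; case: xi_flow => xi0 xi_lip xi_ode.
apply: (singular_propagates H _ _ xi_lip xi_ode t_ge0).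
- exact: super_up.
- by move=> x p /sub_ge; rewrite enorm_sqr.
- by rewrite xi0.
Qed.
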